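(* For $n$ points with $|C|$ colors, a minimum length (crossing-free) backbone labeling with infinite backbones can be computed in $O\bigl(n^2\cdot\prod_{i=1}^{|C|}k_i\bigr)$ time if at most $k_i$ labels are allowed for color $i$, $i=1,\dots,|C|$, and in $O(n^2\cdot K)$ time if in total at most $K$ labels are allowed.
   Context: Setting: $P=\{p_1,\dots,p_n\}$ is a finite set of points in an axis-aligned rectangle $R$; each point $p$ has a color $c(p)$ from a finite color set $C=\{1,\dots,|C|\}$; no two points share the same $x$- or the same $y$-coordinate, and the points are given in decreasing order of $y$-coordinate ($p_1$ topmost). By abuse of notation $p_i$ also denotes the $y$-coordinate of the $i$th point. A backbone labeling of $P$ consists of a finite set $\mathcal L$ of colored labels on the boundary (left or right side) of $R$, together with an assignment of each point $p\in P$ to a label in $\mathcal L$ of color $c(p)$. A label $l$ is described by its color $c(l)$, the $y$-coordinate $y(l)$ of its backbone, and the set $P(l)$ of points assigned to it. The backbone leader of $l$ consists of a horizontal segment at height $y(l)$ (the backbone) together with, for each $p\in P(l)$, the vertical segment joining $p$ to the backbone. An infinite backbone spans the whole width of $R$. Leaders of distinct labels may not overlap. The labeling is crossing-free if leaders of distinct labels do not cross, i.e. are disjoint. Placement convention: a backbone may pass through an input point of its own color; otherwise it must keep the distance to the points that is required by the label heights. That is, for each $i$ there are given positions $p_i^-$ and $p_i^+$, the closest positions immediately above and below $p_i$ that the label heights allow, with $p_1^->p_1>p_1^+>p_2^->p_2>p_2^+>\dots>p_n^->p_n>p_n^+$, and a backbone not passing through a point lies at a height $\geq p_1^-$, or at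 a height $\leq p_n^+$, or in $[p_{i+1}^-,p_i^+]$ for some $1\le i<n$. Length: the length of a labeling is $\lambda\cdot|\mathcal L|$ plus the sum of the lengths of all vertical segments, where either $\lambda=0$ (only vertical segments are counted) or $\lambda$ is the width of $R$ (backbones are counted as well); the result holds for both choices. Bounds on the number of labels are either a color vector $(k_1,\dots,k_{|C|})$ (at most $k_i$ labels of color $i$) or a global bound $K\ge|C|$ on the total number of labels. *)

(* Defs.v *)
From mathcomp Require Import all_boot all_order all_algebra.
From mathcomp Require Import classical_sets reals.

Set Implicit Arguments.
Unset Strict Implicit.
Unset Printing Implicit Defensive.

Import Order.TTheory GRing.Theory Num.Theory.
Local Open Scope ring_scope.

(** * Backbone labelings *)

(* Points are numbered from 0, topmost first; colors are numbered from 0.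
   [yminus i] and [yplus i] are the closest admissible backbone heights
   immediately above and immediately below point [i].  The superscripts follow
   the top-down numbering, so "minus" is the upper one. *)
Record instance (R : realType) := Instance {
  npts : nat;
  ncol : nat;
  xleft : R;
  xright : R;
  ybot : R;
  ytop : R;
  px : 'I_npts -> R;
  py : 'I_npts -> R;
  yminus : 'I_npts -> R;
  yplus : 'I_npts -> R;
  pcol : 'I_npts -> 'I_ncol }.

Arguments px {R} _ _.
Arguments py {R} _ _.
Arguments yminus {R} _ _.
Arguments yplus {R} _ _.
Arguments pcol {R} _ _.

(* Distinctness of the y-coordinates follows from the last two clauses. *)
Definition wf_instance (R : realType) (I : instance R) : Prop :=
  [/\ (0 < npts I)%N,
      xleft I < xright I /\ ybot I < ytop I,
      forall i, xleft I <= px I i <= xright I /\ ybot I <= py I i <= ytop I,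
      injective (px I) &
      (forall i, yplus I i < py I i /\ py I i < yminus I i) /\
      (forall i j : 'I_(npts I), j = i.+1 :> nat -> yminus I j < yplus I i)].

(* A label may have no point assigned to it. *)
Record labeling (R : realType) (I : instance R) := Labeling {
  nlab : nat;
  lcol : 'I_nlab -> 'I_(ncol I);
  lht : 'I_nlab -> R;
  asg : 'I_(npts I) -> 'I_nlab }.

Section Labelings.
Variables (R : realType) (I : instance R).
Implicit Type L : labeling I.

Definition backbone L (l : 'I_(nlab L)) : set (R * R) :=
  [set q | q.2 = lht l /\ xleft I <= q.1 <= xright I]%classic.

Definition vsegment L (p : 'I_(npts I)) : set (R * R) :=
  let h := lht (asg L p) in
  [set q | q.1 = px I p /\
           Num.min (py I p) h <= q.2 <= Num.max (py I p) h]%classic.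

Definition leader L (l : 'I_(nlab L)) : set (R * R) :=
  (backbone l `|` \bigcup_(p in [set p | asg L p = l]) vsegment L p)%classic.

Definition crossing_free L : Prop :=
  forall l1 l2 : 'I_(nlab L), l1 <> l2 ->
    (leader l1 `&` leader l2 = set0)%classic.

Definition through_own_point L (l : 'I_(nlab L)) : Prop :=
  exists i : 'I_(npts I), lht l = py I i /\ lcol l = pcol I i.

Definition keeps_distance (h : R) : Prop :=
  [\/ exists i : 'I_(npts I), i = 0%N :> nat /\ yminus I i <= h,
      exists i : 'I_(npts I), i.+1 = npts I /\ h <= yplus I i |
      exists i j : 'I_(npts I), j = i.+1 :> nat /\ yminus I j <= h <= yplus I i].

Definition backbone_labeling L : Prop :=
  [/\ forall p, lcol (asg L p) = pcol I p,
      forall l : 'I_(nlab L), ybot I <= lht l <= ytop I,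
      forall l : 'I_(nlab L), through_own_point l \/ keeps_distance (lht l) &
      crossing_free L].

(* [count_backbones] selects whether the horizontal segments are counted. *)
Definition labeling_length (count_backbones : bool) L : R :=
  (if count_backbones then xright I - xleft I else 0) * (nlab L)%:R
  + \sum_(p < npts I) `|py I p - lht (asg L p)|.

Definition color_bounded (k : 'I_(ncol I) -> nat) L : Prop :=
  forall c, (#|[pred l : 'I_(nlab L) | lcol l == c]| <= k c)%N.

Definition total_bounded (K : nat) L : Prop := (nlab L <= K)%N.

End Labelings.

(** * Real RAM *)

(* Random-access machine over natural numbers and reals, programmed with
   structured control flow.  Memory consists of natural-number arrays and real
   arrays, each of unbounded length.  Array names are literals of the program
   text, so a program uses finitely many arrays; cells are addressed by computed
   natural numbers.  Every node of the syntax tree that is evaluated costs one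
   time unit.  Natural numbers are unbounded, hence they can only be added,
   subtracted and compared: unit-cost multiplication would make the model
   unrealistically strong.  Reals cannot be converted to natural numbers. *)

Inductive iexp : Type :=
  | IConst of nat
  | ILoad of nat & iexp
  | IAdd of iexp & iexp
  | ISub of iexp & iexp.

Inductive rexp : Type :=
  | RConst of nat
  | RLoad of nat & iexp
  | RAdd of rexp & rexp
  | RSub of rexp & rexp
  | RMul of rexp & rexp.

Inductive bexp : Type :=
  | BILe of iexp & iexp
  | BRLe of rexp & rexp
  | BNot of bexp
  | BAnd of bexp & bexp.

(* [IStore a i e] and [RStore a i e] write [e] to cell [i] of array [a]. *)
Inductive com : Type :=
  | Skip
  | IStore of nat & iexp & iexp
  | RStore of nat & iexp & rexp
  | Seq of com & com
  | If of bexp & com & com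
  | While of bexp & com.

Fixpoint icost (e : iexp) : nat :=
  match e with
  | IConst _ => 1
  | ILoad _ i => (icost i).+1
  | IAdd e1 e2 | ISub e1 e2 => (icost e1 + icost e2).+1
  end.

Fixpoint rcost (e : rexp) : nat :=
  match e with
  | RConst _ => 1
  | RLoad _ i => (icost i).+1
  | RAdd e1 e2 | RSub e1 e2 | RMul e1 e2 => (rcost e1 + rcost e2).+1
  end.

Fixpoint bcost (b : bexp) : nat :=
  match b with
  | BILe e1 e2 => (icost e1 + icost e2).+1
  | BRLe e1 e2 => (rcost e1 + rcost e2).+1
  | BNot b1 => (bcost b1).+1
  | BAnd b1 b2 => (bcost b1 + bcost b2).+1
  end.

Record state (R : realType) := State {
  imem : nat -> nat -> nat;
  rmem : nat -> nat -> R }.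

Definition upd (T : Type) (m : nat -> nat -> T) (a i : nat) (v : T) :
    nat -> nat -> T :=
  fun a' i' => if (a' == a) && (i' == i) then v else m a' i'.

Section Semantics.
Variable R : realType.
Implicit Type s : state R.

Fixpoint ieval s (e : iexp) : nat :=
  match e with
  | IConst k => k
  | ILoad a i => imem s a (ieval s i)
  | IAdd e1 e2 => (ieval s e1 + ieval s e2)%N
  | ISub e1 e2 => (ieval s e1 - ieval s e2)%N
  end.

Fixpoint reval s (e : rexp) : R :=
  match e with
  | RConst k => k%:R
  | RLoad a i => rmem s a (ieval s i)
  | RAdd e1 e2 => reval s e1 + reval s e2
  | RSub e1 e2 => reval s e1 - reval s e2
  | RMul e1 e2 => reval s e1 * reval s e2
  end.

Fixpoint beval s (b : bexp) : bool :=
  match b with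
  | BILe e1 e2 => (ieval s e1 <= ieval s e2)%N
  | BRLe e1 e2 => reval s e1 <= reval s e2
  | BNot b1 => ~~ beval s b1
  | BAnd b1 b2 => beval s b1 && beval s b2
  end.

(* [exec c s t s']: started in [s], [c] halts in [s'] after [t] time units. *)
Inductive exec : com -> state R -> nat -> state R -> Prop :=
  | ExecSkip s : exec Skip s 1 s
  | ExecIStore s a i e :
      exec (IStore a i e) s (icost i + icost e).+1
        (State (upd (imem s) a (ieval s i) (ieval s e)) (rmem s))
  | ExecRStore s a i e :
      exec (RStore a i e) s (icost i + rcost e).+1
        (State (imem s) (upd (rmem s) a (ieval s i) (reval s e)))
  | ExecSeq c1 c2 s1 s2 s3 t1 t2 :
      exec c1 s1 t1 s2 -> exec c2 s2 t2 s3 ->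
      exec (Seq c1 c2) s1 (t1 + t2).+1 s3
  | ExecIfTrue b c1 c2 s s' t :
      beval s b -> exec c1 s t s' -> exec (If b c1 c2) s (bcost b + t).+1 s'
  | ExecIfFalse b c1 c2 s s' t :
      ~~ beval s b -> exec c2 s t s' -> exec (If b c1 c2) s (bcost b + t).+1 s'
  | ExecWhileTrue b c s1 s2 s3 t1 t2 :
      beval s1 b -> exec c s1 t1 s2 -> exec (While b c) s2 t2 s3 ->
      exec (While b c) s1 (bcost b + t1 + t2).+1 s3
  | ExecWhileFalse b c s :
      ~~ beval s b -> exec (While b c) s (bcost b).+1 s.

End Semantics.

(** * The computational problem *)

Definition arr (T : Type) (z : T) (n : nat) (f : 'I_n -> T) (j : nat) : T :=
  if insub j is Some i then f i else z.

(* Input: natural-number array 0 holds the number of points and the number of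
   colors, array 1 the colors of the points, array 2 the bounds on the number of
   labels; real array 0 holds the rectangle and arrays 1 to 4 the coordinates
   and the admissible heights around the points.  All other cells are 0. *)
Definition init_state (R : realType) (I : instance R) (bound : nat -> nat) :
    state R :=
  State
    (fun a j => match a with
                | 0 => nth 0%N [:: npts I; ncol I] j
                | 1 => arr 0%N (fun i => val (pcol I i)) j
                | 2 => bound j
                | _ => 0%N
                end)
    (fun a j => match a with
                | 0 => nth 0 [:: xleft I; xright I; ybot I; ytop I] j
                | 1 => arr 0 (px I) j
                | 2 => arr 0 (py I) j
                | 3 => arr 0 (yminus I) j
                | 4 => arr 0 (yplus I) j
                | _ => 0
                end).

Definition color_bounds_input (q : nat) (k : 'I_q -> nat) : nat -> nat :=
  arr 0%N k.

Definition total_bound_input (K : nat) : nat -> nat := nth 0%N [:: K].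

(* Output: natural-number array 3 holds the success flag and the number of
   labels, array 4 the colors of the labels, array 5 the label assigned to each
   point; real array 5 holds the heights of the labels. *)
Definition outputs (R : realType) (I : instance R) (s : state R)
    (L : labeling I) : Prop :=
  [/\ imem s 3 0 = 1%N, imem s 3 1 = nlab L,
      (forall l : 'I_(nlab L), imem s 4 l = lcol l),
      (forall l : 'I_(nlab L), rmem s 5 l = lht l) &
      (forall p : 'I_(npts I), imem s 5 p = asg L p)].

Definition reports_infeasible (R : realType) (s : state R) : Prop :=
  imem s 3 0 = 0%N.

Definition minimum_length (R : realType) (I : instance R)
    (count_backbones : bool) (admissible : labeling I -> Prop)
    (L : labeling I) : Prop :=
  [/\ backbone_labeling L, admissible L &
      forall L' : labeling I, backbone_labeling L' -> admissible L' ->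
        labeling_length count_backbones L <= labeling_length count_backbones L'].

(* [prog] halts within [T] time units, either with a minimum-length labeling
   among the admissible ones or, if there is none at all, with a report of
   infeasibility. *)
Definition computes_minimum (R : realType) (I : instance R) (prog : com)
    (bound : nat -> nat) (count_backbones : bool)
    (admissible : labeling I -> Prop) (T : nat) : Prop :=
  exists (t : nat) (s : state R),
    [/\ exec prog (init_state I bound) t s, (t <= T)%N &
        (exists L, outputs s L /\ minimum_length count_backbones admissible L)
        \/ (reports_infeasible s /\
            ~ exists L, backbone_labeling L /\ admissible L)].

(* Main.v *)
Require Import Defs.
From mathcomp Require Import all_boot all_order all_algebra.
From mathcomp Require Import zify ring lra.
From mathcomp Require Import classical_sets reals.

Set Implicit Arguments.
Unset Strict Implicit.
Unset Printing Implicit Defensive.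

Import Order.TTheory GRing.Theory Num.Theory.
Local Open Scope nat_scope.

(* An infinite backbone cannot cross the vertical segments of another label, so
   the points strictly between two consecutive backbones carry only the two
   colors of these backbones.  With the assignment fixed, the length is linear in
   the height of a backbone between two consecutive points; hence a backbone can
   be moved to an adjacent point of its own label or, if the adjacent point
   belongs to another label, as close to that point as allowed.  In the latter
   case its color is the first color other than that of the adjacent point on the
   side on which it serves points.  This leaves O(n) candidates (position, color),
   and a labeling becomes a path through the candidates, whose edge weights are
   differences of entries of an O(n) by O(n) table.  Two consecutive backbones of
   the same color are joined through a separator node marking where the points
   change over.

   The shortest path is computed with a budget.  When every label serves a point,
   the first label of each color is forced, so it is free and only the
   others are charged: for a color vector the budget is a mixed-radix number with
   [k_c] possible digits for each occurring color [c], and for a global bound [K]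
   it is [K] minus the number of occurring colors.  Not charging the first label
   keeps the number of budgets below the product of the [k_c] (or below [K]); a
   label is recognized as the first of its color by looking at the points above
   the preceding backbone. *)

(** * Reasoning about programs *)

(** A crossing-free assignment may serve two points of one color in the wrong order, the upper point
    from the lower backbone. Such a labeling is not a chain, so the given assignment is replaced by
    a cheapest crossing-free one on the same backbones, in which this cannot happen. Then every
    backbone is moved on its own, as the length splits over the labels; the point to check is that
    these moves preserve the order of the backbones.

    The time bounds do not mention the number of colors, which may exceed the number of points.
    Hence no loop runs over the colors: tables are indexed by nodes, and the occurring colors are
    found by scanning the points. The machine cannot multiply or divide natural numbers, so row
    offsets are stored, remainders are kept by counters that wrap around, and the number of budgets
    is built by repeated addition. *)

Fixpoint imods (c : com) : seq nat :=
  match c with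
  | IStore a _ _ => [:: a]
  | Seq c1 c2 | If _ c1 c2 => imods c1 ++ imods c2
  | While _ c1 => imods c1
  | _ => [::]
  end.

Fixpoint rmods (c : com) : seq nat :=
  match c with
  | RStore a _ _ => [:: a]
  | Seq c1 c2 | If _ c1 c2 => rmods c1 ++ rmods c2
  | While _ c1 => rmods c1
  | _ => [::]
  end.

Fixpoint loop_free (c : com) : bool :=
  match c with
  | Seq c1 c2 | If _ c1 c2 => loop_free c1 && loop_free c2
  | While _ _ => false
  | _ => true
  end.

(** An upper bound computed from the text of a loop-free command: both branches of a conditional are
    added up, which is crude but evaluates to a numeral. The value for loops is meaningless. *)
Fixpoint ccost (c : com) : nat :=
  match c with
  | Skip => 1
  | IStore _ i e => (icost i + icost e).+1
  | RStore _ i e => (icost i + rcost e).+1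
  | Seq c1 c2 => (ccost c1 + ccost c2).+1
  | If b c1 c2 => (bcost b + (ccost c1 + ccost c2)).+1
  | While _ _ => 0
  end.

Notation V a := (ILoad a (IConst 0)).
Notation RV a := (RLoad a (IConst 0)).
Notation "a [ i ]<- e" := (IStore a i e) (at level 60, i at level 200).
Notation "a [ i ]<~ e" := (RStore a i e) (at level 60, i at level 200).
Notation "a <-- e" := (IStore a (IConst 0) e) (at level 60).
Notation "a <~~ e" := (RStore a (IConst 0) e) (at level 60).
Notation "c1 ;; c2" := (Seq c1 c2) (at level 62, right associativity).
Notation BIEq e1 e2 := (BAnd (BILe e1 e2) (BILe e2 e1)).

(* The bound is reread at every iteration, so it must live in a scalar that the
   body does not modify. *)
Definition For (x lim : nat) (body : com) : com :=
  x <-- IConst 0 ;;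
  While (BNot (BILe (V lim) (V x))) (body ;; x <-- IAdd (V x) (IConst 1)).

Section Machine.
Variable R : realType.
Implicit Types (s : state R) (Q : state R -> Prop).

Definition frame (mi mr : seq nat) s s' : Prop :=
  (forall a, a \notin mi -> imem s' a = imem s a) /\
  (forall a, a \notin mr -> rmem s' a = rmem s a).

Lemma frame_refl mi mr s : frame mi mr s s. Proof. by []. Qed.

Lemma frame_trans mi mr s1 s2 s3 :
  frame mi mr s1 s2 -> frame mi mr s2 s3 -> frame mi mr s1 s3.
Proof.
move=> [h1 h2] [h3 h4]; split=> a ha; first by rewrite h3 // h1.
by rewrite h4 // h2.
Qed.

Lemma frame_sub mi mr mi' mr' s s' :
  {subset mi <= mi'} -> {subset mr <= mr'} ->
  frame mi mr s s' -> frame mi' mr' s s'.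
Proof.
move=> hi hr [h1 h2]; split=> a ha.
  by apply: h1; apply: contra ha; apply: hi.
by apply: h2; apply: contra ha; apply: hr.
Qed.

Lemma frame_cat mi mr mi' mr' s1 s2 s3 :
  frame mi mr s1 s2 -> frame mi' mr' s2 s3 ->
  frame (mi ++ mi') (mr ++ mr') s1 s3.
Proof.
move=> [h1 h2] [h3 h4]; split=> a; rewrite mem_cat negb_or => /andP [ha hb].
  by rewrite h3 // h1.
by rewrite h4 // h2.
Qed.

Lemma upd_other T (m : nat -> nat -> T) a i v a' :
  a' != a -> upd m a i v a' = m a'.
Proof. by rewrite /upd => /negbTE ->. Qed.

Lemma exec_frame c s t s' : exec c s t s' -> frame (imods c) (rmods c) s s'.
Proof.
elim=> {c s t s'} //=.
- by move=> s a i e; split=> //= b; rewrite inE => hb; rewrite upd_other.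
- by move=> s a i e; split=> //= b; rewrite inE => hb; rewrite upd_other.
- move=> c1 c2 s1 s2 s3 t1 t2 _ h1 _ h2.
  apply: (@frame_trans _ _ _ s2); [move: h1 | move: h2]; apply: frame_sub;
  by move=> a; rewrite mem_cat => ->; rewrite ?orbT.
- move=> b c1 c2 s s' t _ _; apply: frame_sub;
  by move=> a; rewrite mem_cat => ->; rewrite ?orbT.
- move=> b c1 c2 s s' t _ _; apply: frame_sub;
  by move=> a; rewrite mem_cat => ->; rewrite ?orbT.
- by move=> b c s1 s2 s3 t1 t2 _ _ h1 _ h2; apply: (frame_trans h1).
Qed.

(** Total correctness with a time limit. The start state is an argument, so preconditions are
    ordinary hypotheses about it. *)
Definition runs (c : com) s (T : nat) Q : Prop :=
  exists t s', [/\ exec c s t s', t <= T & Q s'].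

Lemma runs_weaken c s T T' Q Q' :
  runs c s T Q -> T <= T' -> (forall s', Q s' -> Q' s') -> runs c s T' Q'.
Proof.
move=> [t [s' [h1 h2 h3]]] hT hQ; exists t, s'; split=> //.
- exact: leq_trans hT.
- exact: hQ.
Qed.

Lemma runs_frame c s T Q :
  runs c s T Q ->
  runs c s T (fun s' => Q s' /\ frame (imods c) (rmods c) s s').
Proof.
move=> [t [s' [h1 h2 h3]]]; exists t, s'; split=> //; split=> //.
exact: exec_frame h1.
Qed.

Lemma runs_seq c1 c2 s T1 T2 Q1 Q :
  runs c1 s T1 Q1 -> (forall s', Q1 s' -> runs c2 s' T2 Q) ->
  runs (c1 ;; c2) s (T1 + T2).+1 Q.
Proof.
move=> [t1 [s1 [h1 h2 h3]]] /(_ _ h3) [t2 [s2 [k1 k2 k3]]].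
exists (t1 + t2).+1, s2; split=> //; first exact: ExecSeq h1 k1.
by rewrite ltnS leq_add.
Qed.

Lemma runs_if b c1 c2 s T Q :
  (beval s b -> runs c1 s T Q) -> (~~ beval s b -> runs c2 s T Q) ->
  runs (If b c1 c2) s (bcost b + T).+1 Q.
Proof.
move=> h1 h2; case: (boolP (beval s b)) => hb.
  have [t [s' [k1 k2 k3]]] := h1 hb; exists (bcost b + t).+1, s'; split=> //.
    exact: ExecIfTrue.
  by rewrite ltnS leq_add2l.
have [t [s' [k1 k2 k3]]] := h2 hb; exists (bcost b + t).+1, s'; split=> //.
  exact: ExecIfFalse.
by rewrite ltnS leq_add2l.
Qed.

(* Weakest precondition of a loop-free command, in continuation-passing style so
   that it computes to a decision tree over the final states. *)
Fixpoint wp (c : com) Q s : Prop :=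
  match c with
  | Skip => Q s
  | IStore a i e =>
      Q (State (upd (imem s) a (ieval s i) (ieval s e)) (rmem s))
  | RStore a i e =>
      Q (State (imem s) (upd (rmem s) a (ieval s i) (reval s e)))
  | Seq c1 c2 => wp c1 (wp c2 Q) s
  | If b c1 c2 => if beval s b then wp c1 Q s else wp c2 Q s
  | While _ _ => False
  end.

Lemma runs_wp c s Q : loop_free c -> wp c Q s -> runs c s (ccost c) Q.
Proof.
elim: c s Q => //=.
- by move=> s Q _ h; exists 1, s; split=> //; apply: ExecSkip.
- move=> a i e s Q _ h.
  by eexists _, _; split; [exact: ExecIStore | exact: leqnn | exact: h].
- move=> a i e s Q _ h.
  by eexists _, _; split; [exact: ExecRStore | exact: leqnn | exact: h].
- move=> c1 h1 c2 h2 s Q /andP [l1 l2] h.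
  by apply: runs_seq (h1 _ _ l1 h) _ => s'; apply: h2.
- move=> b c1 h1 c2 h2 s Q /andP [l1 l2] h.
  have: runs (If b c1 c2) s (bcost b + maxn (ccost c1) (ccost c2)).+1 Q.
    apply: runs_if => hb; move: h; rewrite ?hb ?(negbTE hb).
      by move=> /(h1 _ _ l1) h; apply: runs_weaken h (leq_maxl _ _) _.
    by move=> /(h2 _ _ l2) h; apply: runs_weaken h (leq_maxr _ _) _.
  move/runs_weaken; apply=> //; rewrite ltnS leq_add2l geq_max.
  by rewrite leq_addr leq_addl.
Qed.

Lemma runs_seq_cost c1 c2 s Q1 Q :
  runs c1 s (ccost c1) Q1 -> (forall s', Q1 s' -> runs c2 s' (ccost c2) Q) ->
  runs (c1 ;; c2) s (ccost (c1 ;; c2)) Q.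
Proof. exact: runs_seq. Qed.

Lemma runs_imp c s T Q Q' :
  runs c s T Q -> (forall s', Q s' -> Q' s') -> runs c s T Q'.
Proof. by move=> h; apply: runs_weaken h (leqnn T). Qed.

Lemma runs_assign a e s x : ieval s e = x ->
  runs (a <-- e) s (ccost (a <-- e)) (fun s' => imem s' a 0 = x).
Proof. by move=> <-; apply: runs_wp => //; rewrite /= /upd !eqxx. Qed.

Definition set_scalar (x v : nat) s : state R :=
  State (upd (imem s) x 0 v) (rmem s).

(** Test, increment and sequencing cost 14 per round; 11 covers the initialization and the failing
    last test. *)
Definition for_time (m B : nat) : nat := m * (B + 14) + 11.

(** The frame condition is handed to each round, so [Inv] only has to describe the cells that the
    body fills; whatever the body leaves alone is recovered from [s0]. The invariant is required
    after the counter has been increased. *)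
Lemma runs_for x lim body s0 m B (Inv : nat -> state R -> Prop) :
  imem s0 lim 0 = m -> lim != x ->
  lim \notin imods body -> x \notin imods body ->
  Inv 0 (set_scalar x 0 s0) ->
  (forall j s, j < m -> Inv j s -> imem s x 0 = j ->
     frame (x :: imods body) (rmods body) s0 s ->
     runs body s B (fun s' => Inv j.+1 (set_scalar x j.+1 s'))) ->
  runs (For x lim body) s0 (for_time m B)
    (fun s => [/\ Inv m s, imem s x 0 = m &
                  frame (x :: imods body) (rmods body) s0 s]).
Proof.
move=> hm hx hl hxb hI0 hstep.
set F := frame _ _.
pose W := While (BNot (BILe (V lim) (V x)))
  (body ;; x <-- IAdd (V x) (IConst 1)).
have loop : forall k j s, j + k = m -> Inv j s -> imem s x 0 = j -> F s0 s ->
    runs W s (k * (B + 14) + 7)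
      (fun s => [/\ Inv m s, imem s x 0 = m & F s0 s]).
  elim=> [|k IH] j s hjk hI hxj hF.
    exists 7, s; split=> //; last by split=> //; rewrite -hjk addn0.
    have -> : 7 = (bcost (BNot (BILe (V lim) (V x)))).+1 by [].
    apply: ExecWhileFalse => /=.
    by rewrite negbK hF.1 ?inE ?negb_or ?hx // hm hxj -hjk addn0.
  have hj : j < m by rewrite -hjk addnS ltnS leq_addr.
  have [t [s1 [e1 e2 [e3 e4]]]] := runs_frame (hstep j s hj hI hxj hF).
  have hx1 : imem s1 x 0 = j by rewrite e4.1.
  have hF1 : F s0 (set_scalar x j.+1 s1).
    apply: (frame_trans hF); split=> a /= ha; last by apply: e4.2.
    move: ha; rewrite inE negb_or => /andP [ha hb].
    by rewrite upd_other // e4.1.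
  have hx2 : imem (set_scalar x j.+1 s1) x 0 = j.+1 by rewrite /= /upd !eqxx.
  have [t2 [s2 [k1 k2 k3]]] :=
    IH j.+1 _ (etrans (addSnnS j k) hjk) e3 hx2 hF1.
  pose b := BNot (BILe (V lim) (V x)).
  exists (bcost b + (t + 6).+1 + t2).+1, s2; split; [| | exact: k3];
    last by rewrite mulSn /=; move: e2 k2; clear; move: (k * _); lia.
  apply: (ExecWhileTrue (s2 := set_scalar x j.+1 s1)) => //.
    by rewrite /= hF.1 ?inE ?negb_or ?hx // hm hxj -ltnNge.
  apply: ExecSeq e1 _.
  have -> : set_scalar x j.+1 s1 =
      State (upd (imem s1) x 0 (imem s1 x 0 + 1)) (rmem s1).
    by rewrite hx1 addn1.
  exact: (ExecIStore s1 x (IConst 0) (IAdd (V x) (IConst 1))).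
have hF0 : F s0 (set_scalar x 0 s0).
  split=> a //=; rewrite inE negb_or => /andP [ha _].
  by rewrite upd_other.
have hx0 : imem (set_scalar x 0 s0) x 0 = 0 by rewrite /= /upd !eqxx.
have [t [s' [h1 h2 h3]]] := loop m 0 _ (add0n m) hI0 hx0 hF0.
exists (3 + t).+1, s'; split=> //; last by rewrite /for_time; lia.
apply: ExecSeq h1.
exact: (ExecIStore s0 x (IConst 0) (IConst 0)).
Qed.

End Machine.

(** * Chains of candidate backbones *)

Record config (R : realType) := Config {
  cfg_n : nat;
  cfg_q : nat;
  cfg_c : nat -> nat;
  cfg_y : nat -> R;
  cfg_ym : nat -> R;
  cfg_yp : nat -> R;
  cfg_lo : R;
  cfg_hi : R;
  cfg_lam : R }.

Section Nodes.
Variables (R : realType) (G : config R).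
Local Notation n := (cfg_n G).
Local Notation q := (cfg_q G).
Local Notation c := (cfg_c G).
Local Notation y := (cfg_y G).
Local Notation ym := (cfg_ym G).
Local Notation yp := (cfg_yp G).
Local Notation ylo := (cfg_lo G).
Local Notation yhi := (cfg_hi G).
Local Notation lam := (cfg_lam G).

(** The color of the nearest point above [t] that is colored differently, or [q]. If the neighbor
    has the same color, its answer is reused, which makes the computation a linear scan. *)
Fixpoint prev_color (t : nat) : nat :=
  if t is t'.+1 then (if c t' == c t then prev_color t' else c t') else q.

(* Indexed from the bottom, as the recursion runs upwards. *)
Fixpoint next_color_rev (j : nat) : nat :=
  if j is j'.+1 then
    let t := n - 1 - j in
    (if c t.+1 == c t then next_color_rev j' else c t.+1)
  else q.

Definition next_color (t : nat) : nat := next_color_rev (n - 1 - t).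

(* Node [4 t] separates point [t - 1] from point [t]; nodes [4 t + 1], [4 t + 2]
   and [4 t + 3] are backbones immediately above, through and immediately below
   point [t].  Separators and impossible backbones get the color [q] of no
   point. *)
Definition nabove (v : nat) : nat := v %/ 4 + (v %% 4 == 3).
(** The interval from [nabove v] to [nbelow v], right end excluded, holds the point on the backbone
    if there is one and is empty otherwise. *)
Definition nbelow (v : nat) : nat := v %/ 4 + (1 < v %% 4).

(** The height 0 of a separator is arbitrary: its color belongs to no point, so it enters no
    length. *)
Definition nheight (v : nat) : R :=
  match (v %% 4)%N with
  | 0%N => 0%R
  | 1%N => ym (v %/ 4)%N
  | 2%N => y (v %/ 4)%N
  | _ => yp (v %/ 4)%N
  end.

Definition ncolor (v : nat) : nat :=
  match v %% 4 with
  | 0 => q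
  | 1 => if (ym (v %/ 4) <= yhi)%R then next_color (v %/ 4) else q
  | 2 => c (v %/ 4)
  | _ => if (ylo <= yp (v %/ 4))%R then prev_color (v %/ 4) else q
  end.

(** Like [wsum] below, a prefix sum: a count or a length over an interval of points is a difference
    of two table entries. *)
Definition cnt (a i : nat) : nat := \sum_(0 <= j < i) (c j == a).

Definition dcnt (a i j : nat) : nat := cnt a j - cnt a i.

Definition wsum (v i : nat) : R :=
  (\sum_(0 <= j < i | c j == ncolor v) `|nheight v - y j|)%R.

(* A backbone immediately below a point must serve something above it, and one
   immediately above a point something below it. *)
Definition edge (u v : nat) : bool :=
  [&& u < v, ncolor u != ncolor v,
      dcnt (ncolor v) (nbelow u) (nabove v) +
      dcnt (ncolor u) (nbelow u) (nabove v) == nabove v - nbelow u,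
      (v %% 4 == 3) <= dcnt (ncolor v) (nbelow u) (nabove v) &
      (u %% 4 == 1) <= dcnt (ncolor u) (nbelow u) (nabove v)].

(** A backbone is paid for on the edge that enters it from above; chains begin at the separator 0,
    so each label is paid for once. A point on its own backbone has distance 0 and lies in none of
    the intervals summed over. *)
Definition weight (u v : nat) : R :=
  ((if ncolor v == q then 0 else lam) +
   (wsum v (nabove v) - wsum v (nbelow u)) +
   (wsum u (nabove v) - wsum u (nbelow u)))%R.

Definition first_use (u v : nat) : bool := cnt (ncolor v) (nbelow u) == 0.

(** [us] runs upwards, from the predecessor of [v] to the topmost node 0, as the tracing back will
    produce it. *)
Definition chain (v : nat) (us : seq nat) : bool :=
  path (fun v u => edge u v) v us && (last v us == 0).

Fixpoint clen (v : nat) (us : seq nat) : R :=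
  if us is u :: us' then (weight u v + clen u us')%R else 0%R.

Fixpoint repeats (v : nat) (us : seq nat) : seq nat :=
  if us is u :: us' then
    if first_use u v then repeats u us' else ncolor v :: repeats u us'
  else [::].

Definition labs (s : seq nat) : seq nat := [seq v <- s | ncolor v != q].

(** Between two neighbors of a chain the color decides. The point on the backbone [v] itself falls
    to [v], as it has the color of [v]. *)
Fixpoint owner (v : nat) (us : seq nat) (i : nat) : nat :=
  if us is u :: us' then
    if nbelow u <= i then (if c i == ncolor v then v else u) else owner u us' i
  else v.

Lemma nodeE t r : r < 4 -> (4 * t + r) %/ 4 = t /\ (4 * t + r) %% 4 = r.
Proof. by move=> hr; rewrite mulnC divnMDl // divn_small // modnMDl modn_small ?addn0. Qed.

Lemma cntS a i : cnt a i.+1 = cnt a i + (c i == a).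
Proof. by rewrite /cnt big_nat_recr. Qed.

Lemma cnt0 a : cnt a 0 = 0. Proof. by rewrite /cnt big_geq. Qed.

Lemma cnt_mono a i j : i <= j -> cnt a i <= cnt a j.
Proof. by move=> h; rewrite /cnt (big_cat_nat (leq0n _) h) //= leq_addr. Qed.

Lemma dcntE a i j : i <= j -> dcnt a i j = \sum_(i <= k < j) (c k == a).
Proof. by move=> h; rewrite /dcnt /cnt (big_cat_nat (leq0n _) h) //= addKn. Qed.

Lemma cnt_gt0P a j : reflect (exists2 i, i < j & c i = a) (0 < cnt a j).
Proof.
apply: (iffP idP) => [|[i hi <-]].
  elim: j => [|j IH]; first by rewrite cnt0.
  rewrite cntS; case: eqP => [<- _|_]; first by exists j.
  by rewrite addn0 => /IH [i hi hc]; exists i => //; apply: ltnW.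
by apply: leq_trans (cnt_mono _ hi); rewrite cntS eqxx addn1.
Qed.

Lemma dcnt_gt0P a i j : i <= j ->
  reflect (exists k, [/\ i <= k, k < j & c k = a]) (0 < dcnt a i j).
Proof.
move=> hij; rewrite dcntE //; apply: (iffP idP) => [|[k [h1 h2 h3]]].
  move=> h; case: (boolP (has (fun k => c k == a) (index_iota i j))).
    case/hasP=> k; rewrite mem_index_iota => /andP [h1 h2] /eqP h3.
    by exists k.
  move=> /hasPn hn; move: h; rewrite big_seq big1 // => k /hn /negbTE -> //.
by rewrite (big_cat_nat h1 (ltnW h2)) //= [X in _ + X]big_ltn // h3 eqxx; lia.
Qed.

Lemma sum_leq1_eq (f : nat -> nat) i j : i <= j -> (forall k, f k <= 1) ->
  (\sum_(i <= k < j) f k == j - i) <->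
  (forall k, i <= k -> k < j -> f k = 1).
Proof.
move=> hij hf; split; last first.
  move=> h; rewrite big_nat (eq_bigr (fun=> 1)).
    by rewrite -big_nat sum_nat_const_nat muln1.
  by move=> k /andP [h1 h2]; apply: h.
rewrite -{1 2 3}(subnKC hij); elim: (j - i) {hij} => [|m IH].
  by move=> _ k h1; rewrite addn0 ltnNge h1.
rewrite addnS big_nat_recr ?leq_addr //= => h.
have hle : \sum_(i <= k < i + m) f k <= m.
  have: \sum_(i <= k < i + m) f k <= \sum_(i <= k < i + m) 1.
    by apply: leq_sum => k _; apply: hf.
  by rewrite sum_nat_const_nat; lia.
have := hf (i + m) => hl.
move=> k h1; rewrite ltnS leq_eqVlt => /orP [/eqP ->|h2].
  by move/eqP: h; lia.
by apply: IH => //; apply/eqP; move/eqP: h; lia.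
Qed.

(** For distinct colors the two counts concern disjoint sets of points, so they fill the interval
    exactly when no third color occurs. This turns the condition into an equation between table
    entries. *)
Lemma two_colors a b i j : i <= j -> a != b ->
  (dcnt b i j + dcnt a i j == j - i) <->
  (forall k, i <= k -> k < j -> c k = a \/ c k = b).
Proof.
move=> hij hab; rewrite !dcntE // -big_split /=.
have hf k : (c k == b) + (c k == a) <= 1.
  by case: (eqVneq (c k) b) => [->|_]; rewrite ?[b == a]eq_sym ?(negbTE hab) //; case: eqP.
rewrite (sum_leq1_eq hij hf); split=> h k h1 h2; have := h k h1 h2.
  by case: eqP => [|_]; [right | case: eqP => //; left].
by case=> ->; rewrite eqxx ?(negbTE hab) // [b == a]eq_sym (negbTE hab).
Qed.

Lemma below_above u v : u < v -> nbelow u <= nabove v.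
Proof. by rewrite /nbelow /nabove; lia. Qed.

Lemma above_below v : nabove v <= nbelow v.
Proof. by rewrite /nbelow /nabove; lia. Qed.

Lemma nbelow_mono u v : u <= v -> nbelow u <= nbelow v.
Proof. by rewrite /nbelow; lia. Qed.

Lemma edge_colors u v i : edge u v -> nbelow u <= i -> i < nabove v ->
  c i = ncolor u \/ c i = ncolor v.
Proof.
case/and5P=> huv hc hs _ _; move: i.
by apply/(two_colors (below_above huv) hc).
Qed.

Lemma passing v i : nabove v <= i -> i < nbelow v -> v %% 4 = 2 /\ i = v %/ 4.
Proof. by rewrite /nabove /nbelow; lia. Qed.

Lemma passing_color v i : nabove v <= i -> i < nbelow v -> ncolor v = c i.
Proof. by move=> h1 h2; have [h ->] := passing h1 h2; rewrite /ncolor h. Qed.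

Lemma passing_height v i : nabove v <= i -> i < nbelow v -> nheight v = y i.
Proof. by move=> h1 h2; have [h ->] := passing h1 h2; rewrite /nheight h. Qed.

Lemma chain_cons v u us : chain v (u :: us) = edge u v && chain u us.
Proof. by rewrite /chain /= andbA. Qed.

Lemma chain_nil v : chain v [::] = (v == 0). Proof. by []. Qed.

Lemma nbelow_le v : v <= 4 * n -> nbelow v <= n.
Proof. by rewrite /nbelow; lia. Qed.

Lemma nabove_le v : v <= 4 * n -> nabove v <= n.
Proof. by rewrite /nabove; lia. Qed.

Lemma ncolor0 : ncolor 0 = q. Proof. by []. Qed.

Lemma chain_serves_below v us : chain v us -> v %% 4 = 3 ->
  0 < cnt (ncolor v) (nbelow v).
Proof.
case: us => [|u us]; first by rewrite chain_nil => /eqP ->.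
rewrite chain_cons => /andP [/and5P [huv _ _ h3 _] _] hv.
move: h3; rewrite hv /dcnt => h3.
by apply: leq_trans (cnt_mono _ (above_below v)); lia.
Qed.

Lemma chain_mem_leq v us : chain v us -> forall u, u \in us -> u < v.
Proof.
elim: us v => [|u us IH] v //; rewrite chain_cons => /andP [/and5P [huv _ _ _ _] hch] w.
rewrite inE => /orP [/eqP -> //|hw]; exact: ltn_trans (IH _ hch _ hw) huv.
Qed.

Lemma chain_uniq v us : chain v us -> uniq (v :: us).
Proof.
elim: us v => [|u us IH] v //; rewrite chain_cons => h.
case/andP: (h) => _ hch; rewrite cons_uniq (IH _ hch) andbT.
apply/negP => hm; have := chain_mem_leq (v := v) (us := u :: us).
by rewrite chain_cons => /(_ h _ hm); rewrite ltnn.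
Qed.

(* Every label of a chain serves a point, so the colors met so far are those of
   the points passed so far and that of the current label. *)
Lemma chain_count v us a : chain v us -> v <= 4 * n -> a != q ->
  count (fun w => ncolor w == a) (v :: us) =
  count (pred1 a) (repeats v us) + ((0 < cnt a (nbelow v)) || (ncolor v == a)).
Proof.
move=> hch; move: hch; elim: us v => [|u us IH] v.
  rewrite chain_nil => /eqP -> _ ha.
  by rewrite /= ncolor0 eq_sym (negbTE ha) /nbelow cnt0.
rewrite chain_cons => /andP [he hch] hv ha.
case/and5P: (he) => huv hcol _ h3 h4.
have hu : u <= 4 * n by lia.
have {IH} hIH := IH _ hch hu ha.
rewrite -[count _ (v :: _)]/((ncolor v == a) + count (fun w => ncolor w == a) (u :: us)) {}hIH.
have hba := below_above huv.
rewrite /= /first_use; case: (eqVneq (ncolor v) a) => [hva|hva] /=.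
  rewrite orbT hva.
  have -> : (ncolor u == a) = false by rewrite -hva; apply: negbTE.
  by case: posnP => h /=; rewrite ?hva ?eqxx; lia.
rewrite orbF add0n.
have -> : count (pred1 a) (if cnt (ncolor v) (nbelow u) == 0 then repeats u us
    else ncolor v :: repeats u us) = count (pred1 a) (repeats u us).
  by case: ifP => //= _; rewrite (negbTE hva).
congr (_ + nat_of_bool _).
apply/idP/idP => [|/cnt_gt0P [i hi hia]].
  case/orP => [h|/eqP hua].
    by apply: leq_trans h (cnt_mono _ _); apply: nbelow_mono; apply: ltnW.
  (* It remains to find a point of the color of [u] above or on [v]: a backbone just above a point
     serves something between [u] and [v], one through a point has that point, and one just below a
     point serves something further up. *)
  have : u %% 4 < 4 by rewrite ltn_pmod.
  case e2: (u %% 4) => [|[|[|[|//]]]] _.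
  - by move: ha; rewrite -hua /ncolor e2 eqxx.
  - move: h4; rewrite e2 hua /= /dcnt => h4.
    by apply: leq_trans (cnt_mono _ (above_below v)); lia.
  - apply/cnt_gt0P; exists (u %/ 4); last by rewrite -hua /ncolor e2.
    by rewrite /nbelow; lia.
  - have := chain_serves_below hch e2; rewrite hua => h.
    by apply: leq_trans h (cnt_mono _ _); apply: nbelow_mono; apply: ltnW.
case: (ltnP i (nbelow u)) => hiu; first by apply/orP; left; apply/cnt_gt0P; exists i.
case: (ltnP i (nabove v)) => hiv.
  case: (edge_colors he hiu hiv) => h; first by rewrite -h hia eqxx orbT.
  by move: hva; rewrite -h hia eqxx.
by move: hva; rewrite (passing_color hiv hi) hia eqxx.
Qed.

Lemma wsum_split v i j : i <= j ->
  (wsum v j - wsum v i =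
   \sum_(i <= k < j | c k == ncolor v) `|nheight v - y k|)%R.
Proof.
by move=> h; rewrite /wsum (big_cat_nat (leq0n _) h) /= addrAC subrr add0r.
Qed.

Lemma edge_weight u v (f : nat -> R) : edge u v ->
  (forall i, nbelow u <= i -> i < nabove v ->
     f i = if c i == ncolor v then `|nheight v - y i|%R else `|nheight u - y i|%R) ->
  (weight u v = (if ncolor v == q then 0 else lam) +
     \sum_(nbelow u <= i < nabove v) f i)%R.
Proof.
move=> he hf; rewrite /weight -addrA; congr (_ + _)%R.
case/and5P: (he) => huv hc _ _ _; have hab := below_above huv.
rewrite !wsum_split // [in RHS](bigID (fun i => c i == ncolor v)) /=.
congr (_ + _)%R; rewrite big_nat_cond [in RHS]big_nat_cond.
  by apply: eq_bigr => i /andP [/andP [h1 h2] h3]; rewrite hf // h3.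
apply: eq_big => [i|i].
  case h12: (nbelow u <= i < nabove v) => //=.
  case/andP: h12 => h1 h2; case: (edge_colors he h1 h2) => ->; first by rewrite eqxx hc.
  by rewrite eqxx eq_sym (negbTE hc).
move=> /andP [/andP [h1 h2] /eqP h3]; rewrite hf // h3 (negbTE hc) //.
Qed.

End Nodes.

(** * From labelings to chains *)

Record wf_config (R : realType) (G : config R) : Prop := WfConfig {
  wf_c : forall i, i < cfg_n G -> cfg_c G i < cfg_q G;
  wf_lo : forall i, i < cfg_n G -> (cfg_lo G <= cfg_y G i)%R;
  wf_hi : forall i, i < cfg_n G -> (cfg_y G i <= cfg_hi G)%R;
  wf_ym : forall i, i < cfg_n G -> (cfg_y G i < cfg_ym G i)%R;
  wf_yp : forall i, i < cfg_n G -> (cfg_yp G i < cfg_y G i)%R;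
  wf_gap : forall i, i.+1 < cfg_n G -> (cfg_ym G i.+1 < cfg_yp G i)%R;
  wf_n : 0 < cfg_n G;
  wf_lam : (0 <= cfg_lam G)%R }.

Section Heights.
Variables (R : realType) (G : config R).
Local Notation n := (cfg_n G).
Local Notation y := (cfg_y G).
Local Notation ym := (cfg_ym G).
Local Notation yp := (cfg_yp G).
Hypothesis wf : wf_config G.

Lemma ym_lt_yp i j : i < j -> j < n -> (ym j < yp i)%R.
Proof.
elim: j => // j IH; rewrite ltnS leq_eqVlt => /orP [/eqP -> |hij] hj.
  exact: wf_gap.
apply: lt_trans (IH hij (ltnW hj)).
apply: lt_trans (wf_gap wf hj) _.
exact: lt_trans (wf_yp wf (ltnW hj)) (wf_ym wf (ltnW hj)).
Qed.

Lemma y_dec i j : i < j -> j < n -> (y j < y i)%R.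
Proof.
move=> hij hj; have hi := ltn_trans hij hj.
apply: lt_trans (wf_ym wf hj) _; apply: lt_trans (wf_yp wf hi).
exact: ym_lt_yp.
Qed.

Lemma y_dec_le i j : i <= j -> j < n -> (y j <= y i)%R.
Proof.
rewrite leq_eqVlt => /orP [/eqP -> //|hij] hj; exact: ltW (y_dec hij hj).
Qed.

End Heights.

Section Completeness.
Variables (R : realType) (G : config R).
Local Notation n := (cfg_n G).
Local Notation q := (cfg_q G).
Local Notation c := (cfg_c G).
Local Notation y := (cfg_y G).
Local Notation ym := (cfg_ym G).
Local Notation yp := (cfg_yp G).
Local Notation ylo := (cfg_lo G).
Local Notation yhi := (cfg_hi G).
Local Notation lam := (cfg_lam G).
Hypothesis wf : wf_config G.

(** The labeling enters through order relations only. By [no_cross], a foreign backbone lies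
    strictly beyond both a point and the backbone of that point, on the same side. Not every
    crossing-free assignment satisfies [g_mono]; the caller arranges it by an exchange argument. *)
Variables (T : finType) (H : T -> R) (col : T -> nat) (g : nat -> T).
Hypothesis H_inj : injective H.
Hypothesis g_col : forall i, i < n -> col (g i) = c i.
Hypothesis no_cross : forall i l, i < n -> l != g i ->
  (y i < H l)%R /\ (H (g i) < H l)%R \/ (H l < y i)%R /\ (H l < H (g i))%R.
Hypothesis g_mono : forall i j, i < j -> j < n -> c i = c j ->
  (H (g j) <= H (g i))%R.
Hypothesis H_range : forall l, (ylo <= H l <= yhi)%R.
Hypothesis H_valid : forall l,
  (exists2 i, i < n & H l = y i) \/
  exists t, [/\ t <= n, forall s, t = s.+1 -> (H l <= yp s)%R &
                        t < n -> (ym t <= H l)%R].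

Definition used (l : T) : bool := has (fun i => g i == l) (iota 0 n).

Lemma usedP l : reflect (exists2 i, i < n & g i = l) (used l).
Proof.
apply: (iffP hasP) => [[i]|[i hi <-]].
  by rewrite mem_iota /= => hi /eqP <-; exists i.
by exists i => //; rewrite mem_iota.
Qed.

Lemma used_col l : used l -> col l < q.
Proof. by case/usedP => i hi <-; rewrite g_col //; apply: (wf_c wf). Qed.

(** As the points come from top to bottom, this is the number of points strictly above the
    backbone. *)
Definition gap (l : T) : nat := find (fun i => (y i <= H l)%R) (iota 0 n).

Lemma gap_le l : gap l <= n.
Proof. by rewrite -[X in _ <= X](size_iota 0 n) find_size. Qed.

Lemma gapP l i : i < n -> (i < gap l) = (H l < y i)%R.
Proof.
move=> hi; apply/idP/idP => [h|h].
  by have := before_find 0 h; rewrite nth_iota // add0n ltNge => ->.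
rewrite ltnNge; apply/negP => hg.
have hgn : gap l < n by apply: leq_ltn_trans hi.
have : (y (gap l) <= H l)%R.
  have := @nth_find _ 0 (fun i => (y i <= H l)%R) (iota 0 n).
  by rewrite has_find size_iota => /(_ hgn); rewrite nth_iota.
move=> h1; have := y_dec_le wf hg hi => h2.
by have := le_lt_trans (le_trans h2 h1) h; rewrite ltxx.
Qed.

Lemma gap_mono l l' : (H l <= H l')%R -> gap l' <= gap l.
Proof.
move=> h; rewrite leqNgt; apply/negP => h1.
have h2 : gap l < n by apply: leq_trans h1 (gap_le _).
move: h1; rewrite gapP // => h1; have := gapP l h2; rewrite ltnn.
by move/esym/negbT; rewrite (le_lt_trans h h1).
Qed.

Lemma above_gap i l : i < n -> (H l < H (g i))%R -> i < gap l.
Proof.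
move=> hi h; rewrite gapP //.
have hl : l != g i by apply/eqP => e; move: h; rewrite e ltxx.
by case: (no_cross hi hl) => -[h1 h2] //; have := lt_trans h h2; rewrite ltxx.
Qed.

Lemma below_gap i l : i < n -> (H (g i) < H l)%R -> gap l <= i.
Proof.
move=> hi h; rewrite leqNgt gapP // -leNgt.
have hl : l != g i by apply/eqP => e; move: h; rewrite e ltxx.
by case: (no_cross hi hl) => -[h1 h2]; [exact: ltW | have := lt_trans h h2; rewrite ltxx].
Qed.

(** A foreign backbone through a point would meet the leader of that point. *)
Lemma through_own l i : i < n -> H l = y i -> g i = l /\ gap l = i.
Proof.
move=> hi h; split.
  case: (eqVneq (g i) l) => // hl.
  by case: (no_cross hi (negbT (etrans (eq_sym _ _) (negbTE hl)))) => -[];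
    rewrite h ltxx.
apply/eqP; rewrite eqn_leq; apply/andP; split.
  by rewrite leqNgt gapP // h ltxx.
rewrite leqNgt; apply/negP => hg.
have hgn := ltn_trans hg hi.
by have := gapP l hgn; rewrite ltnn h => /esym; rewrite (y_dec wf hg hi).
Qed.

Lemma off_points l : ~~ [exists i : 'I_n, H l == y i] ->
  (forall s, gap l = s.+1 -> (H l <= yp s)%R) /\
  (gap l < n -> (ym (gap l) <= H l)%R).
Proof.
move/existsPn => hno; case: (H_valid l) => [[i hi /eqP h]|[t [ht hp hm]]].
  by have := hno (Ordinal hi); rewrite /= h.
suff -> : gap l = t by [].
apply/eqP; rewrite eqn_leq; apply/andP; split.
  rewrite leqNgt; apply/negP => h.
  have htn : t < n by apply: leq_trans h (gap_le _).
  move: h; rewrite gapP // => h; have := le_lt_trans (hm htn) h.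
  by rewrite ltNge (ltW (wf_ym wf htn)).
case: t ht hp hm => // t ht hp _; rewrite gapP //.
exact: le_lt_trans (hp t erefl) (wf_yp wf ht).
Qed.

(** [alpha] and [beta] count the served points above the backbone and the others; raising the
    backbone within its gap changes the length at the rate [beta l - alpha l]. *)
Definition alpha (l : T) : nat := \sum_(0 <= i < n | g i == l) (i < gap l).
Definition beta (l : T) : nat := \sum_(0 <= i < n | g i == l) (gap l <= i).

(** The backbone moves towards the majority of its points, upwards in a tie, and stays if it is on a
    point already. For a used label the chosen side holds a served point, which gives the candidate
    its color. *)
Definition fit (l : T) : nat :=
  let t := gap l in
  if (t < n) && (H l == y t) then 4 * t + 2
  else if beta l <= alpha l then
    (if g t.-1 == l then 4 * t.-1 + 2 else 4 * t.-1 + 3)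
  else (if g t == l then 4 * t + 2 else 4 * t + 1).

Variant fit_spec (l : T) : nat -> Prop :=
  | FitThrough m of m < n & g m = l & gap l <= m.+1 & m <= gap l &
      [\/ H l = y m, gap l = m.+1 /\ beta l <= alpha l |
          gap l = m /\ alpha l <= beta l] : fit_spec l (4 * m + 2)
  | FitBelow m i of m < n & i < m & g m <> l & g i = l & gap l = m.+1 &
      (H l <= yp m)%R & alpha l >= beta l : fit_spec l (4 * m + 3)
  | FitAbove m i of i < n & m < i & g m <> l & g i = l & gap l = m &
      (ym m <= H l)%R & alpha l < beta l : fit_spec l (4 * m + 1).

Lemma alpha_gt0 l : 0 < alpha l -> exists2 i, i < gap l & g i = l.
Proof.
move=> h; case: (boolP (has (fun i => (g i == l) && (i < gap l)) (iota 0 n))).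
  by case/hasP=> i _ /andP [/eqP h1 h2]; exists i.
move/hasPn => hn; move: h; rewrite /alpha big_nat_cond big1 // => i /andP [h1 h2].
have := hn i; rewrite mem_iota add0n h1 h2 /= => /(_ isT).
by move/negbTE ->.
Qed.

Lemma beta_gt0 l : 0 < beta l -> exists i, [/\ gap l <= i, i < n & g i = l].
Proof.
move=> h; case: (boolP (has (fun i => (g i == l) && (gap l <= i)) (iota 0 n))).
  case/hasP=> i; rewrite mem_iota /= => hi /andP [/eqP h1 h2].
  by exists i.
move/hasPn => hn; move: h; rewrite /beta big_nat_cond big1 // => i /andP [h1 h2].
have := hn i; rewrite mem_iota add0n h1 h2 /= => /(_ isT).
by move/negbTE ->.
Qed.

Lemma used_gt0 l : used l -> 0 < alpha l + beta l.
Proof.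
case/usedP => i hi hg; rewrite /alpha /beta -big_split /=.
rewrite (big_cat_nat (leq0n i) (ltnW hi)) /=.
rewrite [X in _ + X]big_mkcond [X in _ + X]big_ltn //= hg eqxx.
have h0 : 0 < (i < gap l) + (gap l <= i) by case: (ltnP i).
by rewrite addnCA ltn_addr.
Qed.

Lemma fitP l : used l -> fit_spec l (fit l).
Proof.
move=> hu; rewrite /fit; case: (boolP (_ && _)) => [/andP [ht /eqP h]|hno].
  have [h1 h2] := through_own ht h.
  by apply: FitThrough => //; constructor 1.
have hex : ~~ [exists i : 'I_n, H l == y i].
  apply/existsPn => i; apply/negP => /eqP h.
  have [_ h2] := through_own (ltn_ord i) h.
  by move: hno; rewrite h2 ltn_ord h eqxx.
have [hp hm] := off_points hex; have hpos := used_gt0 hu.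
case: leqP => hab.
  have /alpha_gt0 [i hi hgi] : 0 < alpha l by lia.
  case ht: (gap l) hi => [|m] //; rewrite ltnS /= => hi.
  have hmn : m < n by rewrite -ht gap_le.
  case: eqP => hg; first by apply: FitThrough; rewrite ?ht //; constructor 2.
  apply: (@FitBelow _ m i) => //; last exact: hp.
  by move: hi; rewrite leq_eqVlt => /orP [/eqP e|//]; move: hg; rewrite -e.
have /beta_gt0 [i [hi hin hgi]] : 0 < beta l by lia.
have hmn := leq_ltn_trans hi hin.
case: eqP => hg; first by apply: FitThrough => //; constructor 3; split=> //; apply: ltnW.
apply: (@FitAbove _ _ i) => //; last exact: hm.
by move: hi; rewrite leq_eqVlt => /orP [/eqP e|//]; move: hg; rewrite e.
Qed.

Lemma fit_above l i : used l -> i < nabove (fit l) -> i < gap l.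
Proof.
by move=> hu; case: fitP => // m; rewrite /nabove; lia.
Qed.

Lemma fit_below l i : used l -> nbelow (fit l) <= i -> gap l <= i.
Proof.
by move=> hu; case: fitP => // m; rewrite /nbelow; lia.
Qed.

Lemma fit_passing l i : used l -> nabove (fit l) <= i -> i < nbelow (fit l) ->
  g i = l.
Proof.
move=> hu; case: fitP => // m; rewrite /nabove /nbelow.
- by move=> _ <- _ _ _ h1 h2; congr g; lia.
- by move=> *; exfalso; lia.
- by move=> *; exfalso; lia.
Qed.

Lemma prev_colorE t i a : i < t -> c i = a -> a <> c t ->
  (forall j, i <= j -> j < t -> c j = a \/ c j = c t) -> prev_color G t = a.
Proof.
elim: t => // t IH; rewrite ltnS => hit hi ha hj /=.
case: eqP => [e|ne].
  move: hit; rewrite leq_eqVlt => /orP [/eqP e'|hit].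
    by move: ha; rewrite -hi e' e.
  apply: IH => //; first by rewrite e.
  by move=> j h1 h2; rewrite e; apply: hj => //; apply: ltnW.
by case: (hj t hit (ltnSn t)) => // /ne.
Qed.

Lemma next_colorS t : t.+1 < n ->
  next_color G t = if c t.+1 == c t then next_color G t.+1 else c t.+1.
Proof.
move=> ht; rewrite /next_color.
have -> : n - 1 - t = (n - 1 - t.+1).+1 by lia.
rewrite [LHS]/=; have -> : n - 1 - (n - 1 - t.+1).+1 = t by lia.
by [].
Qed.

Lemma next_colorE t i a : t < i -> i < n -> c i = a -> a <> c t ->
  (forall j, t < j -> j <= i -> c j = a \/ c j = c t) -> next_color G t = a.
Proof.
move=> hti; have [k ->] : exists k, i = t + k.+1 by exists (i - t.+1); lia.
elim: k t {hti} => [|k IH] t hin hi ha hj.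
  rewrite next_colorS; last by move: hin; rewrite addn1.
  by rewrite -hi addn1; case: eqP => // e; move: ha; rewrite -hi addn1 e.
have h1 : t.+1 < n by apply: leq_ltn_trans hin; lia.
rewrite next_colorS //; case: eqP => [e|ne]; last first.
  by case: (hj t.+1 (ltnSn t) _) => [|//|/ne//]; lia.
apply: IH; rewrite ?addSnnS ?e // => j h2 h3.
by apply: hj => //; apply: ltnW.
Qed.

(* The points between a served point and its backbone belong to that label or to
   the next one beyond. *)
Lemma between_below m i l : m < n -> i < m -> g m <> l -> g i = l ->
  gap l = m.+1 ->
  col l <> c m /\ (forall j, i <= j -> j < m -> c j = col l \/ c j = c m).
Proof.
move=> hm him hgm hgi hgap; have hi := ltn_trans him hm.
have hup j : j <= m -> g j <> l -> (H l < H (g j))%R.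
  move=> hj hne; have hjn := leq_ltn_trans hj hm.
  rewrite ltNge le_eqVlt negb_or; apply/andP; split.
    by apply/eqP => /H_inj.
  by apply/negP => /(below_gap hjn); rewrite hgap leqNgt ltnS hj.
have hyi j : j <= m -> g j <> l -> i <= j -> (y i < H (g j))%R.
  move=> hj hne hij; have h1 := hup j hj hne.
  have h2 : g j != g i by rewrite hgi; apply/eqP.
  case: (no_cross hi h2) => -[] // _; rewrite hgi => h3.
  by have := lt_trans h1 h3; rewrite ltxx.
split.
  move=> e; have hc : c i = c m by rewrite -(g_col hi) hgi.
  have := g_mono him hm hc; rewrite hgi leNgt.
  by rewrite (hup m (leqnn m) hgm).
move=> j hij hjm; have hj := ltn_trans hjm hm.
case: (eqVneq (g j) l) => [e|/eqP hne]; first by left; rewrite -(g_col hj) e.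
right; rewrite -(g_col hj) -(g_col hm); congr col.
apply/eqP; apply/negPn/negP => hjm'.
(* Both foreign backbones lie above point [i], hence above points [j] and [m]. If they differ, the
   leader that reaches the higher one crosses the lower one. *)
have h1 := hyi j (ltnW hjm) hne hij; have h2 := hyi m (leqnn m) hgm (ltnW him).
have h3 := y_dec_le wf hij hj; have h4 := y_dec_le wf (ltnW him) hm.
have h5 : g m != g j by rewrite eq_sym.
case: (no_cross hj h5) => -[a1 a2]; case: (no_cross hm hjm') => -[b1 b2].
- by have := lt_trans a2 b2; rewrite ltxx.
- by have := lt_trans b1 (le_lt_trans h4 h1); rewrite ltxx.
- by have := lt_le_trans (lt_trans h2 a1) h3; rewrite ltxx.
- by have := lt_trans a2 b2; rewrite ltxx.
Qed.

(** The mirror image of [between_below], for a served point below the backbone. *)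
Lemma between_above m i l : i < n -> m < i -> g m <> l -> g i = l ->
  gap l = m ->
  col l <> c m /\ (forall j, m < j -> j <= i -> c j = col l \/ c j = c m).
Proof.
move=> hi hmi hgm hgi hgap; have hm := ltn_trans hmi hi.
have hdn j : j < n -> m <= j -> g j <> l -> (H (g j) < H l)%R.
  move=> hjn hj hne; rewrite ltNge le_eqVlt negb_or; apply/andP; split.
    by apply/eqP => e; apply: hne; rewrite (H_inj e).
  by apply/negP => /(above_gap hjn); rewrite hgap ltnNge hj.
have hyi j : j <= i -> m <= j -> g j <> l -> (H (g j) < y i)%R.
  move=> hj hmj hne; have h1 := hdn j (leq_ltn_trans hj hi) hmj hne.
  have h2 : g j != g i by rewrite hgi; apply/eqP.
  case: (no_cross hi h2) => -[] // _; rewrite hgi => h3.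
  by have := lt_trans h1 h3; rewrite ltxx.
split.
  move=> e; have hc : c m = c i by rewrite -(g_col hi) hgi.
  have := g_mono hmi hi hc; rewrite hgi leNgt.
  by rewrite (hdn m hm (leqnn m) hgm).
move=> j hmj hji; have hj := leq_ltn_trans hji hi.
case: (eqVneq (g j) l) => [e|/eqP hne]; first by left; rewrite -(g_col hj) e.
right; rewrite -(g_col hj) -(g_col hm); congr col.
apply/eqP; apply/negPn/negP => hjm'.
have h1 := hyi j hji (ltnW hmj) hne; have h2 := hyi m (ltnW hmi) (leqnn m) hgm.
have h3 := y_dec_le wf hji hi; have h4 := y_dec_le wf (ltnW hmi) hi.
have h5 : g m != g j by rewrite eq_sym.
case: (no_cross hj h5) => -[a1 a2]; case: (no_cross hm hjm') => -[b1 b2].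
- by have := lt_trans a2 b2; rewrite ltxx.
- by have := lt_le_trans (lt_trans a1 h2) h3; rewrite ltxx.
- by have := lt_le_trans (lt_trans b1 h1) h4; rewrite ltxx.
- by have := lt_trans a2 b2; rewrite ltxx.
Qed.

(** The candidate stays in the rectangle: a node below a point is reached by moving up from [H l],
    one above a point by moving down, so the bound tested in [ncolor] is respected. *)
Lemma fit_color l : used l -> ncolor G (fit l) = col l.
Proof.
move=> hu; have hul := H_range l; case/andP: hul => hlo hhi; case: fitP => //.
- move=> m hm hg _ _ _; rewrite /ncolor.
  by have [-> ->] := nodeE m (isT : 2 < 4); rewrite -hg g_col.
- move=> m i hm him hgm hgi hgap hyp _; rewrite /ncolor.
  have [-> ->] := nodeE m (isT : 3 < 4); rewrite (le_trans hlo hyp).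
  have [h1 h2] := between_below hm him hgm hgi hgap.
  by apply: (prev_colorE him) => //; rewrite -hgi g_col // (ltn_trans him hm).
- move=> m i hi hmi hgm hgi hgap hym _; rewrite /ncolor.
  have [-> ->] := nodeE m (isT : 1 < 4); rewrite (le_trans hym hhi).
  have [h1 h2] := between_above hi hmi hgm hgi hgap.
  by apply: (next_colorE hmi) => //; rewrite -hgi g_col.
Qed.

(** With [d] the distance moved, each served point above comes closer by [d] and each other one
    recedes by at most [d]; the former are no fewer. *)
Lemma move_up l h : (H l <= h)%R -> (forall i, i < n -> i < gap l -> (h <= y i)%R) ->
  beta l <= alpha l ->
  (\sum_(0 <= i < n | g i == l) `|h - y i| <=
   \sum_(0 <= i < n | g i == l) `|H l - y i|)%R.
Proof.
move=> h1 h2 hab; set d := (h - H l)%R.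
have hd : (0 <= d)%R by rewrite subr_ge0.
apply: (@le_trans _ _ (\sum_(0 <= i < n | g i == l)
   (`|H l - y i| + (d * (gap l <= i)%:R - d * (i < gap l)%:R)))%R).
  rewrite big_nat_cond [in leRHS]big_nat_cond.
  apply: ler_sum => i /andP [/andP [_ hi] _].
  case: (ltnP i (gap l)) => hg.
    have hy := h2 i hi hg; rewrite mulr0 mulr1 add0r.
    by rewrite !ler0_norm ?subr_le0 //; [rewrite /d; lra | exact: le_trans hy].
  rewrite mulr0 mulr1 subr0.
  have -> : (h - y i = (H l - y i) + d)%R by rewrite /d; lra.
  by apply: le_trans (ler_normD _ _) _; rewrite (ger0_norm hd).
rewrite big_split /= -[leRHS]addr0 lerD2l sumrB -!mulr_sumr -!natr_sum.
by rewrite -mulrBr mulr_ge0_le0 // subr_le0 ler_nat.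
Qed.

Lemma move_down l h : (h <= H l)%R -> (forall i, i < n -> gap l <= i -> (y i <= h)%R) ->
  alpha l <= beta l ->
  (\sum_(0 <= i < n | g i == l) `|h - y i| <=
   \sum_(0 <= i < n | g i == l) `|H l - y i|)%R.
Proof.
move=> h1 h2 hab; set d := (H l - h)%R.
have hd : (0 <= d)%R by rewrite subr_ge0.
apply: (@le_trans _ _ (\sum_(0 <= i < n | g i == l)
   (`|H l - y i| + (d * (i < gap l)%:R - d * (gap l <= i)%:R)))%R).
  rewrite big_nat_cond [in leRHS]big_nat_cond.
  apply: ler_sum => i /andP [/andP [_ hi] _].
  case: (ltnP i (gap l)) => hg.
    rewrite mulr0 mulr1 subr0.
    have -> : (h - y i = (H l - y i) - d)%R by rewrite /d; lra.
    by apply: le_trans (ler_normB _ _) _; rewrite (ger0_norm hd).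
  have hy := h2 i hi hg; rewrite mulr0 mulr1 add0r.
  by rewrite !ger0_norm ?subr_ge0 //; [rewrite /d; lra | exact: le_trans h1].
rewrite big_split /= -[leRHS]addr0 lerD2l sumrB -!mulr_sumr -!natr_sum.
by rewrite -mulrBr mulr_ge0_le0 // subr_le0 ler_nat.
Qed.

Lemma fit_cost l : used l ->
  (\sum_(0 <= i < n | g i == l) `|nheight G (fit l) - y i| <=
   \sum_(0 <= i < n | g i == l) `|H l - y i|)%R.
Proof.
case/fitP.
- move=> m hm hg hg1 hg2; rewrite /nheight.
  have [-> ->] := nodeE m (isT : 2 < 4).
  case=> [->//|[e hab]|[e hab]].
    apply: move_up => // [|i hi]; last by rewrite e ltnS => him; apply: (y_dec_le wf).
    by apply: ltW; rewrite -gapP // e.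
  apply: move_down => // [|i hi]; last by rewrite e => him; apply: (y_dec_le wf).
  by rewrite leNgt -gapP // e ltnn.
- move=> m i hm him hgm hgi hgap hyp hab; rewrite /nheight.
  have [-> ->] := nodeE m (isT : 3 < 4).
  apply: move_up => // j hj; rewrite hgap ltnS => hjm.
  by apply: le_trans (ltW (wf_yp wf hm)) _; apply: (y_dec_le wf).
- move=> m i hi hmi hgm hgi hgap hym hab; rewrite /nheight.
  have hm := ltn_trans hmi hi.
  have [-> ->] := nodeE m (isT : 1 < 4).
  apply: move_down => // [j hj|]; last exact: ltnW.
  rewrite hgap => hjm; apply: le_trans (ltW (wf_ym wf hm)); apply: (y_dec_le wf) => //.
Qed.

(** All backbones move at once, and several may share a gap between points. They keep their order
    because every point of the upper label is above the lower backbone and no point of the lower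
    label is above the upper one. *)
Lemma fit_lt l l' : used l -> used l' -> (H l < H l')%R -> fit l' < fit l.
Proof.
move=> hu hu' hll; have hg := gap_mono (ltW hll).
have hne : l <> l' by move=> e; move: hll; rewrite e ltxx.
have hs i : i < n -> g i = l' -> i < gap l.
  by move=> hi e; apply: above_gap; rewrite ?e.
have hs' i : i < n -> g i = l -> gap l' <= i.
  by move=> hi e; apply: below_gap; rewrite ?e.
case: (fitP hu) => [m hm e1 e2 e3 _|m j hm e1 _ e2 e3 _ _|m j hj e1 _ e2 e3 _ _];
case: (fitP hu') => [m' hm' f1 f2 f3 _|m' j' hm' f1 _ f2 f3 _ _|m' j' hj' f1 _ f2 f3 _ _].
- have := hs _ hm' f1; have := hs' _ hm e1.
  have : m <> m' by move=> e; apply: hne; rewrite -e1 -f1 e.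
  by lia.
- by have := hs' _ hm e1; lia.
- by have := hs' _ hm e1; lia.
- by have := hs _ hm' f1; lia.
- by have := hs' _ (ltn_trans e1 hm) e2; lia.
- by have := hs' _ (ltn_trans e1 hm) e2; lia.
- by have := hs _ hm' f1; lia.
- by lia.
- by have := hs _ hj' f2; lia.
Qed.

Lemma fit_le l : used l -> 0 < fit l < 4 * n.
Proof. by case/fitP => m; lia. Qed.

Lemma fit_mod l : used l -> fit l %% 4 <> 0.
Proof. by case/fitP => m; lia. Qed.

Definition fcost (i : nat) : R := `|nheight G (fit (g i)) - y i|%R.

Lemma g_used i : i < n -> used (g i).
Proof. by move=> hi; apply/usedP; exists i. Qed.

Lemma not_below l i : i < n -> used l -> i < nabove (fit l) -> (H l <= H (g i))%R.
Proof.
move=> hi hu h; rewrite leNgt; apply/negP => h1.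
by have := below_gap hi h1; rewrite leqNgt fit_above.
Qed.

Lemma not_above l i : i < n -> used l -> nbelow (fit l) <= i -> (H (g i) <= H l)%R.
Proof.
move=> hi hu h; rewrite leNgt; apply/negP => h1.
by have := above_gap hi h1; rewrite ltnNge fit_below.
Qed.

Lemma fit_serves_above l : used l -> fit l %% 4 = 3 ->
  exists i, [/\ i < nabove (fit l), i < n & g i = l].
Proof.
case/fitP => [m _ _ _ _ _ |m i hm him _ hgi _ _ _ _|m i _ _ _ _ _ _ _].
- by have [_ ->] := nodeE m (isT : 2 < 4).
- exists i; split=> //; last exact: ltn_trans hm.
  by rewrite /nabove; lia.
- by have [_ ->] := nodeE m (isT : 1 < 4).
Qed.

Lemma fit_serves_below l : used l -> fit l %% 4 = 1 ->
  exists i, [/\ nbelow (fit l) <= i, i < n & g i = l].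
Proof.
case/fitP => [m _ _ _ _ _ |m i _ _ _ _ _ _ _|m i hi hmi _ hgi _ _ _ _].
- by have [_ ->] := nodeE m (isT : 2 < 4).
- by have [_ ->] := nodeE m (isT : 3 < 4).
- by exists i; split=> //; rewrite /nbelow; lia.
Qed.

Lemma edge_intro u v : u < v -> ncolor G u != ncolor G v ->
  (forall i, nbelow u <= i -> i < nabove v -> c i = ncolor G u \/ c i = ncolor G v) ->
  (v %% 4 = 3 -> exists i, [/\ nbelow u <= i, i < nabove v & c i = ncolor G v]) ->
  (u %% 4 = 1 -> exists i, [/\ nbelow u <= i, i < nabove v & c i = ncolor G u]) ->
  edge G u v.
Proof.
move=> huv hc hr hv hu; have hab := below_above huv; apply/and5P; split=> //.
- by apply/(two_colors G hab hc).
- by case: eqP => //= /hv h; apply/(dcnt_gt0P _ _ hab).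
- by case: eqP => //= /hu h; apply/(dcnt_gt0P _ _ hab).
Qed.

Lemma sum_fcost_passing v i j : used v -> nabove (fit v) = i ->
  nbelow (fit v) = j -> (\sum_(i <= k < j) fcost k = 0)%R.
Proof.
move=> hv <- <-; rewrite big_nat big1 // => k /andP [h1 h2].
rewrite /fcost (fit_passing hv h1 h2) (passing_height G h1 h2).
by rewrite subrr normr0.
Qed.

Lemma fit_le_n l : used l -> nbelow (fit l) <= n.
Proof. by move/fit_le; rewrite /nbelow; lia. Qed.

Lemma sep_nabove s : nabove (4 * s) = s. Proof. by rewrite /nabove; lia. Qed.
Lemma sep_nbelow s : nbelow (4 * s) = s. Proof. by rewrite /nbelow; lia. Qed.
Lemma sep_color s : ncolor G (4 * s) = q.
Proof. by rewrite /ncolor; have -> : (4 * s) %% 4 = 0 by lia. Qed.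

Lemma edge_to_sep l s : used l -> nbelow (fit l) <= s -> s <= n ->
  (forall i, nbelow (fit l) <= i -> i < s -> g i = l) ->
  (fit l %% 4 = 1 -> nbelow (fit l) < s) ->
  edge G (fit l) (4 * s) /\
  (weight G (fit l) (4 * s) = \sum_(nbelow (fit l) <= i < s) fcost i)%R.
Proof.
move=> hu hs hsn hall h1.
have he : edge G (fit l) (4 * s).
  apply: edge_intro.
  - case: (eqVneq (fit l %% 4) 1) => [e|/eqP e]; last first.
      by move: hs e (fit_mod hu); rewrite /nbelow; lia.
    by move: (h1 e); rewrite /nbelow; lia.
  - by rewrite sep_color fit_color // neq_ltn used_col.
  - move=> i hi; rewrite sep_nabove => his; left.
    by rewrite fit_color // -(hall i hi his) g_col // (leq_trans his).
  - by lia.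
  - move=> /h1 hlt; exists (nbelow (fit l)); split=> //; first by rewrite sep_nabove.
    by rewrite fit_color // -g_col ?(leq_trans hlt) // (hall _ (leqnn _) hlt).
split=> //; rewrite (edge_weight (f := fcost) he).
  by rewrite sep_color eqxx add0r sep_nabove.
move=> i hi; rewrite sep_nabove => his; rewrite sep_color.
have hin := leq_trans his hsn.
have -> : (c i == q) = false by have := wf_c wf hin; lia.
by rewrite /fcost hall.
Qed.

Lemma edge_from_sep l s : used l -> s <= nabove (fit l) ->
  (forall i, s <= i -> i < nabove (fit l) -> g i = l) ->
  (fit l %% 4 = 3 -> s < nabove (fit l)) ->
  edge G (4 * s) (fit l) /\
  (weight G (4 * s) (fit l) = lam + \sum_(s <= i < nabove (fit l)) fcost i)%R.
Proof.
move=> hu hs hall h3.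
have hin i : i < nabove (fit l) -> i < n.
  move=> h; apply: leq_trans h _.
  by apply: leq_trans (above_below _) (fit_le_n hu).
have hlq : ncolor G (fit l) != q by rewrite fit_color // neq_ltn used_col.
have he : edge G (4 * s) (fit l).
  apply: edge_intro.
  - case: (eqVneq (fit l %% 4) 3) => [e|/eqP e].
      by move: (h3 e); rewrite /nabove; lia.
    by move: hs e (fit_mod hu); rewrite /nabove; lia.
  - by rewrite sep_color eq_sym.
  - move=> i; rewrite sep_nbelow => hi his; right.
    by rewrite fit_color // -(hall i hi his) g_col // hin.
  - move=> /h3 hlt; exists s; split=> //; first by rewrite sep_nbelow.
    by rewrite fit_color // -(hall _ (leqnn _) hlt) g_col // hin.
  - by lia.
split=> //; rewrite (edge_weight (f := fcost) he).
  by rewrite (negbTE hlq) sep_nbelow.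
move=> i; rewrite sep_nbelow => hi his.
have hc : c i = col l by rewrite -g_col ?(hall i hi his) // hin.
by rewrite fit_color // /fcost hall // hc eqxx.
Qed.

Lemma edge_direct l l' : used l -> used l' -> (H l < H l')%R -> col l <> col l' ->
  (forall i, nbelow (fit l') <= i -> i < nabove (fit l) -> g i = l' \/ g i = l) ->
  edge G (fit l') (fit l) /\
  (weight G (fit l') (fit l) = lam + \sum_(nbelow (fit l') <= i < nabove (fit l)) fcost i)%R.
Proof.
move=> hu hu' hll hcol hall; have hlt := fit_lt hu hu' hll.
have hin i : i < nabove (fit l) -> i < n.
  move=> h; apply: leq_trans h _.
  by apply: leq_trans (above_below _) (fit_le_n hu).
have hcl i : i < nabove (fit l) -> g i = l -> c i = ncolor G (fit l).
  by move=> hi e; rewrite fit_color // -(g_col (hin i hi)) e.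
have hcl' i : i < nabove (fit l) -> g i = l' -> c i = ncolor G (fit l').
  by move=> hi e; rewrite fit_color // -(g_col (hin i hi)) e.
have he : edge G (fit l') (fit l).
  apply: edge_intro => //.
  - by rewrite !fit_color //; apply/eqP => e; apply: hcol.
  - by move=> i hi hi'; case: (hall i hi hi') => e; [left; apply: hcl' | right; apply: hcl].
  - move=> /(fit_serves_above hu) [i [hi hin' hgi]]; exists i; split=> //; last exact: hcl.
    rewrite leqNgt; apply/negP => h.
    have : (H l' <= H (g i))%R.
      case: (ltnP i (nabove (fit l'))) => h'; first exact: not_below.
      by rewrite (fit_passing hu' h' h).
    by rewrite hgi leNgt hll.
  - move=> /(fit_serves_below hu') [i [hi hin' hgi]].
    suff h : i < nabove (fit l) by exists i; split=> //; apply: hcl'.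
    rewrite ltnNge; apply/negP => h.
    have : (H (g i) <= H l)%R.
      case: (leqP (nbelow (fit l)) i) => h'; first exact: not_above.
      by rewrite (fit_passing hu h h').
    by rewrite hgi leNgt hll.
split=> //; rewrite (edge_weight (f := fcost) he).
  have hlq : ncolor G (fit l) != q by rewrite fit_color // neq_ltn used_col.
  by rewrite (negbTE hlq).
move=> i hi hi'; rewrite /fcost; case: (hall i hi hi') => e.
  rewrite (hcl' _ hi' e) e ifN // !fit_color //.
  by apply/eqP => e'; apply: hcol.
by rewrite (hcl _ hi' e) e eqxx.
Qed.

(** Induction on the number of used backbones above [l]. Besides the chain, the labels [ls] behind
    its backbones are recorded: being distinct, they bound the number of backbones in total and per
    color. *)
Lemma reach l : used l -> exists us ls,
  [/\ chain G (fit l) us, labs G (fit l :: us) = map fit ls, uniq ls,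
       (forall l', l' \in ls -> used l' && (H l <= H l')%R) &
       (clen G (fit l) us =
        lam * (size ls)%:R + \sum_(0 <= i < nbelow (fit l)) fcost i)%R].
Proof.
have [k] := ubnP #|[pred l' | used l' && (H l < H l')%R]|.
elim: k l => // k IH l hk hu.
have hlq : ncolor G (fit l) != q by rewrite fit_color // neq_ltn used_col.
have hpass : (\sum_(0 <= i < nbelow (fit l)) fcost i =
   \sum_(0 <= i < nabove (fit l)) fcost i)%R.
  rewrite (big_cat_nat (leq0n _) (above_below (fit l))) /=.
  by rewrite [X in (_ + X)%R](sum_fcost_passing hu erefl erefl) addr0.
have hin i : i < nabove (fit l) -> i < n.
  move=> h; apply: leq_trans h _.
  by apply: leq_trans (above_below _) (fit_le_n hu).
case: (pickP [pred l' | used l' && (H l < H l')%R]) => [l0 hl0|hno]; last first.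
  have hall i : 0 <= i -> i < nabove (fit l) -> g i = l.
    move=> _ hi; have := not_below (hin i hi) hu hi.
    rewrite le_eqVlt => /orP [/eqP /H_inj //|h].
    by have := hno (g i); rewrite /= g_used ?h // hin.
  have h3 : fit l %% 4 = 3 -> 0 < nabove (fit l).
    by move=> /(fit_serves_above hu) [i [h _ _]]; apply: leq_ltn_trans h.
  have [he hw] := @edge_from_sep l 0 hu (leq0n _) hall h3.
  rewrite muln0 in he hw.
  exists [:: 0], [:: l]; split=> //.
  - by rewrite chain_cons he chain_nil.
  - by rewrite /labs /= hlq ncolor0 eqxx.
  - by move=> l'; rewrite inE => /eqP ->; rewrite hu lexx.
  - by rewrite [LHS]/= hw addr0 hpass mulr1.
(* [l1] is the next used backbone above [l], so the points in between belong to one of the two. *)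
have := @arg_minP _ _ _ l0 [pred l' | used l' && (H l < H l')%R] H hl0.
case=> l1 /andP [hu1 hl1] hmin.
have hk1 : #|[pred l' | used l' && (H l1 < H l')%R]| < k.
  rewrite -ltnS; apply: leq_trans hk; rewrite ltnS.
  apply: proper_card; apply/fintype.properP; split.
    by apply/fintype.subsetP => x; rewrite !inE => /andP [-> /(lt_trans hl1) ->].
  by exists l1; rewrite !inE ?hu1 ?ltxx.
have [us [ls [hch hlabs huniq hls hlen]]] := IH l1 hk1 hu1.
have hlt := fit_lt hu hu1 hl1; have hba := below_above hlt.
have hall i : nbelow (fit l1) <= i -> i < nabove (fit l) -> g i = l1 \/ g i = l.
  move=> h1 h2; have hi := hin i h2.
  have := not_below hi hu h2; rewrite le_eqVlt => /orP [/eqP /H_inj|h]; first by right.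
  left; apply: H_inj; apply/eqP; rewrite eq_le not_above //=.
  by apply: hmin; rewrite /= g_used.
have hnl : l \notin ls by apply/negP => /hls; rewrite leNgt hl1 andbF.
have hls' l' : l' \in l :: ls -> used l' && (H l <= H l')%R.
  rewrite inE => /orP [/eqP ->|/hls /andP [-> h]]; first by rewrite hu lexx.
  by rewrite (le_trans (ltW hl1)).
have hsum : (\sum_(0 <= i < nbelow (fit l)) fcost i =
   \sum_(0 <= i < nbelow (fit l1)) fcost i +
   \sum_(nbelow (fit l1) <= i < nabove (fit l)) fcost i)%R.
  by rewrite hpass (big_cat_nat (leq0n _) hba).
case: (eqVneq (col l) (col l1)) => [hc|/eqP hc]; last first.
  have [he hw] := edge_direct hu hu1 hl1 hc hall.
  exists (fit l1 :: us), (l :: ls); split=> //.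
  - by rewrite chain_cons he.
  - by rewrite /labs /= hlq; congr (_ :: _).
  - by rewrite /= hnl.
  - by rewrite [LHS]/= hw hlen hsum /= mulrS; ring.
have hmono i j : nbelow (fit l1) <= i -> i <= j -> j < nabove (fit l) ->
    g i = l -> g j = l.
  move=> hi; rewrite leq_eqVlt => /orP [/eqP <- //|hij] hj e.
  have hjn := hin j hj; have hi' := ltn_trans hij hj.
  case: (hall j (ltnW (leq_ltn_trans hi hij)) hj) => // e1.
  have : c i = c j by rewrite -(g_col hjn) e1 -(g_col (hin i hi')) e.
  by move=> /(g_mono hij hjn); rewrite e e1 leNgt hl1.
(* With equal colors the color cannot tell the two labels apart. The separator sits at the first
   point of [l] in between, or at the end of the range if there is none; by [hmono] all points in
   between from there on belong to [l]. *)
pose s := nbelow (fit l1) + find (fun i => g i == l)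
            (index_iota (nbelow (fit l1)) (nabove (fit l))).
have hs1 : nbelow (fit l1) <= s by rewrite /s leq_addr.
have hs2 : s <= nabove (fit l).
  rewrite -[leqRHS](subnKC hba) /s leq_add2l.
  rewrite -[leqRHS](size_iota (nbelow (fit l1)) (nabove (fit l) - nbelow (fit l1))).
  exact: find_size.
have hup i : nbelow (fit l1) <= i -> i < s -> g i = l1.
  move=> h1 h2; case: (hall i h1 (leq_trans h2 hs2)) => // e.
  have hi : i - nbelow (fit l1) < find (fun i => g i == l)
      (index_iota (nbelow (fit l1)) (nabove (fit l))) by rewrite /s in h2; lia.
  have := before_find 0 hi; rewrite nth_iota; last by lia.
  by rewrite subnKC // e eqxx.
have hdn i : s <= i -> i < nabove (fit l) -> g i = l.
  move=> h1 h2; have hsn : s < nabove (fit l) by apply: leq_ltn_trans h2.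
  apply: (hmono s) => //.
  have := @nth_find _ 0 (fun i => g i == l) (index_iota (nbelow (fit l1)) (nabove (fit l))).
  rewrite has_find size_iota.
  have hf : find (fun i => g i == l) (index_iota (nbelow (fit l1)) (nabove (fit l)))
     < nabove (fit l) - nbelow (fit l1) by rewrite /s in hsn; lia.
  by move=> /(_ hf); rewrite nth_iota // => /eqP.
have hsn : s <= n.
  by apply: leq_trans hs2 (leq_trans (above_below _) (fit_le_n hu)).
have h1 : fit l1 %% 4 = 1 -> nbelow (fit l1) < s.
  move=> /(fit_serves_below hu1) [i [hi hin' hgi]].
  apply: leq_ltn_trans hi _; rewrite ltnNge; apply/negP => hsi.
  case: (ltnP i (nabove (fit l))) => hi2.
    by have := hl1; rewrite -hgi (hdn i hsi hi2) ltxx.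
  have : (H (g i) <= H l)%R.
    case: (leqP (nbelow (fit l)) i) => h'; first exact: not_above.
    by rewrite (fit_passing hu hi2 h').
  by rewrite hgi leNgt hl1.
have h3 : fit l %% 4 = 3 -> s < nabove (fit l).
  move=> /(fit_serves_above hu) [i [hi hin' hgi]].
  apply: leq_ltn_trans hi; rewrite leqNgt; apply/negP => his.
  case: (leqP (nbelow (fit l1)) i) => hi2.
    by have := hl1; rewrite -(hup i hi2 his) hgi ltxx.
  have : (H l1 <= H (g i))%R.
    case: (ltnP i (nabove (fit l1))) => h'; first exact: not_below.
    by rewrite (fit_passing hu1 h' hi2).
  by rewrite hgi leNgt hl1.
have [he1 hw1] := edge_to_sep hu1 hs1 hsn hup h1.
have [he2 hw2] := edge_from_sep hu hs2 hdn h3.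
exists (4 * s :: fit l1 :: us), (l :: ls); split=> //.
- by rewrite !chain_cons he1 he2.
- by rewrite /labs [filter _ _]/= hlq sep_color eqxx; congr (_ :: _).
- by rewrite /= hnl.
- rewrite [LHS]/= hw1 hw2 hlen hsum (big_cat_nat hs1 hs2) /= mulrS; ring.
Qed.

Lemma completeness : exists us,
  [/\ chain G (4 * n) us,
       (forall a, count (fun v => ncolor G v == a) (labs G (4 * n :: us)) <=
         #|[pred l | used l & col l == a]|),
       size (labs G (4 * n :: us)) <= #|[pred l | used l]| &
       (clen G (4 * n) us <= lam * #|T|%:R + \sum_(0 <= i < n) `|H (g i) - y i|)%R].
Proof.
have hn := wf_n wf.
have := @arg_minP _ _ _ (g 0) [pred l | used l] H (g_used hn).
case=> l /= hu hmin; have [us [ls [hch hlabs huniq hls hlen]]] := reach hu.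
have hall i : nbelow (fit l) <= i -> i < n -> g i = l.
  move=> h1 h2; apply: H_inj; apply/eqP; rewrite eq_le not_above //=.
  by apply: hmin; apply: g_used.
have h1 : fit l %% 4 = 1 -> nbelow (fit l) < n.
  by move=> /(fit_serves_below hu) [i [h2 h3 _]]; apply: leq_ltn_trans h3.
have [he hw] := edge_to_sep hu (fit_le_n hu) (leqnn n) hall h1.
exists (fit l :: us).
have hl : labs G (4 * n :: fit l :: us) = map fit ls.
  by rewrite /labs [filter _ _]/= sep_color eqxx /= -hlabs.
have hsz : size ls <= #|[pred l | used l]|.
  rewrite -(card_uniqP huniq); apply: subset_leq_card; apply/fintype.subsetP => x.
  by move/hls => /andP [h _]; rewrite inE.
split; last 1 first.
- rewrite [leLHS]/= hw hlen addrC -addrA -(big_cat_nat (leq0n _) (fit_le_n hu)) /=.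
  apply: lerD.
    apply: ler_wpM2l; first exact: wf_lam wf.
    by rewrite ler_nat; apply: leq_trans hsz (max_card _).
  rewrite !big_mkord.
  (* The vertical length is split by label, so that [fit_cost] applies to each label separately. *)
  rewrite (partition_big (fun i : 'I_n => g i) predT) //=.
  rewrite [leRHS](partition_big (fun i : 'I_n => g i) predT) //=.
  apply: ler_sum => l' _; case: (boolP (used l')) => hu'; last first.
    rewrite !big1 // => i /eqP hi; move: hu'; rewrite -hi g_used //.
  have := fit_cost hu'; rewrite !big_mkord => h.
  rewrite (eq_bigr (fun i : 'I_n => `|nheight G (fit l') - y i|%R)).
    by rewrite [leRHS](eq_bigr (fun i : 'I_n => `|H l' - y i|%R)) // => i /eqP ->.
  by move=> i /eqP e; rewrite /fcost e.
- by rewrite chain_cons he.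
- move=> a; rewrite [X in count _ X](_ : _ = map fit ls); last exact: hl.
  rewrite count_map -size_filter.
  rewrite -(card_uniqP (filter_uniq _ huniq)).
  apply: subset_leq_card; apply/fintype.subsetP => x; rewrite mem_filter inE.
  by case/andP => /= h /hls /andP [h2 _]; rewrite inE h2 -(fit_color h2).
- rewrite [X in size X](_ : _ = map fit ls); last exact: hl.
  by rewrite size_map.
Qed.

End Completeness.

(** * From chains to labelings *)

Section Soundness.
Variables (R : realType) (G : config R).
Local Notation n := (cfg_n G).
Local Notation q := (cfg_q G).
Local Notation c := (cfg_c G).
Local Notation y := (cfg_y G).
Local Notation ym := (cfg_ym G).
Local Notation yp := (cfg_yp G).
Local Notation lam := (cfg_lam G).
Hypothesis wf : wf_config G.

Lemma label_lt v : v <= 4 * n -> ncolor G v != q -> v %/ 4 < n /\ 0 < v %% 4.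
Proof.
move=> hv; rewrite /ncolor; case e: (v %% 4) => [|r]; first by rewrite eqxx.
by split=> //; lia.
Qed.

Lemma prev_color_le t : t < n -> prev_color G t <= q.
Proof.
elim: t => [|t IH] ht //=; case: ifP => _; first exact: IH (ltnW ht).
exact: ltnW (wf_c wf (ltnW ht)).
Qed.

Lemma next_color_rev_le j : j < n -> next_color_rev G j <= q.
Proof.
elim: j => [|j IH] hj //=; case: ifP => _; first exact: IH (ltnW hj).
by apply: ltnW; apply: (wf_c wf); lia.
Qed.

Lemma label_color v : v <= 4 * n -> ncolor G v != q -> ncolor G v < q.
Proof.
move=> hv hq; have [ht _] := label_lt hv hq; rewrite ltn_neqAle hq /=.
rewrite /ncolor; case: (v %% 4) => [|[|[|_]]] //.
- by case: ifP => // _; apply: next_color_rev_le; lia.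
- exact: ltnW (wf_c wf ht).
- by case: ifP => // _; apply: prev_color_le.
Qed.

Lemma label_height v : v <= 4 * n -> ncolor G v != q ->
  (yp (v %/ 4) <= nheight G v <= ym (v %/ 4))%R.
Proof.
move=> hv hq; have [ht _] := label_lt hv hq.
have h1 := wf_ym wf ht; have h2 := wf_yp wf ht.
have h3 := lt_trans h2 h1.
move: hq; rewrite /nheight /ncolor; case: (v %% 4) => [|[|[|r]]] hq.
- by move: hq; rewrite eqxx.
- by rewrite lexx ltW.
- by rewrite !ltW.
- by rewrite lexx ltW.
Qed.

Lemma height_lt u v : u < v -> v <= 4 * n -> ncolor G u != q -> ncolor G v != q ->
  (nheight G v < nheight G u)%R.
Proof.
move=> huv hv hqu hqv; have hu := leq_trans (ltnW huv) hv.
have [hu1 hu2] := label_lt hu hqu; have [hv1 hv2] := label_lt hv hqv.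
case: (ltnP (u %/ 4) (v %/ 4)) => h.
  have /andP [h1 _] := label_height hu hqu.
  have /andP [_ h2] := label_height hv hqv.
  by apply: le_lt_trans h2 (lt_le_trans _ h1); apply: (ym_lt_yp wf).
have e : u %/ 4 = v %/ 4 by lia.
have hr : u %% 4 < v %% 4 by lia.
have h1 := wf_ym wf hv1; have h2 := wf_yp wf hv1; have h3 := lt_trans h2 h1.
rewrite /nheight e; have : v %% 4 < 4 by rewrite ltn_pmod.
by move: hr hu2; case: (u %% 4) => [|[|[|?]]]; case: (v %% 4) => [|[|[|[|?]]]].
Qed.

Lemma height_below_point v i : v <= 4 * n -> ncolor G v != q -> i < nabove v ->
  (nheight G v < y i)%R.
Proof.
move=> hv hq hi; have [ht hr] := label_lt hv hq.
have /andP [_ hm] := label_height hv hq.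
case: (ltnP i (v %/ 4)) => h.
  apply: le_lt_trans hm _; apply: lt_trans (wf_yp wf (ltn_trans h ht)).
  exact: (ym_lt_yp wf).
have [e ->] : v %% 4 = 3 /\ i = v %/ 4.
  by move: hi h; rewrite /nabove; case: eqP; lia.
by rewrite /nheight e; apply: wf_yp.
Qed.

Lemma height_above_point v i : v <= 4 * n -> ncolor G v != q ->
  nbelow v <= i -> i < n -> (y i < nheight G v)%R.
Proof.
move=> hv hq hi hin; have [ht hr] := label_lt hv hq.
have /andP [hp _] := label_height hv hq.
case: (ltnP (v %/ 4) i) => h.
  apply: lt_le_trans hp; apply: lt_trans (wf_ym wf hin) _.
  exact: (ym_lt_yp wf).
have [e ->] : v %% 4 = 1 /\ i = v %/ 4.
  by move: hi h hr; rewrite /nbelow; lia.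
by rewrite /nheight e; apply: wf_ym.
Qed.

Lemma owner_mem v us i : owner G v us i \in v :: us.
Proof.
elim: us v => [|u us IH] v; first by rewrite /= inE.
rewrite /=; case: ifP => _; last by rewrite inE IH orbT.
by case: ifP; rewrite !inE eqxx ?orbT.
Qed.

Lemma owner_color v us i : chain G v us -> i < nbelow v ->
  ncolor G (owner G v us i) = c i.
Proof.
elim: us v => [|u us IH] v; first by rewrite chain_nil => /eqP ->.
rewrite chain_cons => /andP [he hch] hi /=; case: leqP => hu; last exact: IH.
case: eqP => [-> //|ne].
case: (ltnP i (nabove v)) => hv; last by case: ne; rewrite (passing_color G hv hi).
by case: (edge_colors he hu hv) => // e; case: ne.
Qed.

Lemma chain_le v us w : chain G v us -> v <= 4 * n -> w \in v :: us -> w <= 4 * n.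
Proof.
move=> hch hv; rewrite inE => /orP [/eqP -> //|/(chain_mem_leq hch) h].
by apply: ltnW; apply: leq_trans h hv.
Qed.

Lemma chain_tail_label u v us i : chain G v (u :: us) ->
  nbelow u <= i -> i < nbelow v -> c i != ncolor G v ->
  i < nabove v /\ ncolor G u = c i.
Proof.
rewrite chain_cons => /andP [he _] hu hv hne.
have hi : i < nabove v.
  rewrite ltnNge; apply/negP => h; move: hne.
  by rewrite (passing_color G h hv) eqxx.
by split=> //; case: (edge_colors he hu hi) => // e; move: hne; rewrite e eqxx.
Qed.

(** A point is served by one of the two chain neighbors that enclose it, and heights are ordered
    along the chain; hence every other backbone lies beyond one end of its leader. *)
Lemma owner_no_cross v us i w : chain G v us -> v <= 4 * n -> i < nbelow v ->
  w \in v :: us -> ncolor G w != q -> w != owner G v us i ->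
  let x := owner G v us i in
  (y i < nheight G w /\ nheight G x < nheight G w \/
   nheight G w < y i /\ nheight G w < nheight G x)%R.
Proof.
elim: us v => [|u us IH] v; first by rewrite chain_nil => /eqP ->.
move=> hch hv hi hw hwq hwx /=.
have hin : i < n by apply: leq_trans hi (nbelow_le hv).
have hciq : c i != q by rewrite neq_ltn (wf_c wf).
have hw4 := chain_le hch hv hw; have hch0 := hch.
move: hch hwx; rewrite chain_cons => /andP [he hch]; have huv : u < v by case/andP: he.
have hu4 : u <= 4 * n by apply: leq_trans (ltnW huv) hv.
rewrite /=; case: leqP => hui hwx; last first.
  move: hw; rewrite inE => /orP [/eqP ewv|hw]; last exact: IH.
  right; set x := owner G u us i; have hx : x \in u :: us by apply: owner_mem.
  have hxu : x < v.
    move: hx; rewrite inE => /orP [/eqP -> //|/(chain_mem_leq hch) h].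
    exact: ltn_trans h huv.
  have hxq : ncolor G x != q by rewrite owner_color.
  split; last by rewrite ewv in hwq *; apply: height_lt.
  apply: height_below_point => //; rewrite ewv.
  by apply: leq_trans hui _; apply: below_above.
case: (eqVneq (c i) (ncolor G v)) hwx => [ec|ne] hwx.
  have hvq : ncolor G v != q by rewrite -ec.
  have hwu : w \in u :: us by move: hw; rewrite inE (negbTE hwx).
  have hwle : w <= u.
    by move: hwu; rewrite inE => /orP [/eqP -> //|/(chain_mem_leq hch) /ltnW].
  left; split; last by apply: height_lt => //; apply: leq_ltn_trans huv.
  apply: height_above_point => //; apply: leq_trans hui; exact: nbelow_mono.
have [hia huc] := chain_tail_label hch0 hui hi ne.
have huq : ncolor G u != q by rewrite huc.
move: hw; rewrite !inE (negbTE hwx) => /orP [/eqP ewv|hw].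
  right; rewrite ewv in hwq *; split; first exact: height_below_point.
  exact: height_lt.
have hwu := chain_mem_leq hch hw.
left; split; last exact: height_lt.
apply: height_above_point => //; apply: leq_trans hui; exact: nbelow_mono (ltnW hwu).
Qed.

Lemma clen_owner v us : chain G v us -> v <= 4 * n ->
  (clen G v us = lam * (size (labs G (v :: us)))%:R +
    \sum_(0 <= i < nbelow v) `|nheight G (owner G v us i) - y i|)%R.
Proof.
elim: us v => [|u us IH] v.
  rewrite chain_nil => /eqP -> _.
  by rewrite /labs /= ncolor0 eqxx /= mulr0 add0r /nbelow big_geq.
move=> hch hv; have hch0 := hch; move: hch.
rewrite chain_cons => /andP [he hch]; have huv : u < v by case/andP: he.
have hu4 : u <= 4 * n by apply: leq_trans (ltnW huv) hv.
pose f i : R := `|nheight G (owner G v (u :: us) i) - y i|%R.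
have hf i : nbelow u <= i -> i < nabove v ->
   f i = if c i == ncolor G v then `|nheight G v - y i|%R else `|nheight G u - y i|%R.
  by move=> h1 h2; rewrite /f /= h1; case: ifP.
rewrite [LHS]/= (edge_weight he hf) IH //.
have -> : (\sum_(0 <= i < nbelow v) `|nheight G (owner G v (u :: us) i) - y i| =
   \sum_(0 <= i < nbelow u) `|nheight G (owner G u us i) - y i| +
   \sum_(nbelow u <= i < nabove v) f i)%R.
  rewrite (big_cat_nat (leq0n _) (above_below v)) /=.
  rewrite (big_cat_nat (leq0n _) (below_above huv)) /= -addrA.
  rewrite [X in (_ + (_ + X))%R]big_nat [X in (_ + (_ + X))%R]big1 ?addr0.
    congr (_ + _)%R; rewrite big_nat [RHS]big_nat.
    by apply: eq_bigr => i /andP [_ h]; rewrite leqNgt h.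
  move=> i /andP [h1 h2]; rewrite (leq_trans (below_above huv) h1).
  by rewrite (passing_color G h1 h2) eqxx (passing_height G h1 h2) subrr normr0.
have -> : size (labs G (v :: u :: us)) =
   (ncolor G v != q) + size (labs G (u :: us)) by rewrite /labs /=; case: ifP.
by rewrite natrD; case: eqP => _ /=; ring.
Qed.

End Soundness.

(** * Transfer between labelings of an instance and chains *)

Section Instance.
Variables (R : realType) (I : instance R) (cb : bool).

Definition config_of : config R :=
  {| cfg_n := npts I;
     cfg_q := ncol I;
     cfg_c := arr 0 (fun i => val (pcol I i));
     cfg_y := arr 0%R (py I);
     cfg_ym := arr 0%R (yminus I);
     cfg_yp := arr 0%R (yplus I);
     cfg_lo := ybot I;
     cfg_hi := ytop I;
     cfg_lam := if cb then (xright I - xleft I)%R else 0%R |}.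

Local Notation G := config_of.
Local Notation n := (npts I).

Lemma arr_ord (T : Type) (z : T) m (f : 'I_m -> T) (i : 'I_m) : arr z f i = f i.
Proof. by rewrite /arr valK. Qed.

Lemma arr_Ordinal (T : Type) (z : T) m (f : 'I_m -> T) i (hi : i < m) :
  arr z f i = f (Ordinal hi).
Proof. exact: (arr_ord z f (Ordinal hi)). Qed.

Hypothesis wfI : wf_instance I.

Lemma wf_config_of : wf_config G.
Proof.
case: wfI => hn [hx hy] hr _ [hpm hg]; split=> //= [i hi|i hi|i hi|i hi|i hi|i hi|].
- by rewrite (arr_Ordinal _ _ hi) /=.
- by rewrite (arr_Ordinal _ _ hi); case: (hr (Ordinal hi)) => _ /andP [].
- by rewrite (arr_Ordinal _ _ hi); case: (hr (Ordinal hi)) => _ /andP [].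
- by rewrite !(arr_Ordinal _ _ hi); case: (hpm (Ordinal hi)).
- by rewrite !(arr_Ordinal _ _ hi); case: (hpm (Ordinal hi)).
- by rewrite (arr_Ordinal _ _ hi) (arr_Ordinal _ _ (ltnW hi)); apply: hg.
- by case: cb => //; rewrite subr_ge0 ltW.
Qed.

Let wf := wf_config_of.

Lemma exists_point : exists p : 'I_n, True.
Proof. by case: wfI => hn _ _ _ _; exists (Ordinal hn). Qed.

Lemma crossing_freeI (L : labeling I) : injective (lht (l:=L)) ->
  (forall p l, l != asg L p ->
    (py I p < lht l /\ lht (asg L p) < lht l \/
     lht l < py I p /\ lht l < lht (asg L p))%R) -> crossing_free L.
Proof.
move=> hinj hnc l1 l2 hne; rewrite -subset0 => -[x h] [].
have hseg p l : l != asg L p -> (h == lht l)%R ->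
    ~ (Num.min (py I p) (lht (asg L p)) <= h <= Num.max (py I p) (lht (asg L p)))%R.
  move=> hl /eqP ->; rewrite ge_min le_max.
  by case: (hnc p l hl) => -[h1 h2] /andP [/orP h3 /orP h4]; case: h3; case: h4;
    rewrite leNgt ?h1 ?h2 // => h5; rewrite leNgt ?h1 ?h2.
case=> [[/= e1 _]|[p /= ep1 [/= ex1 eh1]]] [[/= e2 _]|[p' /= ep2 [/= ex2 eh2]]].
- by apply: hne; apply: hinj; rewrite -e1 -e2.
- apply: (hseg p' l1) eh2; last by rewrite e1.
  by rewrite ep2; apply/eqP.
- apply: (hseg p l2) eh1; last by rewrite e2.
  by rewrite ep1; apply/eqP => e; apply: hne.
(* Two vertical segments can only meet at equal x-coordinates, that is, for the same point. *)
- case: wfI => _ _ _ hpx _.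
  by apply: hne; rewrite -ep1 -ep2; congr asg; apply: hpx; rewrite -ex1 -ex2.
Qed.

Lemma soundness us : chain G (4 * n) us -> exists L : labeling I,
  let s := labs G (4 * n :: us) in
  [/\ backbone_labeling L, nlab L = size s,
      forall l : 'I_(nlab L), lcol l = ncolor G (nth 0 s l) :> nat &
      forall l : 'I_(nlab L), lht l = nheight G (nth 0 s l)] /\
  [/\ forall p : 'I_n, asg L p = index (owner G (4 * n) us p) s :> nat,
      labeling_length cb L = clen G (4 * n) us &
      forall a : 'I_(ncol I), #|[pred l : 'I_(nlab L) | lcol l == a]| =
        count (fun v => ncolor G v == a) s].
Proof.
move=> hch; pose s := labs G (4 * n :: us); have [p0 _] := exists_point.
have hbel : nbelow (4 * n) = n by rewrite sep_nbelow.
have hs v : v \in s -> v <= 4 * n /\ ncolor G v != ncol I.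
  rewrite mem_filter => /andP [h1 h2]; split=> //.
  exact: (chain_le hch (leqnn (4 * n)) h2).
have hu : uniq s by apply: filter_uniq; apply: chain_uniq hch.
have ho (p : 'I_n) : owner G (4 * n) us p \in s.
  rewrite mem_filter owner_mem andbT (owner_color hch) ?hbel //.
  by rewrite neq_ltn (wf_c wf).
have hi (p : 'I_n) : index (owner G (4 * n) us p) s < size s by rewrite index_mem.
(* The default of [insubd] never shows: by [hcol] below, all nodes of [s] have colors in range. *)
pose L := @Labeling R I (size s) (fun l => insubd (pcol I p0) (ncolor G (nth 0 s l)))
  (fun l => nheight G (nth 0 s l)) (fun p => Ordinal (hi p)).
have hmem (l : 'I_(nlab L)) : nth 0 s l \in s by apply: mem_nth; apply: ltn_ord.
have hcol v : v \in s -> ncolor G v < ncol I.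
  move=> hv; have [h1 h2] := hs v hv.
  exact: (label_color wf h1 h2).
have hlcol (l : 'I_(nlab L)) : lcol l = ncolor G (nth 0 s l) :> nat.
  by rewrite /= val_insubd hcol.
have hasg (p : 'I_n) : nth 0 s (asg L p) = owner G (4 * n) us p.
  by rewrite /= nth_index.
have hnth (l l' : 'I_(nlab L)) : l != l' -> nth 0 s l != nth 0 s l'.
  by move=> h; rewrite nth_uniq // ltn_ord.
exists L; split; split=> //; last 1 first.
- move=> a; transitivity (count (fun v => ncolor G v == a) s); last by [].
  rewrite -sum1_count (big_nth 0) big_mkord sum1_card.
  apply: eq_card => l; rewrite !inE -(inj_eq val_inj).
  by congr (_ == _); apply: hlcol.
- split.
  + move=> p; apply: val_inj; apply: etrans (hlcol (asg L p)) _.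
    rewrite hasg (owner_color hch) ?hbel //=; exact: arr_ord.
  + move=> l /=; have [h1 h2] := hs _ (hmem l).
    have [ht hr] := label_lt (G := G) h1 h2.
    have hlo := wf_lo wf ht; have hhi := wf_hi wf ht.
    have hm := wf_ym wf ht; have hp := wf_yp wf ht; move: h2.
    rewrite /nheight /ncolor; case: (_ %% 4) hr => [|[|[|r]]] // _.
    * case: ifP => [h _|_]; last by rewrite eqxx.
      by rewrite andbT; exact: le_trans hlo (ltW hm).
    * by move=> _; apply/andP; split; [exact: hlo | exact: hhi].
    * case: ifP => [h _|_]; last by rewrite eqxx.
      by exact: le_trans (ltW hp) hhi.
  + move=> l /=; have [h1 h2] := hs _ (hmem l).
    have [ht hr] := label_lt (G := G) h1 h2; have hc := hlcol l.
    move: h2 hc; rewrite /through_own_point /= /nheight /ncolor.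
    set t := (_ %/ 4) in ht *; pose p := Ordinal ht.
    have hlast : t.+1 = n \/ t.+1 < n.
      by case: (ltnP t.+1 n) => h; [right | left; apply/eqP; rewrite eqn_leq ht].
    case: (_ %% 4) hr => [|[|[|r]]] // _ h2 hc.
    * right; rewrite /= (arr_Ordinal _ _ ht).
      case: (eqVneq t 0) => h0; first by constructor 1; exists p; rewrite lexx.
      rewrite -lt0n in h0; have ht' : t.-1 < n by apply: leq_ltn_trans (leq_pred _) ht.
      constructor 3; exists (Ordinal ht'), p; rewrite /= prednK // lexx.
      split=> //; case: wfI => _ _ _ _ [_ hg].
      by apply: ltW; apply: hg; rewrite /= prednK.
    * left; exists p; rewrite /= (arr_Ordinal _ _ ht); split=> //.
      by apply: val_inj; apply: etrans hc _; rewrite /= (arr_Ordinal _ _ ht).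
    * right; rewrite /= (arr_Ordinal _ _ ht).
      case: hlast => h0; first by constructor 2; exists p; rewrite lexx.
      constructor 3; exists p, (Ordinal h0); rewrite lexx andbT.
      split=> //; case: wfI => _ _ _ _ [_ hg].
      by apply: ltW; apply: hg.
  + apply: crossing_freeI => [l l' /= h|p l hl].
      apply/eqP; apply/negPn/negP => hll.
      have hne := hnth _ _ hll.
      have [h1 h2] := hs _ (hmem l); have [h3 h4] := hs _ (hmem l').
      move: hne; rewrite neq_ltn => /orP [h5|h5].
        by have := height_lt wf h5 h3 h2 h4; rewrite h ltxx.
      by have := height_lt wf h5 h1 h4 h2; rewrite h ltxx.
    have [h1 h2] := hs _ (hmem l).
    have hw : nth 0 s l \in 4 * n :: us.
      by have := hmem l; rewrite mem_filter => /andP [].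
    have hne := hnth _ _ hl; rewrite hasg in hne.
    have hlt : p < nbelow (4 * n) by rewrite hbel.
    have := owner_no_cross wf hch (leqnn _) hlt hw h2 hne.
    by rewrite -hasg /= (arr_ord 0%R (py I)).
- rewrite (clen_owner hch (leqnn _)) hbel /labeling_length big_mkord.
  congr (_ + _)%R; apply: eq_bigr => p _.
  by rewrite -hasg distrC /= (arr_ord 0%R (py I)).
Qed.

(** The exchange argument that secures [g_mono]. Backbones and colors are kept, and among the
    finitely many assignments without crossings a cheapest one [f] is taken. If it served two points
    of one color in the wrong order, either point could be moved to the backbone of the other
    without crossings, and one of these two changes would save length. *)
Lemma completeness_of (L : labeling I) : backbone_labeling L -> exists us,
  [/\ chain G (4 * n) us,
      forall a : 'I_(ncol I), count (fun v => ncolor G v == a) (labs G (4 * n :: us))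
        <= #|[pred l : 'I_(nlab L) | lcol l == a]|,
      size (labs G (4 * n :: us)) <= nlab L &
      (clen G (4 * n) us <= labeling_length cb L)%R].
Proof.
case=> hcol hrange hvalid hcf; have [p0 _] := exists_point.
case: (wfI) => hn [hx hy] hr hpx [hpm hg].
pose m := nlab L; pose H : 'I_m -> R := @lht _ _ L.
have hback (l : 'I_m) (x : R) : (xleft I <= x <= xright I)%R -> leader l (x, H l).
  by move=> h; left.
have hinj : injective H.
  move=> l l' e; apply/eqP; apply/negPn/negP => /eqP hne.
  have := hcf l l' hne; rewrite -subset0 => /(_ (xleft I, H l)); apply.
  by split; [|rewrite e]; apply: hback; rewrite lexx ltW.
pose ok (f : {ffun 'I_n -> 'I_m}) := [forall p,
  (lcol (f p) == pcol I p) && [forall l, (l != f p) ==>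
    ((py I p < H l) && (H (f p) < H l) || (H l < py I p) && (H l < H (f p)))%R]].
pose cost (f : {ffun 'I_n -> 'I_m}) := (\sum_(p < n) `|H (f p) - py I p|)%R.
pose f0 : {ffun 'I_n -> 'I_m} := [ffun p => asg L p].
have hf0 : ok f0.
  apply/forallP => p; rewrite ffunE hcol eqxx /=; apply/forallP => l; apply/implyP => hl.
  have hp : (xleft I <= px I p <= xright I)%R by case: (hr p).
  have hnot : ~ vsegment L p (px I p, H l).
    move=> hs; have := hcf l (asg L p) (elimN eqP hl); rewrite -subset0.
    by move/(_ (px I p, H l)); apply; split; [apply: hback | right; exists p].
  have hHl : H (asg L p) != H l by apply: contra hl => /eqP /hinj ->.
  move: hnot; rewrite /vsegment /= -/(H _) => hnot.
  case: (ltP (py I p) (H l)) => h1; case: (ltP (H (asg L p)) (H l)) => h2 //=.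
  + by exfalso; apply: hnot; split=> //; rewrite ge_min le_max (ltW h1) h2 orbT.
  + by exfalso; apply: hnot; split=> //; rewrite ge_min le_max (ltW h2) h1 orbT.
  + rewrite !lt_neqAle h1 h2 [H l == H _]eq_sym hHl !andbT.
    apply/eqP => e; apply: hnot; split=> //.
    by rewrite ge_min le_max -e lexx.
case: (arg_minP cost hf0) => f hf hmin.
have fP p : lcol (f p) = pcol I p /\ forall l, l != f p ->
    (py I p < H l /\ H (f p) < H l \/ H l < py I p /\ H l < H (f p))%R.
  have /andP [/eqP h1 /forallP h2] := forallP hf p; split=> // l hl.
  have /implyP /(_ hl) := h2 l.
  by case/orP => /andP []; [left | right].
have reassign p l : lcol l = pcol I p -> (forall l', l' != l ->
    (py I p < H l' /\ H l < H l' \/ H l' < py I p /\ H l' < H l)%R) ->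
    (`|H (f p) - py I p| <= `|H l - py I p|)%R.
  move=> hl hlc; pose f' : {ffun 'I_n -> 'I_m} := [ffun x => if x == p then l else f x].
  have hf' : ok f'.
    apply/forallP => x; rewrite ffunE; case: (eqVneq x p) => [->|_]; last exact: (forallP hf).
    rewrite hl eqxx /=; apply/forallP => l'; apply/implyP => /hlc.
    by case=> -[-> ->]; rewrite ?orbT.
  have := hmin _ hf'; rewrite /cost (bigD1 p) //= [leRHS](bigD1 p) //=.
  rewrite ffunE eqxx.
  rewrite [X in (_ <= _ + X)%R -> _](eq_bigr (fun x => `|H (f x) - py I x|%R)).
    by rewrite lerD2r.
  by move=> x /negbTE hx'; rewrite ffunE hx'.
(* Values beyond the last point are arbitrary. *)
pose g i := oapp f (f p0) (insub i).
have gE i (hi : i < n) : g i = f (Ordinal hi) by rewrite /g insubT.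
have ydec (i j : 'I_n) : i < j -> (py I j < py I i)%R.
  move=> hij; have := y_dec wf hij (ltn_ord j).
  by rewrite /= !(arr_ord 0%R (py I)).
have yE i (hi : i < n) : cfg_y G i = py I (Ordinal hi) by apply: arr_Ordinal.
have hA4 l : (exists2 i, i < n & H l = cfg_y G i) \/
    exists t, [/\ t <= n, forall s, t = s.+1 -> (H l <= cfg_yp G s)%R &
                t < n -> (cfg_ym G t <= H l)%R].
  case: (hvalid l) => [[i [h _]]|].
    by left; exists i => //; apply: etrans h _; rewrite /= (arr_ord 0%R (py I)).
  case=> [[i [hi h]]|[i [hi h]]|[i [j [hj /andP [ha hb]]]]]; right.
  + exists 0; split=> // _.
    by move: h; rewrite -hi /= (arr_ord 0%R (yminus I)).
  + exists n; split; rewrite ?ltnn // => t ht.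
    have -> : t = i by apply: succn_inj; rewrite hi.
    by rewrite /= (arr_ord 0%R (yplus I)).
  + exists j; split; [exact: ltnW (ltn_ord j) | move=> t ht | move=> _].
      have -> : t = i by apply: succn_inj; rewrite -hj.
      by rewrite /= (arr_ord 0%R (yplus I)).
    by rewrite /= (arr_ord 0%R (yminus I)).
have hA3 i j : i < j -> j < n -> cfg_c G i = cfg_c G j -> (H (g j) <= H (g i))%R.
  move=> hij hj hc; have hi := ltn_trans hij hj.
  set p := Ordinal hi; set r := Ordinal hj; rewrite !gE -/p -/r.
  have hcol' : pcol I p = pcol I r.
    by apply: val_inj; move: hc; rewrite /= !(arr_Ordinal _ _ hi) !(arr_Ordinal _ _ hj).
  have hpr : (py I r < py I p)%R by apply: ydec.
  rewrite leNgt; apply/negP => hlt.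
  have [cp np] := fP p; have [cr nr] := fP r.
  have hne : f p != f r by apply/eqP => e; move: hlt; rewrite e ltxx.
  (* The wrong order forces the lower backbone below both points and the upper one above both. *)
  have a1 : (H (f p) < py I r)%R.
    by case: (nr _ hne) => -[] // _ h; have := lt_trans h hlt; rewrite ltxx.
  have a2 : (py I p < H (f r))%R.
    have hne' : f r != f p by rewrite eq_sym.
    by case: (np _ hne') => -[] // _ h; have := lt_trans h hlt; rewrite ltxx.
  have b1 := reassign p (f r) (etrans cr (esym hcol')).
  have b2 := reassign r (f p) (etrans cp hcol').
  have {}b1 : (`|H (f p) - py I p| <= `|H (f r) - py I p|)%R.
    apply: b1 => l' /nr [] [e1 e2].
      by left; split=> //; apply: lt_trans e2.
    by right; split=> //; apply: lt_trans hpr.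
  have {}b2 : (`|H (f r) - py I r| <= `|H (f p) - py I r|)%R.
    apply: b2 => l' /np [] [e1 e2].
      by left; split=> //; apply: lt_trans e1.
    by right; split=> //; apply: lt_trans a1.
  (* The two inequalities add up to [py I p <= py I r], against the order of the points. *)
  move: b1 b2; rewrite ler0_norm; last by rewrite subr_le0 ltW // (lt_trans a1).
  rewrite ger0_norm; last by rewrite subr_ge0 ltW.
  rewrite ger0_norm; last by rewrite subr_ge0 ltW // (lt_trans hpr).
  rewrite ler0_norm; last by rewrite subr_le0 ltW.
  by move: hpr; clear; lra.
have hA2 i l : i < n -> l != g i -> (cfg_y G i < H l)%R /\ (H (g i) < H l)%R \/
    (H l < cfg_y G i)%R /\ (H l < H (g i))%R.
  move=> hi hl; rewrite gE in hl *; rewrite yE.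
  by have [_ h] := fP (Ordinal hi); apply: h.
have hA1 i : i < n -> lcol (g i) = cfg_c G i :> nat.
  move=> hi; rewrite gE /= (arr_Ordinal _ _ hi).
  by have [-> _] := fP (Ordinal hi).
have [us [h1 h2 h3 h4]] := completeness wf (H := H) (col := fun l => lcol l) hinj hA1 hA2 hA3 hrange hA4.
exists us; split=> //.
+ move=> a; apply: leq_trans (h2 a) _; apply: subset_leq_card.
  by apply/fintype.subsetP => l; rewrite !inE => /andP [_]; rewrite -(inj_eq val_inj).
+ by apply: leq_trans h3 _; rewrite -[leqRHS]card_ord; apply: max_card.
+ apply: le_trans h4 _; rewrite card_ord /labeling_length; apply: lerD => //.
  apply: le_trans (_ : cost f <= _)%R.
    rewrite big_mkord; apply: ler_sum => p _.
    by rewrite /g valK /= (arr_ord 0%R (py I)).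
  apply: le_trans (hmin _ hf0) _; apply: ler_sum => p _.
  by rewrite ffunE distrC.
Qed.

End Instance.

(** * Budgets and the recurrence *)

Section Budget.
Variables (wt md : nat -> nat).

(** The remainder modulo [md a] cuts off the places above that of [a], so the test says that the
    digit of [a] is not zero, and no borrow occurs. With [wt a = 1] and [md a] above every budget
    this is a plain counter; thus one program serves both kinds of bounds. *)
Definition spend (a kap : nat) : option nat :=
  if wt a <= kap %% md a then Some (kap - wt a) else None.

Fixpoint affordable (kap : nat) (s : seq nat) : bool :=
  if s is a :: s' then
    if spend a kap is Some kap' then affordable kap' s' else false
  else true.

Lemma spend_le a kap kap' : spend a kap = Some kap' -> kap' <= kap.
Proof. by rewrite /spend; case: ifP => // _ [<-]; apply: leq_subr. Qed.

(* Weights and moduli of a mixed-radix number system with [k a] digits at the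
   place of [a]. *)
Definition radix (used : pred nat) (k : nat -> nat) (P : nat) : Prop :=
  (forall a, used a -> [/\ 0 < wt a, 0 < k a, md a = k a * wt a & md a %| P]) /\
  (forall a b, used a -> used b -> a != b -> md a %| wt b \/ md b %| wt a).

(** Spending on [a] lowers its digit by one and keeps the others: a place below that of [a] has a
    modulus dividing [wt a], and a place above it is not reached by a borrow. *)
Lemma affordable_radix used k P : radix used k P -> forall s kap,
  all used s -> affordable kap s <->
  forall a, used a -> count_mem a s <= (kap %% md a) %/ wt a.
Proof.
move=> [hr hch]; elim=> [|a s IH] kap //= /andP [ha hs].
have [wa ka ea _] := hr a ha.
have mda : 0 < md a by rewrite ea muln_gt0 ka.
have digit b : used b -> wt a <= kap %% md a ->
    (kap %% md b) %/ wt b = (a == b) + ((kap - wt a) %% md b) %/ wt b.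
  move=> hb hle; have hk : wt a <= kap by apply: leq_trans hle (leq_mod _ _).
  have [wb kb eb _] := hr b hb.
  case: (eqVneq a b) => [<-|hab].
    have -> : (kap - wt a) %% md a = kap %% md a - wt a.
      rewrite {1}(divn_eq kap (md a)) -addnBA // modnMDl modn_small //.
      exact: leq_ltn_trans (leq_subr _ _) (ltn_pmod _ mda).
    by rewrite -{1}(subnKC hle) -{1}[wt a]mul1n divnMDl.
  rewrite add0n; case: (hch a b ha hb hab) => hdv.
    rewrite eb -!modn_divl; congr (_ %% _).
    have hr' : wt a <= kap %% wt b.
      apply: leq_trans hle _; rewrite -(modn_dvdm kap hdv); exact: leq_mod.
    rewrite [in RHS](divn_eq kap (wt b)) -addnBA // divnMDl //.
    by rewrite [X in _ + X]divn_small ?addn0 // (leq_ltn_trans (leq_subr _ _)) ?ltn_pmod.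
  have mdb : 0 < md b by rewrite eb muln_gt0 kb.
  by rewrite modnB // (eqP hdv) ltn0 mul0n add0n subn0.
rewrite /spend; case: leqP => hle; last first.
  split=> // /(_ a ha); rewrite eqxx add1n divn_small //.
rewrite IH //; split=> h b hb; have := h b hb; rewrite digit // leq_add2l //.
Qed.

(** The largest budget has all digits maximal, because every [md a] divides [P]. *)
Lemma radix_top used k P a : radix used k P -> 0 < P -> used a ->
  (P.-1 %% md a) %/ wt a = (k a).-1.
Proof.
move=> [hr _] hP ha; have [wa ka ea /dvdnP [m em]] := hr a ha.
have mda : 0 < md a by rewrite ea muln_gt0 ka.
have hm : 0 < m by move: hP; rewrite em; case: m {em}.
have -> : P.-1 = m.-1 * md a + (md a).-1.
  by rewrite em; case: m hm {em} => // m _; rewrite mulSn; move: mda; case: (md a) => // d _; lia.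
rewrite modnMDl modn_small ?prednK //.
have -> : (md a).-1 = (k a).-1 * wt a + (wt a).-1.
  by rewrite ea; case: (k a) ka => // d _; rewrite mulSn; move: wa; case: (wt a) => // x _; lia.
by rewrite divnMDl // divn_small ?addn0 // prednK.
Qed.

Lemma affordable_unit (used : pred nat) P s kap :
  (forall a, used a -> wt a = 1 /\ md a = P) -> kap < P -> all used s ->
  affordable kap s = (size s <= kap).
Proof.
move=> h; elim: s kap => //= a s IH kap hk /andP [ha hs].
rewrite /spend (h a ha).1 (h a ha).2 modn_small //.
case: kap hk => [|kap] hk //=; rewrite subn1 IH //; exact: ltnW.
Qed.

End Budget.

Section Bellman.
Variables (R : realType) (G : config R).
Variables (wt md : nat -> nat) (P : nat).
Local Notation n := (cfg_n G).
Local Notation N := (4 * n + 1).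
Local Notation spend := (spend wt md).
Local Notation affordable := (affordable wt md).

Definition step (u v kap : nat) : option nat :=
  if first_use G u v then Some kap else spend (ncolor G v) kap.

(* [F v kap] tells whether node [v] can be reached within budget [kap]; then
   [D] is the least cost and [PR], [PK] are the predecessor and its budget. *)
Variables (F : nat -> nat -> bool) (D : nat -> nat -> R) (PR PK : nat -> nat -> nat).

(** The second clause makes every recorded cost attainable, the third says that no single edge
    improves on it. How the tables are filled is left open, so optimality and tracing back are
    independent of the program. *)
Definition bellman : Prop :=
  [/\ forall kap, kap < P -> F 0 kap /\ D 0 kap = 0%R,
       forall v kap, 0 < v -> v < N -> kap < P -> F v kap ->
         [/\ edge G (PR v kap) v, step (PR v kap) v kap = Some (PK v kap),
              F (PR v kap) (PK v kap) &
              D v kap = (D (PR v kap) (PK v kap) + weight G (PR v kap) v)%R] &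
       forall u v kap kap', v < N -> kap < P -> edge G u v ->
         step u v kap = Some kap' -> F u kap' ->
         F v kap /\ (D v kap <= D u kap' + weight G u v)%R].

Hypothesis hB : bellman.

Lemma step_le u v kap kap' : step u v kap = Some kap' -> kap' <= kap.
Proof. by rewrite /step; case: ifP => [_ [<-] //|_ /spend_le]. Qed.

Lemma bellman_optimal v us kap : chain G v us -> v < N -> kap < P ->
  affordable kap (repeats G v us) -> F v kap /\ (D v kap <= clen G v us)%R.
Proof.
case: hB => h0 h1 h2; elim: us v kap => [|u us IH] v kap.
  by rewrite chain_nil => /eqP -> _ hk _; have [h ->] := h0 kap hk.
rewrite chain_cons => /andP [he hch] hv hk hf.
have huv : u < v by case/andP: he.
have [kap' hs ha] : exists2 kap', step u v kap = Some kap' &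
    affordable kap' (repeats G u us).
  move: hf; rewrite /= /step; case: ifP => _ /=; first by exists kap.
  by case: (spend _ kap) => // kap'; exists kap'.
have hk' : kap' < P by apply: leq_ltn_trans hk; apply: step_le hs.
have [hF hD] := IH u kap' hch (ltn_trans huv hv) hk' ha.
have [hF' hD'] := h2 u v kap kap' hv hk he hs hF; split=> //.
by apply: le_trans hD' _; rewrite [leRHS]/= addrC lerD2l.
Qed.

(** Predecessors have smaller numbers, so fuel [v] is enough. *)
Fixpoint trace (fuel v kap : nat) : seq nat :=
  if fuel is f.+1 then
    if v == 0 then [::] else PR v kap :: trace f (PR v kap) (PK v kap)
  else [::].

Lemma trace_chain f v kap : v <= f -> v < N -> kap < P -> F v kap ->
  [/\ chain G v (trace f v kap), affordable kap (repeats G v (trace f v kap)) &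
      clen G v (trace f v kap) = D v kap].
Proof.
case: hB => h0 h1 h2; elim: f v kap => [|f IH] v kap hvf hv hk hF.
  move: hvf; rewrite leqn0 => /eqP ->; have [_ e] := h0 kap hk.
  by split=> //=.
rewrite [trace _ _ _]/=; case: posnP => hv0.
  by rewrite hv0; have [_ e] := h0 kap hk; split=> //=.
have [he hs hF' hD] := h1 v kap hv0 hv hk hF.
have huv : PR v kap < v by case/andP: he.
have hk' : PK v kap < P by apply: leq_ltn_trans hk; apply: step_le hs.
have [hch ha hl] := IH (PR v kap) (PK v kap)
  (leq_trans huv hvf) (ltn_trans huv hv) hk' hF'.
split.
- by rewrite chain_cons he.
- by move: hs; rewrite /= /step; case: ifP => _; [case=> e; rewrite [X in affordable X]e | move=> /= ->].
- by rewrite [LHS]/= hl hD addrC.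
Qed.

End Bellman.

(** * The program *)

(* Natural-number scalars (cell 0 of their array): 10 number of points,
   11 number of colors, 12 number of nodes, 13 row length of the counting tables,
   14 number of budgets, 15-19 loop counters, 35-57 temporaries.
   Natural-number arrays: 20, 21 nearest other color above and below each point,
   22-26 attributes of the nodes, 27 and 31 row offsets, 28 counting table,
   29, 30 weight and modulus of each color, 32-34 dynamic program.
   Reals: 10 cost of a backbone, 11 heights of the nodes, 13 length table,
   14 dynamic program, 15-17 temporaries. *)

Definition init_prog (cb : bool) : com :=
  10 <-- ILoad 0 (IConst 0) ;;
  11 <-- ILoad 0 (IConst 1) ;;
  12 <-- IAdd (IAdd (IAdd (V 10) (V 10)) (IAdd (V 10) (V 10))) (IConst 1) ;;
  13 <-- IAdd (V 10) (IConst 1) ;;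
  10 <~~ (if cb then RSub (RLoad 0 (IConst 1)) (RLoad 0 (IConst 0))
           else RConst 0).

Definition prev_body : com :=
  If (BILe (IConst 1) (V 15))
    (If (BIEq (ILoad 1 (ISub (V 15) (IConst 1))) (ILoad 1 (V 15)))
       (20 [V 15]<- ILoad 20 (ISub (V 15) (IConst 1)))
       (20 [V 15]<- ILoad 1 (ISub (V 15) (IConst 1))))
    (20 [V 15]<- V 11).

Definition next_body : com :=
  35 <-- ISub (ISub (V 10) (IConst 1)) (V 15) ;;
  If (BILe (IConst 1) (V 15))
    (If (BIEq (ILoad 1 (IAdd (V 35) (IConst 1))) (ILoad 1 (V 35)))
       (21 [V 35]<- ILoad 21 (IAdd (V 35) (IConst 1)))
       (21 [V 35]<- ILoad 1 (IAdd (V 35) (IConst 1))))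
    (21 [V 35]<- V 11).

Definition set_node (x col ab be nu nd : iexp) (h : rexp) : com :=
  22 [x]<- col ;; 23 [x]<- ab ;; 24 [x]<- be ;; 25 [x]<- nu ;; 26 [x]<- nd ;;
  11 [x]<~ h.

Definition node_prep : com :=
  36 <-- IAdd (IAdd (V 15) (V 15)) (IAdd (V 15) (V 15)) ;;
  If (BRLe (RLoad 3 (V 15)) (RLoad 0 (IConst 3)))
    (37 <-- ILoad 21 (V 15)) (37 <-- V 11) ;;
  If (BRLe (RLoad 0 (IConst 2)) (RLoad 4 (V 15)))
    (38 <-- ILoad 20 (V 15)) (38 <-- V 11).

Definition node_body : com :=
  node_prep ;;
  set_node (V 36) (V 11) (V 15) (V 15) (IConst 0) (IConst 0) (RConst 0) ;;
  set_node (IAdd (V 36) (IConst 1)) (V 37) (V 15) (V 15) (IConst 0) (IConst 1)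
    (RLoad 3 (V 15)) ;;
  set_node (IAdd (V 36) (IConst 2)) (ILoad 1 (V 15)) (V 15)
    (IAdd (V 15) (IConst 1)) (IConst 0) (IConst 0) (RLoad 2 (V 15)) ;;
  set_node (IAdd (V 36) (IConst 3)) (V 38) (IAdd (V 15) (IConst 1))
    (IAdd (V 15) (IConst 1)) (IConst 1) (IConst 0) (RLoad 4 (V 15)).

(** The third loop makes four nodes per point; the separator below the last point is left over. *)
Definition nodes_prog : com :=
  For 15 10 prev_body ;;
  For 15 10 next_body ;;
  For 15 10 node_body ;;
  set_node (ISub (V 12) (IConst 1)) (V 11) (V 10) (V 10) (IConst 0) (IConst 0)
    (RConst 0).

(** * Correctness of the node attributes *)

Section Phases.
Variables (R : realType) (G : config R) (bound : nat -> nat).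
Local Notation n := (cfg_n G).
Local Notation q := (cfg_q G).
Local Notation N := (4 * n + 1).
Implicit Types s : state R.

Record base s : Prop := Base {
  base_c : imem s 1 = cfg_c G;
  base_bound : imem s 2 = bound;
  base_n : imem s 10 0 = n;
  base_q : imem s 11 0 = q;
  base_N : imem s 12 0 = N;
  base_row : imem s 13 0 = n.+1;
  base_lo : rmem s 0 2 = cfg_lo G;
  base_hi : rmem s 0 3 = cfg_hi G;
  base_y : rmem s 2 = cfg_y G;
  base_ym : rmem s 3 = cfg_ym G;
  base_yp : rmem s 4 = cfg_yp G;
  base_lam : rmem s 10 0 = cfg_lam G }.

(** Boolean, so that for concrete programs the side conditions on frames are closed by
    evaluation. *)
Definition untouched (mi mr ai ar : seq nat) : bool :=
  ~~ has (mem mi) ai && ~~ has (mem mr) ar.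

Lemma frame_i mi mr s s' ai ar : frame mi mr s s' -> untouched mi mr ai ar ->
  forall a, a \in ai -> imem s' a = imem s a.
Proof. by case=> h _ /andP [/hasPn h1 _] a /h1 /h. Qed.

Lemma frame_r mi mr s s' ai ar : frame mi mr s s' -> untouched mi mr ai ar ->
  forall a, a \in ar -> rmem s' a = rmem s a.
Proof. by case=> _ h /andP [_ /hasPn h1] a /h1 /h. Qed.

Lemma untouched_sub mi mr ai ar ai' ar' : untouched mi mr ai ar ->
  all (mem ai) ai' -> all (mem ar) ar' -> untouched mi mr ai' ar'.
Proof.
case/andP=> /hasPn h1 /hasPn h2 /allP h3 /allP h4; apply/andP.
by split; apply/hasPn => a; [move/h3/h1 | move/h4/h2].
Qed.

Lemma base_frame mi mr s s' : frame mi mr s s' ->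
  untouched mi mr [:: 1; 2; 10; 11; 12; 13] [:: 0; 2; 3; 4; 10] ->
  base s -> base s'.
Proof.
move=> hf hu [*]; have hi := frame_i hf hu; have hr := frame_r hf hu.
by split; rewrite ?hi ?hr.
Qed.

Lemma prefixS (T : Type) (f g : nat -> T) j x :
  (forall t, t < j -> f t = g t) -> x = g j ->
  forall t, t < j.+1 -> (if t == j then x else f t) = g t.
Proof.
move=> h e t; rewrite ltnS leq_eqVlt; case: eqP => [-> _ //|_ /=]; exact: h.
Qed.

Lemma prev_ok s : base s ->
  runs (For 15 10 prev_body) s (for_time n (ccost prev_body))
    (fun s' => forall t, t < n -> imem s' 20 t = prev_color G t).
Proof.
move=> hb; apply: runs_weaken (leqnn _) _.
  apply: (runs_for (Inv := fun j s => forall t, t < j -> imem s 20 t = prev_color G t)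
    (base_n hb)) => // j s1 hj hI hx hf.
  have hb1 : base s1 by apply: base_frame hf _ hb.
  apply: runs_wp => //=; rewrite hx (base_c hb1) (base_q hb1) subn1.
  case: j hj hI hx => [|j] hj hI hx /=.
    by move=> t; rewrite ltnS leqn0 => /eqP ->; rewrite /upd.
  rewrite -eqn_leq; case: ifP => hc; rewrite /upd /=;
    by apply: prefixS => //=; rewrite hc ?hI.
by move=> s' [].
Qed.

Lemma next_ok s : base s ->
  runs (For 15 10 next_body) s (for_time n (ccost next_body))
    (fun s' => forall t, t < n -> imem s' 21 t = next_color G t).
Proof.
move=> hb; apply: runs_weaken (leqnn _) _.
  apply: (runs_for (Inv := fun j s => forall t, t < j ->
    imem s 21 (n - 1 - t) = next_color_rev G t) (base_n hb)) => // j s1 hj hI hx hf.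
  have hb1 : base s1 by apply: base_frame hf _ hb.
  apply: runs_wp => //=; rewrite /upd /= hx (base_c hb1) (base_q hb1) (base_n hb1).
  have cell t : t < n -> (n - 1 - t == n - 1 - j) = (t == j) by lia.
  case: j hj hI hx cell => [|j] hj hI hx cell /=.
    by move=> t; rewrite ltnS leqn0 => /eqP ->; rewrite eqxx.
  have e1 : n - 1 - j.+1 + 1 = n - 1 - j by lia.
  have e2 : (n - 1 - j.+1).+1 = n - 1 - j by lia.
  rewrite -eqn_leq e1 hI // => {hf}.
  case: ifP => hc; move=> t ht; rewrite cell ?(leq_trans ht) //;
    move: t ht; apply: prefixS => //=; rewrite e2 hc //.
move=> s' [hI _ _] t ht; rewrite /next_color -hI; last by lia.
by congr (imem s' 21 _); lia.
Qed.

Definition natt s (v : nat) :=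
  (imem s 22 v, imem s 23 v, imem s 24 v, imem s 25 v, imem s 26 v, rmem s 11 v).

Definition nspec (v : nat) :=
  (ncolor G v, nabove v, nbelow v, (v %% 4 == 3) : nat, (v %% 4 == 1) : nat,
   nheight G v).

Lemma nspecE t r : r < 4 -> nspec (4 * t + r) =
  (match r with
   | 0 => q
   | 1 => if (cfg_ym G t <= cfg_hi G)%R then next_color G t else q
   | 2 => cfg_c G t
   | _ => if (cfg_lo G <= cfg_yp G t)%R then prev_color G t else q
   end, t + (r == 3), t + (1 < r), (r == 3) : nat, (r == 1) : nat,
   match r with
   | 0 => 0%R
   | 1 => cfg_ym G t
   | 2 => cfg_y G t
   | _ => cfg_yp G t
   end).
Proof.
move=> hr; rewrite /nspec /ncolor /nheight /nabove /nbelow.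
by have [-> ->] := nodeE t hr.
Qed.

Record nodes_ok s : Prop := NodesOk {
  nodes_base : base s;
  nodes_att : forall v, v < N -> natt s v = nspec v }.

Definition node_frame := @frame R [:: 22; 23; 24; 25; 26] [:: 11].

(** [set_node] evaluates its arguments between its six writes; this asks that the value survive any
    change of the arrays being written. *)
Definition stable (s : state R) (e : iexp) (x : nat) : Prop :=
  forall s', node_frame s s' -> ieval s' e = x.

Lemma set_node_ok s x col ab be nu nd h xv colv abv bev nuv ndv hv :
  stable s x xv -> stable s col colv -> stable s ab abv -> stable s be bev ->
  stable s nu nuv -> stable s nd ndv ->
  (forall s', node_frame s s' -> reval s' h = hv) ->
  runs (set_node x col ab be nu nd h) s (ccost (set_node x col ab be nu nd h))
    (fun s' => node_frame s s' /\ forall v, natt s' v =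
     if v == xv then (colv, abv, bev, nuv, ndv, hv) else natt s v).
Proof.
move=> hx hcol hab hbe hnu hnd hh; apply: runs_wp => //.
set Q := (X in wp _ X); rewrite /set_node; set c := (X in wp X).
have step_i a i e c' xi xe s0 : a \in [:: 22; 23; 24; 25; 26] ->
    node_frame s s0 -> stable s i xi -> stable s e xe ->
    (node_frame s (State (upd (imem s0) a xi xe) (rmem s0)) ->
     wp c' Q (State (upd (imem s0) a xi xe) (rmem s0))) ->
    wp (a [i]<- e ;; c') Q s0.
  move=> ha hf hi he hk /=; rewrite hi // he //; apply: hk.
  split=> b hb /=; last exact: hf.2.
  by rewrite upd_other ?hf.1 //; apply: contra hb => /eqP ->.
rewrite {}/c; do 5 (eapply step_i;
  [by [] | first [eassumption | exact: frame_refl] | eassumption | eassumption | move=> ?]).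
match goal with h : node_frame s ?x |- wp _ _ ?x => have hf5 := h end.
rewrite [wp _ _ _]/= hx // hh //; split.
  split=> b hb /=; first exact: hf5.1.
  by rewrite upd_other ?hf5.2 //; apply: contra hb => /eqP ->.
by move=> v; rewrite /natt /upd /=; case: eqP.
Qed.

Lemma node_prep_ok s j : base s -> j < n -> imem s 15 0 = j ->
  imem s 20 j = prev_color G j -> imem s 21 j = next_color G j ->
  runs node_prep s (ccost node_prep) (fun s' =>
    [/\ imem s' 36 0 = 4 * j,
        imem s' 37 0 = (if (cfg_ym G j <= cfg_hi G)%R then next_color G j else q) &
        imem s' 38 0 = (if (cfg_lo G <= cfg_yp G j)%R then prev_color G j else q)]).
Proof.
move=> hb hj hx hp hn; apply: runs_wp => //=; rewrite /upd /=.
rewrite !hx (base_q hb) (base_hi hb) (base_lo hb) (base_ym hb) (base_yp hb) hp hn.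
by case: ifP => h1; case: ifP => h2; rewrite /upd /= ?h1 ?h2; split=> //; lia.
Qed.

Lemma node_loop_ok s : base s ->
  (forall t, t < n -> imem s 20 t = prev_color G t) ->
  (forall t, t < n -> imem s 21 t = next_color G t) ->
  runs (For 15 10 node_body) s (for_time n (ccost node_body))
    (fun s' => forall v, v < 4 * n -> natt s' v = nspec v).
Proof.
move=> hb hp hn; apply: runs_weaken (leqnn _) _.
  apply: (runs_for (Inv := fun j s => forall v, v < 4 * j -> natt s v = nspec v)
    (base_n hb)) => // j s1 hj hI hx hf.
  have hb1 : base s1 by apply: base_frame hf _ hb.
  have {}hp : imem s1 20 j = prev_color G j by rewrite hf.1 ?hp.
  have {}hn : imem s1 21 j = next_color G j by rewrite hf.1 ?hn.
  apply: runs_seq_cost (runs_frame (node_prep_ok hb1 hj hx hp hn)) _.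
  move=> s2 [[h36 h37 h38] hf2].
  have hb2 : base s2 by apply: base_frame hf2 _ hb1.
  have hx2 : imem s2 15 0 = j by rewrite hf2.1.
  have fact s' : node_frame s2 s' -> [/\ base s', imem s' 15 0 = j,
      imem s' 36 0 = 4 * j, imem s' 37 0 = imem s2 37 0 & imem s' 38 0 = imem s2 38 0].
    by move=> hs; split; rewrite ?hs.1 //; apply: base_frame hs _ hb2.
  apply: runs_seq_cost.
    apply: (@set_node_ok _ _ _ _ _ _ _ _ (4 * j) q j j 0 0 0%R) => // s' hs;
      by have [bs e1 e2 e3 e4] := fact _ hs; rewrite /= ?e1 ?e2 ?(base_q bs).
  move=> s3 [hf3 ha3]; apply: runs_seq_cost.
    apply: (@set_node_ok _ _ _ _ _ _ _ _ (4 * j + 1) (imem s2 37 0) j j 0 1 (cfg_ym G j)) => // s' hs;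
      have [bs e1 e2 e3 e4] := fact _ (frame_trans hf3 hs);
      by rewrite /= ?e1 ?e2 ?e3 ?(base_ym bs).
  move=> s4 [hf4 ha4]; apply: runs_seq_cost.
    apply: (@set_node_ok _ _ _ _ _ _ _ _ (4 * j + 2) (cfg_c G j) j (j + 1) 0 0 (cfg_y G j)) => // s' hs;
      have [bs e1 e2 e3 e4] := fact _ (frame_trans hf3 (frame_trans hf4 hs));
      by rewrite /= ?(base_c bs) ?e1 ?e2 ?e3 ?(base_y bs).
  move=> s5 [hf5 ha5]; apply: runs_imp.
    apply: (@set_node_ok _ _ _ _ _ _ _ _ (4 * j + 3) (imem s2 38 0) (j + 1) (j + 1) 1 0 (cfg_yp G j)) => // s' hs;
      have [bs e1 e2 e3 e4] :=
        fact _ (frame_trans hf3 (frame_trans hf4 (frame_trans hf5 hs)));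
      by rewrite /= ?e1 ?e2 ?e4 ?(base_yp bs).
  move=> s6 [hf6 ha6] v hv; rewrite -[natt _ v]/(natt s6 v) ha6 ha5 ha4 ha3 h37 h38.
  case: eqP => [->|n3]; first by rewrite nspecE.
  case: eqP => [->|n2]; first by rewrite nspecE ?addn0.
  case: eqP => [->|n1]; first by rewrite nspecE ?addn0.
  case: eqP => [->|n0].
    by have := nspecE j (isT : 0 < 4); rewrite !addn0.
  have hv2 : v < 4 * j by lia.
  by rewrite -hI // /natt !hf2.1 ?hf2.2.
by move=> s' [].
Qed.

Lemma nodes_prog_ok s : base s ->
  runs nodes_prog s (for_time n (ccost prev_body) + for_time n (ccost next_body) +
     for_time n (ccost node_body) + 100)
    (fun s' => nodes_ok s' /\ frame (imods nodes_prog) (rmods nodes_prog) s s').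
Proof.
move=> hb; apply: runs_frame.
pose c4 := set_node (ISub (V 12) (IConst 1)) (V 11) (V 10) (V 10) (IConst 0)
    (IConst 0) (RConst 0).
have h : runs nodes_prog s (for_time n (ccost prev_body) +
   (for_time n (ccost next_body) + (for_time n (ccost node_body) + ccost c4).+1).+1).+1
   nodes_ok.
  apply: runs_seq (runs_frame (prev_ok hb)) _ => s1 [h1 f1].
  have hb1 : base s1 by apply: base_frame f1 _ hb.
  apply: runs_seq (runs_frame (next_ok hb1)) _ => s2 [h2 f2].
  have hb2 : base s2 by apply: base_frame f2 _ hb1.
  have h1' t : t < n -> imem s2 20 t = prev_color G t by move=> ht; rewrite f2.1 ?h1.
  apply: runs_seq (runs_frame (node_loop_ok hb2 h1' h2)) _ => s3 [h3 f3].
  have hb3 : base s3 by apply: base_frame f3 _ hb2.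
  apply: runs_imp.
    apply: (@set_node_ok _ _ _ _ _ _ _ _ (4 * n) q n n 0 0 0%R) => // s' hs;
      have bs := base_frame hs isT hb3;
      by rewrite /= ?(base_N bs) ?(base_n bs) ?(base_q bs) ?addn1 ?subn1.
  move=> s4 [hf4 ha4]; split; first by apply: base_frame hf4 _ hb3.
  move=> v hv; rewrite ha4; case: eqP => [->|ne]; last by apply: h3; lia.
  by have := nspecE n (isT : 0 < 4); rewrite !addn0.
apply: runs_weaken h _ _ => //.
have : ccost c4 <= 90 by [].
lia.
Qed.

End Phases.

(** * Prefix tables of counts and lengths *)

Definition row_body : com :=
  If (BIEq (ILoad 1 (V 17)) (ILoad 22 (V 16)))
    (28 [IAdd (V 39) (IConst 1)]<- IAdd (ILoad 28 (V 39)) (IConst 1) ;;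
     If (BRLe (RLoad 2 (V 17)) (RLoad 11 (V 16)))
       (13 [IAdd (V 39) (IConst 1)]<~
          RAdd (RLoad 13 (V 39)) (RSub (RLoad 11 (V 16)) (RLoad 2 (V 17))))
       (13 [IAdd (V 39) (IConst 1)]<~
          RAdd (RLoad 13 (V 39)) (RSub (RLoad 2 (V 17)) (RLoad 11 (V 16)))))
    (28 [IAdd (V 39) (IConst 1)]<- ILoad 28 (V 39) ;;
     13 [IAdd (V 39) (IConst 1)]<~ RLoad 13 (V 39)) ;;
  39 <-- IAdd (V 39) (IConst 1).

Definition row_start : com :=
  27 [V 16]<- V 39 ;; 28 [V 39]<- IConst 0 ;; 13 [V 39]<~ RConst 0.

(** The tables are flat arrays filled in the order of addresses by the pointer in scalar 39; the
    final increment leads from the last column of a row to the next row. *)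
Definition table_body : com :=
  row_start ;; For 17 10 row_body ;; 39 <-- IAdd (V 39) (IConst 1).

Definition table_prog : com :=
  39 <-- IConst 0 ;; For 16 12 table_body.

Section Tables.
Variables (R : realType) (G : config R) (bound : nat -> nat).
Local Notation n := (cfg_n G).
Local Notation N := (4 * n + 1).
Local Notation nodes_ok := (nodes_ok G bound).
Implicit Types s : state R.

Lemma nodes_frame mi mr s s' : frame mi mr s s' ->
  untouched mi mr [:: 1; 2; 10; 11; 12; 13; 22; 23; 24; 25; 26] [:: 0; 2; 3; 4; 10; 11] ->
  nodes_ok s -> nodes_ok s'.
Proof.
move=> hf hu [hb ha]; have hi := frame_i hf hu; have hr := frame_r hf hu.
split; first by case: hb => *; split; rewrite ?hi ?hr.
by move=> v hv; rewrite -ha // /natt !hi ?hr.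
Qed.

Section Att.
Variables (s : state R) (v : nat).
Hypotheses (hs : nodes_ok s) (hv : v < N).
Let h := nodes_att hs hv.
Lemma att_color : imem s 22 v = ncolor G v. Proof. by case: h. Qed.
Lemma att_above : imem s 23 v = nabove v. Proof. by case: h. Qed.
Lemma att_below : imem s 24 v = nbelow v. Proof. by case: h. Qed.
Lemma att_up : imem s 25 v = (v %% 4 == 3). Proof. by case: h. Qed.
Lemma att_down : imem s 26 v = (v %% 4 == 1). Proof. by case: h. Qed.
Lemma att_height : rmem s 11 v = nheight G v. Proof. by case: h. Qed.
End Att.

(** There is one row per node rather than per color, so the size is independent of the number of
    colors. *)
Definition tab (p : nat) : nat * R :=
  (cnt G (ncolor G (p %/ n.+1)) (p %% n.+1), wsum G (p %/ n.+1) (p %% n.+1)).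

Definition tab_upto s (a : nat) : Prop :=
  forall p, p < a -> (imem s 28 p, rmem s 13 p) = tab p.

Lemma tabE v i : i <= n ->
  tab (v * n.+1 + i) = (cnt G (ncolor G v) i, wsum G v i).
Proof.
by move=> hi; rewrite /tab divnMDl // modnMDl divn_small ?modn_small // addn0.
Qed.

Lemma wsum0 v : wsum G v 0 = 0%R. Proof. by rewrite /wsum big_geq. Qed.

Lemma wsumS v i : wsum G v i.+1 = (wsum G v i +
  if cfg_c G i == ncolor G v then `|nheight G v - cfg_y G i| else 0)%R.
Proof.
by rewrite /wsum big_mkcond /= big_nat_recr //= -big_mkcond.
Qed.

Lemma row_ok s v : nodes_ok s -> v < N -> imem s 16 0 = v ->
  imem s 39 0 = v * n.+1 -> tab_upto s (v * n.+1 + 1) ->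
  runs (For 17 10 row_body) s (for_time n (ccost row_body))
    (fun s' => imem s' 39 0 = v * n.+1 + n /\ tab_upto s' (v * n.+1 + n + 1)).
Proof.
move=> hs hv hv0 hp0 ht0; apply: runs_imp.
  apply: (runs_for (Inv := fun j s => imem s 39 0 = v * n.+1 + j /\
     tab_upto s (v * n.+1 + j + 1)) (base_n (nodes_base hs))) => //.
    by rewrite addn0.
  move=> j s1 hj [hp ht] hx hf.
  have hs1 : nodes_ok s1 by apply: nodes_frame hf _ hs.
  have hv1 : imem s1 16 0 = v by rewrite hf.1.
  have [hb1 _] := hs1.
  have := ht (v * n.+1 + j); rewrite addn1 ltnSn => /(_ isT).
  rewrite tabE; last by exact: ltnW.
  case=> hC hW.
  apply: runs_wp => //=; rewrite /upd /= !hx hv1 (base_c hb1) (att_color hs1 hv) -eqn_leq.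
  have fin x w : x = cnt G (ncolor G v) j.+1 -> w = wsum G v j.+1 ->
    forall p, p < v * n.+1 + j.+1 + 1 ->
      (if p == v * n.+1 + j + 1 then x else imem s1 28 p,
       if p == v * n.+1 + j + 1 then w else rmem s1 13 p) = tab p.
    move=> -> -> p hpl; case: eqP => [->|ne].
      by rewrite -addnA addn1 tabE.
    by apply: ht; lia.
  case: ifP => hc /=; last first.
    rewrite !hp; split; first by lia.
    apply: fin; first by rewrite cntS hc addn0.
    by rewrite wsumS hc addr0.
  rewrite /upd /= (att_height hs1 hv) (base_y hb1).
  case: ifP => hy; rewrite !hp; (split; first by lia); apply: fin.
  - by rewrite cntS hc hC.
  - by rewrite wsumS hc hW ger0_norm // subr_ge0.
  - by rewrite cntS hc hC.
  - rewrite wsumS hc hW ler0_norm ?opprB // subr_le0.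
    by rewrite leNgt; apply/negP => h; move: hy; rewrite (ltW h).
by move=> s' [].
Qed.

Record tables_ok s : Prop := TablesOk {
  tables_nodes : nodes_ok s;
  tables_row : forall v, v < N -> imem s 27 v = v * n.+1;
  tables_tab : tab_upto s (N * n.+1) }.

Lemma table_prog_ok s : nodes_ok s ->
  runs table_prog s (for_time N (for_time n (ccost row_body) + 40) + 10)
    (fun s' => tables_ok s' /\ frame (imods table_prog) (rmods table_prog) s s').
Proof.
move=> hs; apply: runs_frame.
pose c0 := 39 <-- IConst 0; pose B := for_time N (for_time n (ccost row_body) + 40).
have h : runs table_prog s (ccost c0 + B).+1 tables_ok; last first.
  by apply: runs_weaken h _ _ => //; rewrite /= -/B; lia.
apply: runs_seq.
  by apply: runs_frame; apply: (@runs_wp _ _ _ (fun s' => imem s' 39 0 = 0)).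
move=> s1 [h1 f1]; have hs1 : nodes_ok s1 by apply: nodes_frame f1 _ hs.
apply: runs_imp.
  apply: (runs_for (Inv := fun v s => [/\ imem s 39 0 = v * n.+1,
     forall u, u < v -> imem s 27 u = u * n.+1 & tab_upto s (v * n.+1)])
     (base_N (nodes_base hs1))) => // v s2 hv [hp hr ht] hx hf.
  have hs2 : nodes_ok s2 by apply: nodes_frame hf _ hs1.
  have tm : for_time n (ccost row_body) + 40 >=
     (ccost row_start + (for_time n (ccost row_body) + ccost (39 <-- IAdd (V 39) (IConst 1))).+1).+1.
    by rewrite /=; lia.
  apply: runs_weaken tm (fun _ h => h).
  apply: runs_seq.
    apply: runs_frame; apply: (@runs_wp _ _ _ (fun s' => [/\
       imem s' 39 0 = v * n.+1, imem s' 16 0 = v,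
       forall u, u < v.+1 -> imem s' 27 u = u * n.+1 &
       tab_upto s' (v * n.+1 + 1)])) => //=.
    rewrite /upd /= !hp !hx; split=> //; first exact: prefixS.
    move=> p hpl; rewrite /= /upd /=; case: (eqVneq p (v * n.+1)) => [->|ne].
      by have := tabE v (leq0n n); rewrite addn0 cnt0 wsum0.
    by apply: ht; lia.
  move=> s3 [[hp3 hx3 hr3 ht3] f3].
  have hs3 : nodes_ok s3 by apply: nodes_frame f3 _ hs2.
  apply: runs_seq.
    by apply: runs_frame; apply: (row_ok hs3 hv hx3 hp3 ht3).
  move=> s4 [[hp4 ht4] f4]; apply: runs_wp => //=; rewrite /upd /= hp4.
  split; first by rewrite mulSn; lia.
    by move=> u hu; rewrite f4.1 ?hr3.
  by move=> p hpl; apply: ht4; move: hpl; rewrite mulSn; lia.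
move=> s' [[h2 h3 h4] _ f2]; split=> //.
by apply: nodes_frame f2 _ hs1.
Qed.

Lemma tables_frame mi mr s s' : frame mi mr s s' ->
  untouched mi mr [:: 1; 2; 10; 11; 12; 13; 22; 23; 24; 25; 26; 27; 28]
    [:: 0; 2; 3; 4; 10; 11; 13] ->
  tables_ok s -> tables_ok s'.
Proof.
move=> hf hu [[hb ha] hr ht]; have hi := frame_i hf hu; have hrr := frame_r hf hu.
split.
- split; first by case: hb => *; split; rewrite ?hi ?hrr.
  by move=> v hv; rewrite -ha // /natt !hi ?hrr.
- by move=> v hv; rewrite hi // hr.
- by move=> p hp; rewrite hi // hrr // ht.
Qed.

Lemma tables_cnt s v i : tables_ok s -> v < N -> i <= n ->
  imem s 28 (imem s 27 v + i) = cnt G (ncolor G v) i /\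
  rmem s 13 (imem s 27 v + i) = wsum G v i.
Proof.
move=> [_ hr ht] hv hi; rewrite hr //.
have hlt : v * n.+1 + i < N * n.+1.
  have h : v.+1 * n.+1 <= N * n.+1 by rewrite leq_mul2r hv orbT.
  by apply: leq_trans h; rewrite mulSn; lia.
by have := ht _ hlt; rewrite tabE // => -[].
Qed.

End Tables.

(* Whether no point above point [V 15] has the same color. *)
Notation new_color :=
  (BILe (ILoad 28 (IAdd (ILoad 27 (IAdd (IAdd (IAdd (V 15) (V 15))
     (IAdd (V 15) (V 15))) (IConst 2))) (V 15))) (IConst 0)).

Definition count_body : com := If new_color (40 <-- IAdd (V 40) (IConst 1)) Skip.

Definition unit_body : com :=
  29 [ILoad 1 (V 15)]<- IConst 1 ;; 30 [ILoad 1 (V 15)]<- V 14.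

(** Scalar 40 counts the occurring colors. The budgets range from 0 to the bound minus this count,
    hence the added 1. *)
Definition total_prog : com :=
  40 <-- IConst 0 ;;
  For 15 10 count_body ;;
  14 <-- IAdd (ISub (ILoad 2 (IConst 0)) (V 40)) (IConst 1) ;;
  For 15 10 unit_body.

(* [P := k * P] by repeated addition, with [k = 1] for colors already seen. *)
Definition add_body : com := 43 <-- IAdd (V 43) (V 14).

Definition radix_start : com :=
  41 <-- ILoad 1 (V 15) ;;
  If new_color (42 <-- ILoad 2 (V 41) ;; 29 [V 41]<- V 14) (42 <-- IConst 1) ;;
  43 <-- IConst 0.

Definition radix_end : com :=
  If new_color (30 [V 41]<- V 43) Skip ;; 14 <-- V 43.

Definition radix_body : com :=
  radix_start ;; For 18 42 add_body ;; radix_end.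

Definition radix_prog : com := 14 <-- IConst 1 ;; For 15 10 radix_body.

(** * Number of budgets, weights and moduli *)

Section Budgets.
Variables (R : realType) (G : config R) (bound : nat -> nat).
Hypothesis wf : wf_config G.
Local Notation n := (cfg_n G).
Local Notation q := (cfg_q G).
Local Notation N := (4 * n + 1).
Local Notation tables_ok := (tables_ok G bound).
Implicit Types s : state R.

Definition seen (t : nat) : pred nat := fun a => 0 < cnt G a t.

Lemma seenS t a : seen t.+1 a = seen t a || (cfg_c G t == a).
Proof. by rewrite /seen cntS; case: (_ == a); case: (cnt G a t). Qed.

Lemma seen_lt t a : t <= n -> seen t a -> a < q.
Proof.
move=> ht /cnt_gt0P [i hi <-]; apply: (wf_c wf); exact: leq_trans hi ht.
Qed.

Definition nseen (t : nat) : nat := \sum_(a < q) seen t a.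

Lemma nseen0 : nseen 0 = 0.
Proof. by rewrite /nseen big1 // => a _; rewrite /seen cnt0. Qed.

Lemma nseenS t : t < n ->
  nseen t.+1 = nseen t + (cnt G (cfg_c G t) t == 0).
Proof.
move=> ht; pose a := Ordinal (wf_c wf ht).
rewrite /nseen (bigD1 a) //= [in RHS](bigD1 a) //= seenS eqxx orbT.
rewrite (eq_bigr (fun b : 'I_q => nat_of_bool (seen t b))).
  by rewrite /seen; case: posnP => _ /=; lia.
move=> b hb; rewrite seenS; case: eqP => [e|_]; last by rewrite orbF.
by case/eqP: hb; apply: val_inj; rewrite /= e.
Qed.

Lemma nseen_le t : nseen t <= q.
Proof.
rewrite /nseen -[leqRHS]card_ord -sum1_card; apply: leq_sum => a _.
by case: (seen t a).
Qed.

(** Keeps the number of budgets for a global bound [K], which is [K] minus the number of occurring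
    colors plus one, at most [K]. *)
Lemma nseen_gt0 : 0 < nseen n.
Proof.
have hn := wf_n wf; have h : 0 < nseen 1.
  by rewrite nseenS // nseen0 cnt0.
apply: leq_trans h _; rewrite /nseen; apply: leq_sum => a _.
case h1: (seen 1 a) => //; rewrite /seen; have -> // : 0 < cnt G a n.
exact: leq_trans h1 (cnt_mono G a hn).
Qed.

Lemma new_colorE s t : tables_ok s -> t < n -> imem s 15 0 = t ->
  beval s new_color = (cnt G (cfg_c G t) t == 0).
Proof.
move=> hs ht hx; rewrite /= hx.
have hv : t + t + (t + t) + 2 < N by lia.
have [-> _] := tables_cnt hs hv (ltnW ht).
have -> : ncolor G (t + t + (t + t) + 2) = cfg_c G t.
  have -> : t + t + (t + t) + 2 = 4 * t + 2 by lia.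
  by rewrite /ncolor; have [-> ->] := nodeE t (isT : 2 < 4).
by rewrite leqn0.
Qed.

Record budget_ok (P : nat) s : Prop := BudgetOk {
  budget_tables : tables_ok s;
  budget_P : imem s 14 0 = P;
  budget_gt0 : 0 < P }.

Lemma total_prog_ok s : tables_ok s ->
  runs total_prog s (for_time n (ccost count_body) + for_time n (ccost unit_body) + 40)
    (fun s' => budget_ok (bound 0 - nseen n + 1) s' /\
       (forall t, t < n -> imem s' 29 (cfg_c G t) = 1 /\
          imem s' 30 (cfg_c G t) = bound 0 - nseen n + 1)).
Proof.
move=> hs; set P := _ + 1.
pose c0 := 40 <-- IConst 0.
pose c2 := 14 <-- IAdd (ISub (ILoad 2 (IConst 0)) (V 40)) (IConst 1).
suff h : runs total_prog s (ccost c0 + (for_time n (ccost count_body) +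
    (ccost c2 + for_time n (ccost unit_body)).+1).+1).+1
    (fun s' => budget_ok P s' /\ (forall t, t < n -> imem s' 29 (cfg_c G t) = 1 /\
          imem s' 30 (cfg_c G t) = P)).
  by apply: runs_weaken h _ _ => //; rewrite /=; lia.
apply: runs_seq.
  by apply: runs_frame; apply: (@runs_wp _ _ _ (fun s' => imem s' 40 0 = 0)).
move=> s1 [h1 f1]; have hs1 : tables_ok s1 by apply: tables_frame f1 _ hs.
have hb1 := nodes_base (tables_nodes hs1).
apply: runs_seq.
  apply: (runs_for (Inv := fun t s => imem s 40 0 = nseen t) (base_n hb1)) => //.
    by rewrite nseen0.
  move=> t s2 ht hI hx hf.
  have hs2 : tables_ok s2 by apply: tables_frame hf _ hs1.
  apply: runs_wp => //; rewrite /count_body [wp _ _ _]/= -/(beval s2 new_color).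
  rewrite (new_colorE hs2 ht hx) nseenS //.
  by case: (cnt G (cfg_c G t) t == 0); rewrite /= /upd /= hI ?addn0.
move=> s2 [h2 _ f2]; have hs2 : tables_ok s2 by apply: tables_frame f2 _ hs1.
have hb2 := nodes_base (tables_nodes hs2).
apply: runs_seq.
  apply: runs_frame; apply: (@runs_wp _ _ _ (fun s' => imem s' 14 0 = P)) => //=.
  by rewrite /upd /= h2 (base_bound hb2).
move=> s3 [h3 f3]; have hs3 : tables_ok s3 by apply: tables_frame f3 _ hs2.
have hb3 := nodes_base (tables_nodes hs3).
apply: runs_imp.
  apply: (runs_for (Inv := fun j s => forall t, t < j -> imem s 29 (cfg_c G t) = 1 /\
    imem s 30 (cfg_c G t) = P) (base_n hb3)) => // j s4 hj hI hx hf.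
  have hs4 : tables_ok s4 by apply: tables_frame hf _ hs3.
  have hP : imem s4 14 0 = P by rewrite hf.1.
  apply: runs_wp => //=; rewrite /upd /= !hx hP (base_c (nodes_base (tables_nodes hs4))).
  move=> t; rewrite ltnS leq_eqVlt => /orP [/eqP ->|ht]; first by rewrite eqxx.
  by case: eqP => // _; apply: hI.
move=> s4 [h4 _ f4]; split=> //; split.
- by apply: tables_frame f4 _ hs3.
- by rewrite f4.1.
- by rewrite /P addn1.
Qed.

Definition radix_size (t : nat) : nat := \prod_(a < q | seen t a) bound a.

Hypothesis bound_gt0 : forall a, a < q -> 0 < bound a.

Lemma radix_size_le t : radix_size t <= \prod_(a < q) bound a.
Proof.
rewrite /radix_size big_mkcond; apply: leq_prod => a _.
by case: ifP => // _; apply: bound_gt0.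
Qed.

Lemma radix_size0 : radix_size 0 = 1.
Proof. by rewrite /radix_size big1 // => a; rewrite /seen cnt0. Qed.

Lemma radix_size_gt0 t : 0 < radix_size t.
Proof.
by rewrite /radix_size; elim/big_ind: _ => // [x z hx hz|a _];
  [rewrite muln_gt0 hx | apply: bound_gt0].
Qed.

Lemma radix_sizeS t : t < n -> radix_size t.+1 =
  (if cnt G (cfg_c G t) t == 0 then bound (cfg_c G t) else 1) * radix_size t.
Proof.
move=> ht; pose a := Ordinal (wf_c wf ht).
case: posnP => h; last first.
  rewrite mul1n; apply: eq_bigl => b; rewrite seenS.
  by case: eqP => [<-|]; rewrite ?orbF // orbT /seen h.
rewrite /radix_size (bigD1 a) /=; last by rewrite seenS eqxx orbT.
congr (_ * _); apply: eq_bigl => b; rewrite seenS.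
case: (eqVneq b a) => [->|hb]; first by rewrite andbF /seen /= h.
rewrite andbT; case: eqP => [e|_]; last by rewrite orbF.
by case/eqP: hb; apply: val_inj; rewrite /= e.
Qed.

Lemma bound_le a : a < q -> bound a <= \prod_(b < q) bound b.
Proof.
move=> ha; rewrite (bigD1 (Ordinal ha)) //= leq_pmulr //.
by elim/big_ind: _ => // [x z hx hz|b _]; [rewrite muln_gt0 hx | apply: bound_gt0].
Qed.

(** A new color gets the next place: its weight is the number of budgets so far, which all earlier
    moduli divide. *)
Lemma radix_extend wt md t P wt' md' : t < n ->
  radix wt md (seen t) bound P -> cnt G (cfg_c G t) t == 0 -> 0 < P ->
  (forall a, wt' a = if a == cfg_c G t then P else wt a) ->
  (forall a, md' a = if a == cfg_c G t then bound (cfg_c G t) * P else md a) ->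
  radix wt' md' (seen t.+1) bound (bound (cfg_c G t) * P).
Proof.
move=> ht [h1 h2] h0 hP hwt hmd; set b := cfg_c G t in h0 hwt hmd *.
have hb : ~~ seen t b by rewrite /seen (eqP h0).
have hS a : seen t.+1 a -> a = b \/ (a != b /\ seen t a).
  rewrite seenS -/b eq_sym; case: (eqVneq a b) => [|ne]; first by left.
  by rewrite orbF; right.
split=> [a /hS [->|[hab ha]]|a a' /hS [->|[hab ha]] /hS [->|[hab' ha']] hne].
- by rewrite hwt hmd eqxx; split=> //; apply: bound_gt0; apply: (wf_c wf).
- by have [x1 x2 x3 x4] := h1 a ha; rewrite hwt hmd (negbTE hab); split=> //;
    rewrite dvdn_mull.
- by rewrite eqxx in hne.
- by right; rewrite hwt hmd eqxx (negbTE hab'); have [] := h1 a' ha'.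
- by left; rewrite hwt hmd eqxx (negbTE hab); have [] := h1 a ha.
- by rewrite !hwt !hmd (negbTE hab) (negbTE hab'); apply: h2.
Qed.

Lemma radix_prog_ok s : tables_ok s ->
  runs radix_prog s (for_time n (for_time (\prod_(a < q) bound a) 20 + 100) + 10)
    (fun s' => budget_ok (radix_size n) s' /\
       radix (imem s' 29) (imem s' 30) (seen n) bound (radix_size n)).
Proof.
move=> hs; set M := \prod_(a < q) bound a.
suff h : runs radix_prog s (ccost (14 <-- IConst 1) +
    for_time n (for_time M 20 + 100)).+1 (fun s' => budget_ok (radix_size n) s' /\
       radix (imem s' 29) (imem s' 30) (seen n) bound (radix_size n)).
  by apply: runs_weaken h _ _ => //; rewrite /=; lia.
apply: runs_seq.
  by apply: runs_frame; apply: (@runs_wp _ _ _ (fun s' => imem s' 14 0 = 1)).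
move=> s1 [h1 f1]; have hs1 : tables_ok s1 by apply: tables_frame f1 _ hs.
have hb1 := nodes_base (tables_nodes hs1).
apply: runs_imp.
  apply: (runs_for (Inv := fun t s => imem s 14 0 = radix_size t /\
     radix (imem s 29) (imem s 30) (seen t) bound (radix_size t)) (base_n hb1)) => //.
    rewrite radix_size0; split; first by rewrite /set_scalar /upd /= h1.
    by split=> a; rewrite /seen cnt0.
  move=> t s2 ht [hP hrad] hx hf.
  have hs2 : tables_ok s2 by apply: tables_frame hf _ hs1.
  have hb2 := nodes_base (tables_nodes hs2).
  set k := if cnt G (cfg_c G t) t == 0 then bound (cfg_c G t) else 1.
  (* Multiplication by [k] is a loop of [k] additions, whose number of rounds has to stay within the
     product of all bounds. *)
  have hkM : k <= M.
    rewrite /k; case: ifP => _; first by apply: bound_le; apply: (wf_c wf).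
    exact: leq_trans (radix_size_gt0 t) (radix_size_le t).
  suff h : runs radix_body s2
     (ccost radix_start + (for_time k (ccost add_body) + ccost radix_end).+1).+1
     (fun s' => imem (set_scalar 15 t.+1 s') 14 0 = radix_size t.+1 /\
       radix (imem (set_scalar 15 t.+1 s') 29) (imem (set_scalar 15 t.+1 s') 30)
         (seen t.+1) bound (radix_size t.+1)).
    apply: runs_weaken h _ _ => //; rewrite /for_time.
    have : k * (ccost add_body + 14) <= M * (20 + 14) by apply: leq_mul.
    by rewrite /=; lia.
  apply: runs_seq.
    apply: (@runs_frame _ _ _ _ (fun s' => [/\ imem s' 41 0 = cfg_c G t,
      imem s' 42 0 = k, imem s' 43 0 = 0 & forall a, imem s' 29 a =
        if (cnt G (cfg_c G t) t == 0) && (a == cfg_c G t) then radix_size t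
        else imem s2 29 a])).
    apply: runs_seq_cost.
      apply: runs_frame; apply: (@runs_wp _ _ _ (fun s' => imem s' 41 0 = cfg_c G t)) => //=.
      by rewrite /upd /= hx (base_c hb2).
    move=> s2' [e41 f']; have hs2' : tables_ok s2' by apply: tables_frame f' _ hs2.
    apply: runs_wp => //; rewrite [wp _ _ _]/= -/(beval s2' new_color).
    have hx' : imem s2' 15 0 = t by rewrite f'.1.
    have [e2 e14 e29] : [/\ imem s2' 2 = bound, imem s2' 14 0 = radix_size t &
        imem s2' 29 = imem s2 29] by rewrite !f'.1 // (base_bound hb2).
    rewrite (new_colorE hs2' ht hx') /k.
    by case: ifP => h0; rewrite /= /upd /= ?e41 ?e2 ?e14 ?e29 ?h0.
  move=> s3 [[h41 h42 h43 h29] f3].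
  have hs3 : tables_ok s3 by apply: tables_frame f3 _ hs2.
  have hP3 : imem s3 14 0 = radix_size t by rewrite f3.1.
  apply: runs_seq.
    apply: (runs_for (Inv := fun j s => imem s 43 0 = j * radix_size t) h42) => //.
    move=> j s4 hj hI hxj hf4; apply: runs_wp => //=; rewrite /upd /= hI hf4.1 // hP3.
    by rewrite mulSn addnC.
  move=> s4 [h43' _ f4]; have hs4 : tables_ok s4 by apply: tables_frame f4 _ hs3.
  have hx4 : imem s4 15 0 = t by rewrite f4.1 // f3.1.
  apply: runs_wp => //; rewrite /radix_end [wp _ _ _]/=.
  rewrite -/(beval s4 new_color) (new_colorE hs4 ht hx4).
  have h30 : imem s4 30 = imem s2 30 by rewrite f4.1 // f3.1.
  have h29' a : imem s4 29 a = _ := etrans (congr1 (fun f => f a) (f4.1 29 isT)) (h29 a).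
  have h41' : imem s4 41 0 = cfg_c G t by rewrite f4.1.
  rewrite radix_sizeS // -/k; case: ifP => h0 /=; rewrite /upd /= h43' ?h41'.
    split=> //; rewrite /k h0; apply: (radix_extend ht hrad h0) => [|a|a].
    - exact: radix_size_gt0.
    - by rewrite h29' h0.
    - by rewrite h30.
  split=> //; rewrite /k h0 mul1n.
  have hs' : seen t.+1 =1 seen t.
    move=> a; rewrite seenS; case: eqP => [<-|]; rewrite ?orbF // orbT /seen lt0n h0 //.
  case: hrad => r1 r2; split=> [a|a b].
    by rewrite hs' h29' h0 h30; apply: r1.
  by rewrite !hs' !h29' h0 h30; apply: r2.
move=> s' [[h2 h3] _ f2]; split=> //; split=> //; last exact: radix_size_gt0.
by apply: tables_frame f2 _ hs1.
Qed.

End Budgets.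

(** * The dynamic program *)

Notation above_v := (ILoad 23 (V 16)).
Notation below_u := (ILoad 24 (V 18)).
Notation entry v i := (IAdd (ILoad 27 (V v)) i).

Definition pair_counts : com :=
  47 <-- ILoad 28 (entry 16 below_u) ;;
  45 <-- ISub (ILoad 28 (entry 16 above_v)) (V 47) ;;
  46 <-- ISub (ILoad 28 (entry 18 above_v)) (ILoad 28 (entry 18 below_u)) ;;
  50 <-- ILoad 29 (ILoad 22 (V 16)) ;;
  51 <-- ILoad 30 (ILoad 22 (V 16)).

Definition pair_edge : com :=
  If (BAnd (BNot (BIEq (ILoad 22 (V 18)) (ILoad 22 (V 16))))
     (BAnd (BIEq (IAdd (V 45) (V 46)) (ISub above_v below_u))
     (BAnd (BILe (ILoad 25 (V 16)) (V 45)) (BILe (ILoad 26 (V 18)) (V 46)))))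
    (48 <-- IConst 1) (48 <-- IConst 0).

Definition pair_weight : com :=
  If (BIEq (ILoad 22 (V 16)) (V 11)) (17 <~~ RConst 0) (17 <~~ RV 10) ;;
  15 <~~ RAdd (RAdd (RV 17)
    (RSub (RLoad 13 (entry 16 above_v)) (RLoad 13 (entry 16 below_u))))
    (RSub (RLoad 13 (entry 18 above_v)) (RLoad 13 (entry 18 below_u))).

(** An unaffordable step is treated as a missing edge, by clearing the flag in scalar 36. *)
Definition cell_step : com :=
  If (BILe (V 47) (IConst 0)) (36 <-- V 48 ;; 37 <-- V 19)
    (If (BILe (V 50) (V 49)) (36 <-- V 48 ;; 37 <-- ISub (V 19) (V 50))
       (36 <-- IConst 0 ;; 37 <-- IConst 0)) ;;
  35 <-- IAdd (ILoad 31 (V 16)) (V 19) ;;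
  38 <-- IAdd (ILoad 31 (V 18)) (V 37).

Definition cell_write : com :=
  16 <~~ RAdd (RLoad 14 (V 38)) (RV 15) ;;
  If (BAnd (BILe (IConst 1) (V 36)) (BAnd (BILe (IConst 1) (ILoad 32 (V 38)))
     (BNot (BAnd (BILe (IConst 1) (ILoad 32 (V 35)))
                 (BRLe (RLoad 14 (V 35)) (RV 16))))))
    (32 [V 35]<- IConst 1 ;; 14 [V 35]<~ RV 16 ;; 33 [V 35]<- V 18 ;;
     34 [V 35]<- V 37) Skip.

(** Scalar 49 holds the budget modulo the modulus of the color of the current node. Without
    division, it is a counter that wraps around; for modulus 0 it never does, in accordance with
    [k %% 0 = k]. *)
Definition cell_next : com :=
  49 <-- IAdd (V 49) (IConst 1) ;;
  If (BAnd (BILe (IConst 1) (V 51)) (BILe (V 51) (V 49))) (49 <-- IConst 0) Skip.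

Definition cell_body : com := cell_step ;; cell_write ;; cell_next.

Definition pair_prep : com := pair_counts ;; pair_edge ;; pair_weight.

Definition pair_body : com :=
  pair_prep ;; 49 <-- IConst 0 ;; For 19 14 cell_body.

Definition offset_body : com := 31 [V 16]<- V 44 ;; 44 <-- IAdd (V 44) (V 14).

(** Row 0 has offset 0, so the second loop marks exactly the cells of node 0 as reached; their cost
    0 is the initial content of the array. *)
Definition dp_prog : com :=
  44 <-- IConst 0 ;; For 16 12 offset_body ;;
  For 19 14 (32 [V 19]<- IConst 1) ;;
  For 16 12 (For 18 16 pair_body).

Section DynamicProgram.
Variables (R : realType) (G : config R) (bound : nat -> nat).
Variables (wt md : nat -> nat) (P : nat).
Hypothesis wf : wf_config G.
Hypothesis P_gt0 : 0 < P.
Local Notation n := (cfg_n G).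
Local Notation N := (4 * n + 1).
Local Notation tables_ok := (tables_ok G bound).
Local Notation nstep := (step G wt md).
Implicit Types s : state R.

Definition cell : Type := (nat * R * nat * nat)%type.
Definition cF (x : cell) : bool := 0 < x.1.1.1.
Definition cD (x : cell) : R := x.1.1.2.
Definition cPR (x : cell) : nat := x.1.2.
Definition cPK (x : cell) : nat := x.2.

Definition cells s (v kap : nat) : cell :=
  (imem s 32 (v * P + kap), rmem s 14 (v * P + kap),
   imem s 33 (v * P + kap), imem s 34 (v * P + kap)).

Implicit Types T : nat -> nat -> cell.

(* The recurrence for cell [(v, kap)], restricted to predecessors below [U]. *)
Definition cell_ok T (U v kap : nat) : Prop :=
  (cF (T v kap) -> let u := cPR (T v kap) in let kap' := cPK (T v kap) in
     [/\ u < U, edge G u v, nstep u v kap = Some kap', cF (T u kap') &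
         cD (T v kap) = (cD (T u kap') + weight G u v)%R]) /\
  (forall u kap', u < U -> edge G u v -> nstep u v kap = Some kap' ->
     cF (T u kap') -> cF (T v kap) /\
       (cD (T v kap) <= cD (T u kap') + weight G u v)%R).

(** The recurrence for a cell reads, apart from the cell itself, only rows before [v] and budgets up
    to [kap], so cells written later do not disturb it. *)
Lemma cell_ok_ext T T' U v kap : U <= v -> kap < P ->
  (forall u kap', u < v -> kap' < P -> T' u kap' = T u kap') ->
  T' v kap = T v kap -> cell_ok T U v kap -> cell_ok T' U v kap.
Proof.
move=> hU hk hT hv [h1 h2]; split; rewrite hv.
  move=> /h1 /= [a1 a2 a3 a4 a5]; rewrite hT //; first exact: leq_trans hU.
  by apply: leq_ltn_trans hk; apply: step_le a3.
move=> u kap' hu he hs; rewrite hT; first exact: h2.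
  exact: leq_trans hU.
by apply: leq_ltn_trans hk; apply: step_le hs.
Qed.

Definition update T (u v kap : nat) : cell :=
  if edge G u v then
    if nstep u v kap is Some kap' then
      let d := (cD (T u kap') + weight G u v)%R in
      if cF (T u kap') && ~~ (cF (T v kap) && (cD (T v kap) <= d)%R)
      then (1, d, u, kap') else T v kap
    else T v kap
  else T v kap.

Lemma cell_ok_update T T' u v kap : u < v -> kap < P ->
  (forall u kap', u < v -> kap' < P -> T' u kap' = T u kap') ->
  T' v kap = update T u v kap -> cell_ok T u v kap -> cell_ok T' u.+1 v kap.
Proof.
move=> huv hk hT hv hc.
have keep : update T u v kap = T v kap ->
    (forall kap', edge G u v -> nstep u v kap = Some kap' -> cF (T u kap') ->
       cF (T v kap) /\ (cD (T v kap) <= cD (T u kap') + weight G u v)%R) ->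
    cell_ok T' u.+1 v kap.
  move=> hsame hnew; have : cell_ok T u.+1 v kap.
    case: hc => h1 h2; split.
      by move=> /h1 [a1 a2 a3 a4 a5]; split=> //; apply: ltnW.
    move=> w kap'; rewrite ltnS leq_eqVlt => /orP [/eqP ->|]; first exact: hnew.
    exact: h2.
  by apply: cell_ok_ext; rewrite ?hv.
move: hv keep; rewrite /update; case: ifP => he; last first.
  by move=> hv; apply.
case hs: (nstep u v kap) => [kap'|]; last by move=> hv; apply.
case: ifP => hF hv keep; last first.
  apply: keep => // _ _ [<-] hFu; move: hF; rewrite hFu /=.
  by move/negbT; rewrite negbK => /andP [].
case/andP: hF => hFu hno.
have hk' : kap' < P by apply: leq_ltn_trans hk; apply: step_le hs.
case: hc => h1 h2; split; rewrite hv /cF /cD /cPR /cPK /= -/(cF _) -/(cD _).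
  by move=> _; rewrite hT //.
move=> w kap2; rewrite ltnS leq_eqVlt => /orP [/eqP ->|hw] he2 hs2 hF2.
  by split=> //; move: hs2; rewrite hs => -[<-]; rewrite hT.
have hk2 : kap2 < P by apply: leq_ltn_trans hk; apply: step_le hs2.
have hwv := ltn_trans hw huv.
rewrite hT // in hF2 *; have [b1 b2] := h2 w kap2 hw he2 hs2 hF2; split=> //.
(* A reached cell was overwritten, so the new value is below the old one and still beats all earlier
   predecessors. *)
move: hno; rewrite b1 /= -ltNge => hlt.
by apply: le_trans (ltW hlt) b2.
Qed.

Record dp_ok s : Prop := DpOk {
  dp_tables : tables_ok s;
  dp_P : imem s 14 0 = P;
  dp_wt : imem s 29 = wt;
  dp_md : imem s 30 = md;
  dp_off : forall v, v < N -> imem s 31 v = v * P }.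

Lemma dp_frame mi mr s s' : frame mi mr s s' ->
  untouched mi mr [:: 1; 2; 10; 11; 12; 13; 14; 22; 23; 24; 25; 26; 27; 28; 29; 30; 31]
    [:: 0; 2; 3; 4; 10; 11; 13] ->
  dp_ok s -> dp_ok s'.
Proof.
move=> hf hu [ht hP hw hm ho]; have hi := frame_i hf hu; have hr := frame_r hf hu.
split; rewrite ?hi //; case: ht => -[hb ha] hr' ht.
split.
- split; first by case: hb => *; split; rewrite ?hi ?hr.
  by move=> v hv; rewrite -ha // /natt !hi ?hr.
- by move=> v hv; rewrite hi // hr'.
- by move=> p hp; rewrite hi // hr // ht.
Qed.

Record pair_ok (u v : nat) s : Prop := PairOk {
  pair_dp : dp_ok s;
  pair_v : imem s 16 0 = v;
  pair_u : imem s 18 0 = u;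
  pair_first : imem s 47 0 = cnt G (ncolor G v) (nbelow u);
  pair_flag : imem s 48 0 = edge G u v;
  pair_len : rmem s 15 0 = weight G u v;
  pair_wt : imem s 50 0 = wt (ncolor G v);
  pair_md : imem s 51 0 = md (ncolor G v) }.

Lemma pair_frame u v mi mr s s' : frame mi mr s s' ->
  untouched mi mr [:: 1; 2; 10; 11; 12; 13; 14; 16; 18; 22; 23; 24; 25; 26; 27; 28;
     29; 30; 31; 47; 48; 50; 51] [:: 0; 2; 3; 4; 10; 11; 13; 15] ->
  pair_ok u v s -> pair_ok u v s'.
Proof.
move=> hf hu [hd *]; have hi := frame_i hf hu; have hr := frame_r hf hu.
split; rewrite ?hi ?hr //.
by apply: (@dp_frame mi mr s) => //; apply: untouched_sub hu _ _.
Qed.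

Lemma addr_inj v kap v' kap' : kap < P -> kap' < P ->
  (v' * P + kap' == v * P + kap) = (v' == v) && (kap' == kap).
Proof.
move=> h h'; apply/eqP/andP => [e|[/eqP -> /eqP ->] //].
have : (v' * P + kap') %/ P = (v * P + kap) %/ P by rewrite e.
rewrite !divnMDl // !divn_small // !addn0 => ev; split; first exact/eqP.
by move: e; rewrite ev => /addnI ->.
Qed.

Lemma pair_prep_ok s u v : dp_ok s -> u < v -> v < N ->
  imem s 16 0 = v -> imem s 18 0 = u ->
  runs pair_prep s (ccost pair_prep) (pair_ok u v).
Proof.
move=> hs huv hvN hxv hxu; have huN := ltn_trans huv hvN.
have ht := dp_tables hs; have hn := tables_nodes ht.
have hav : nabove v <= n by apply: nabove_le; lia.
have hbu : nbelow u <= n by apply: nbelow_le; lia.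
have [c1 w1] := tables_cnt ht hvN hbu; have [c2 w2] := tables_cnt ht hvN hav.
have [c3 w3] := tables_cnt ht huN hbu; have [c4 w4] := tables_cnt ht huN hav.
have av := att_above hn hvN; have bu := att_below hn huN.
have cv := att_color hn hvN; have cu := att_color hn huN.
apply: runs_seq_cost.
  apply: (@runs_frame _ _ _ _ (fun s' =>
    [/\ imem s' 47 0 = cnt G (ncolor G v) (nbelow u),
        imem s' 45 0 = dcnt G (ncolor G v) (nbelow u) (nabove v) &
        imem s' 46 0 = dcnt G (ncolor G u) (nbelow u) (nabove v)] /\
    (imem s' 50 0 = wt (ncolor G v) /\ imem s' 51 0 = md (ncolor G v)))).
  apply: runs_seq_cost (runs_frame (runs_assign _ (x := cnt G (ncolor G v) (nbelow u)) _)) _.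
    by rewrite /= hxv hxu bu c1.
  move=> s1 [h47 f1].
  apply: runs_seq_cost (runs_frame (runs_assign _
    (x := dcnt G (ncolor G v) (nbelow u) (nabove v)) _)) _.
    by rewrite /= h47 !(f1.1 16, f1.1 23, f1.1 27, f1.1 28) // hxv av c2.
  move=> s2 [h45 f2]; have g2 := frame_cat f1 f2.
  apply: runs_seq_cost (runs_frame (runs_assign _
    (x := dcnt G (ncolor G u) (nbelow u) (nabove v)) _)) _.
    rewrite /= !(g2.1 16, g2.1 18, g2.1 23, g2.1 24, g2.1 27, g2.1 28) //.
    by rewrite hxv hxu av bu c3 c4.
  move=> s3 [h46 f3]; have g3 := frame_cat g2 f3.
  apply: runs_seq_cost (runs_frame (runs_assign _ (x := wt (ncolor G v)) _)) _.
    by rewrite /= !(g3.1 16, g3.1 22, g3.1 29) // hxv cv (dp_wt hs).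
  move=> s4 [h50 f4]; have g4 := frame_cat g3 f4.
  apply: runs_imp (runs_frame (runs_assign _ (x := md (ncolor G v)) _)) _.
    by rewrite /= !(g4.1 16, g4.1 22, g4.1 30) // hxv cv (dp_md hs).
  move=> s5 [h51 f5]; have g35 := frame_cat f4 f5.
  split; first split.
  - by rewrite g35.1 // f3.1 // f2.1.
  - by rewrite g35.1 // f3.1.
  - by rewrite g35.1.
  - by rewrite f5.1.
move=> s1 [[[h47 h45 h46] [h50 h51]] f1].
apply: runs_seq_cost.
  apply: runs_frame; apply: (@runs_wp _ _ _ (fun s' => imem s' 48 0 = edge G u v)) => //=.
  rewrite !(f1.1 16, f1.1 18, f1.1 22, f1.1 23, f1.1 24, f1.1 25, f1.1 26) //.
  rewrite hxv hxu av bu cv cu h45 h46 (att_up hn hvN) (att_down hn huN) -!eqn_leq.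
  by case: ifP => h; rewrite /edge huv andTb h.
move=> s2 [h48 f2].
have f12 := frame_cat f1 f2.
have hs2 : dp_ok s2 by apply: dp_frame f12 _ hs.
have ht2 := dp_tables hs2; have hn2 := tables_nodes ht2.
have {c1 w1}[_ w1] := tables_cnt ht2 hvN hbu; have {c2 w2}[_ w2] := tables_cnt ht2 hvN hav.
have {c3 w3}[_ w3] := tables_cnt ht2 huN hbu; have {c4 w4}[_ w4] := tables_cnt ht2 huN hav.
have {}av := att_above hn2 hvN; have {}bu := att_below hn2 huN.
have {}cv := att_color hn2 hvN.
have hxv2 : imem s2 16 0 = v by rewrite f12.1.
have hxu2 : imem s2 18 0 = u by rewrite f12.1.
apply: runs_imp.
  apply: runs_frame; apply: (@runs_wp _ _ _ (fun s' => rmem s' 15 0 = weight G u v)) => //=.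
  rewrite hxv2 hxu2 cv (base_q (nodes_base hn2)) -eqn_leq.
  by case: ifP => hc; rewrite /upd /= av bu w1 w2 w3 w4
    ?(base_lam (nodes_base hn2)) /weight hc.
move=> s3 [h15 f3]; have f23 := frame_cat f2 f3; split=> //.
- by apply: dp_frame f3 _ hs2.
- by rewrite f3.1.
- by rewrite f3.1.
- by rewrite f23.1.
- by rewrite f3.1.
- by rewrite f23.1.
- by rewrite f23.1.
Qed.

Lemma cell_step_ok s u v kap : pair_ok u v s -> kap < P -> u < v -> v < N ->
  imem s 19 0 = kap -> imem s 49 0 = kap %% md (ncolor G v) ->
  runs cell_step s (ccost cell_step) (fun s' =>
    exists kap', [/\ imem s' 35 0 = v * P + kap, imem s' 38 0 = u * P + kap',
      imem s' 37 0 = kap' &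
      if nstep u v kap is Some k then imem s' 36 0 = edge G u v /\ kap' = k
      else imem s' 36 0 = 0]).
Proof.
move=> hs hk huv hvN hx hr; have huN := ltn_trans huv hvN.
have hd := pair_dp hs; apply: runs_wp => //=; rewrite /upd /=.
rewrite !(pair_first hs) !(pair_wt hs) !(pair_flag hs) !(pair_v hs) !(pair_u hs) hx hr.
rewrite /step /first_use leqn0; case: ifP => h0 /=.
  by exists kap; rewrite /upd /= !(dp_off hd) ?hx ?h0.
rewrite /spend; case: ifP => h1 /=.
  exists (kap - wt (ncolor G v)).
  by rewrite /upd /= !(dp_off hd) ?hx ?h0 ?h1.
by exists 0; rewrite /upd /= !(dp_off hd) ?hx ?h0 ?h1.
Qed.

Lemma cell_write_ok s u v kap kap' : pair_ok u v s -> kap < P -> u < v -> v < N ->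
  imem s 35 0 = v * P + kap -> imem s 38 0 = u * P + kap' -> imem s 37 0 = kap' ->
  (if nstep u v kap is Some k then imem s 36 0 = edge G u v /\ kap' = k
   else imem s 36 0 = 0) ->
  runs cell_write s (ccost cell_write) (fun s' =>
    forall v' k', k' < P -> cells s' v' k' =
      if (v' == v) && (k' == kap) then update (cells s) u v kap else cells s v' k').
Proof.
move=> hs hk huv hvN h35 h38 h37 h36; apply: runs_wp => //=; rewrite /upd /=.
rewrite h35 h38 h37 (pair_len hs) (pair_u hs).
set d := (rmem s 14 (u * P + kap') + _)%R.
set b := [&& _, _ & _].
have -> : update (cells s) u v kap = if b then (1, d, u, kap') else cells s v kap.
  rewrite /update /b; case hst: (nstep u v kap) h36 => [k|]; last first.
    by move=> ->; rewrite if_same.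
  case=> -> ek; rewrite -{}ek; case: (edge G u v) => //=.
case: ifP => hb v' k' hk'.
  rewrite -addr_inj // hb /cells /=.
  by case: eqP.
rewrite hb /cells /=; case: ifP => // /andP [/eqP -> /eqP ->] //.
Qed.

Lemma modS_next d k : (if (0 < d) && (d <= k %% d + 1) then 0 else k %% d + 1) = k.+1 %% d.
Proof.
case: (posnP d) => [->|hd] /=; first by rewrite !modn0 addn1.
rewrite modnS addn1; case: (boolP (d %| k.+1)) => h.
  suff -> : d <= (k %% d).+1 by [].
  rewrite leqNgt; apply/negP => hlt; have := divn_eq k d => e.
  move: h; rewrite e -addnS dvdn_addr ?dvdn_mull // => h; have := dvdn_leq (ltn0Sn _) h.
  by rewrite leqNgt hlt.
case: ifP => // hle; case/negP: h.
have -> : k.+1 = (k %/ d) * d + (k %% d).+1 by rewrite addnS -divn_eq.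
have -> : (k %% d).+1 = d by apply/eqP; rewrite eqn_leq hle ltn_pmod.
by rewrite dvdn_addr ?dvdnn ?dvdn_mull.
Qed.

Lemma cell_body_ok s u v kap : pair_ok u v s -> kap < P -> u < v -> v < N ->
  imem s 19 0 = kap -> imem s 49 0 = kap %% md (ncolor G v) ->
  runs cell_body s (ccost cell_body) (fun s' =>
    imem s' 49 0 = kap.+1 %% md (ncolor G v) /\
    forall v' k', k' < P -> cells s' v' k' =
      if (v' == v) && (k' == kap) then update (cells s) u v kap else cells s v' k').
Proof.
move=> hs hk huv hvN hx hr.
apply: runs_seq_cost (runs_frame (cell_step_ok hs hk huv hvN hx hr)) _.
move=> s1 [[kap' [h35 h38 h37 h36]] f1].
have hs1 : pair_ok u v s1 by apply: pair_frame f1 _ hs.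
have hr1 : imem s1 49 0 = kap %% md (ncolor G v) by rewrite f1.1.
have hc1 v' k' : cells s1 v' k' = cells s v' k' by rewrite /cells !f1.1 ?f1.2.
apply: runs_seq_cost (runs_frame (cell_write_ok hs1 hk huv hvN h35 h38 h37 h36)) _.
move=> s2 [hc2 f2].
have hs2 : pair_ok u v s2 by apply: pair_frame f2 _ hs1.
have hr2 : imem s2 49 0 = kap %% md (ncolor G v) by rewrite f2.1.
have hup : update (cells s1) u v kap = update (cells s) u v kap.
  by rewrite /update; case: ifP => // _; case: (nstep u v kap) => [k|] //; rewrite !hc1.
apply: runs_imp.
  apply: runs_frame; apply: (@runs_wp _ _ _
    (fun s' => imem s' 49 0 = kap.+1 %% md (ncolor G v))) => //=.
  rewrite /upd /= hr2 (pair_md hs2) -modS_next; by case: ifP => h; rewrite /upd /= ?h.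
move=> s3 [h49 f3]; split=> // v' k' hk'.
have -> : cells s3 v' k' = cells s2 v' k' by rewrite /cells !f3.1 ?f3.2.
by rewrite hc2 // hup hc1.
Qed.

(** Updating in place is harmless: the update of a cell reads that cell and row [u], which differs
    from row [v]. *)
Lemma pair_loop_ok s u v : pair_ok u v s -> u < v -> v < N -> imem s 49 0 = 0 ->
  runs (For 19 14 cell_body) s (for_time P (ccost cell_body)) (fun s' =>
    forall v' k', k' < P -> cells s' v' k' =
      if v' == v then update (cells s) u v k' else cells s v' k').
Proof.
move=> hs huv hvN hr; apply: runs_imp.
  apply: (runs_for (Inv := fun j s' => imem s' 49 0 = j %% md (ncolor G v) /\
    forall v' k', k' < P -> cells s' v' k' =
      if (v' == v) && (k' < j) then update (cells s) u v k' else cells s v' k')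
    (dp_P (pair_dp hs))) => //.
    by rewrite mod0n; split=> // v' k' _; rewrite andbF.
  move=> j s1 hj [hm hc] hx hf.
  have hs1 : pair_ok u v s1 by apply: pair_frame hf _ hs.
  apply: runs_imp (cell_body_ok hs1 hj huv hvN hx hm) _.
  move=> s2 [h49 hc2]; split=> // v' k' hk'.
  have -> : cells (set_scalar 19 j.+1 s2) v' k' = cells s2 v' k' by [].
  rewrite hc2 // ltnS leq_eqVlt.
  case: (eqVneq v' v) => [->|hv] /=; last by rewrite hc // (negbTE hv).
  case: (eqVneq k' j) => [->|hkj] /=; last by rewrite hc // eqxx.
  have e1 : cells s1 v j = cells s v j by rewrite hc // eqxx ltnn.
  rewrite /update e1; case: ifP => // he; case hst: (nstep u v j) => [k|] //.
  have hk : k < P by apply: leq_ltn_trans hj; apply: step_le hst.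
  have hne : (u == v) = false by apply/eqP => e; rewrite e ltnn in huv.
  by rewrite !hc // hne.
move=> s' [[_ h] _ _] v' k' hk'; rewrite h // hk' andbT //.
Qed.

Definition rows_done T (v : nat) : Prop :=
  (0 < v -> forall kap, kap < P -> cF (T 0 kap) /\ cD (T 0 kap) = 0%R) /\
  (forall v' kap, 0 < v' -> v' < v -> kap < P -> cell_ok T v' v' kap).

(** Cells start as zeros, that is, as unreached; so each row begins by satisfying the recurrence
    over no predecessors. *)
Definition unreached T (v : nat) : Prop :=
  forall v' kap, 0 < v' -> v <= v' -> kap < P -> ~~ cF (T v' kap).

Definition pair_time : nat := for_time P (ccost cell_body) + 400.

Lemma pair_body_ok s u v : dp_ok s -> u < v -> v < N -> imem s 16 0 = v ->
  imem s 18 0 = u ->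
  runs pair_body s pair_time (fun s' => forall v' k', k' < P -> cells s' v' k' =
      if v' == v then update (cells s) u v k' else cells s v' k').
Proof.
move=> hs huv hvN hxv hxu.
suff h : runs pair_body s (ccost pair_prep +
    (ccost (49 <-- IConst 0) + for_time P (ccost cell_body)).+1).+1
    (fun s' => forall v' k', k' < P -> cells s' v' k' =
      if v' == v then update (cells s) u v k' else cells s v' k').
  apply: runs_weaken h _ _ => //; rewrite /pair_time.
  have : ccost pair_prep <= 300 by [].
  by rewrite [ccost (_ <-- _)]/=; lia.
apply: runs_seq (runs_frame (pair_prep_ok hs huv hvN hxv hxu)) _ => s1 [h1 f1].
have hc1 v' k' : cells s1 v' k' = cells s v' k' by rewrite /cells !f1.1 ?f1.2.
apply: runs_seq.
  by apply: runs_frame; apply: (@runs_wp _ _ _ (fun s' => imem s' 49 0 = 0)).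
move=> s2 [h49 f2]; have h2 : pair_ok u v s2 by apply: pair_frame f2 _ h1.
have hc2 v' k' : cells s2 v' k' = cells s v' k'.
  by rewrite -hc1 /cells !f2.1 ?f2.2.
apply: runs_imp (pair_loop_ok h2 huv hvN h49) _ => s3 h3 v' k' hk'.
rewrite h3 // !hc2; case: ifP => // _.
by rewrite /update; case: ifP => // _; case: (nstep u v k') => [k|] //; rewrite !hc2.
Qed.

Lemma row_loop_ok s v : dp_ok s -> v < N -> imem s 16 0 = v ->
  rows_done (cells s) v -> unreached (cells s) v ->
  (v = 0 -> forall kap, kap < P -> cF (cells s 0 kap) /\ cD (cells s 0 kap) = 0%R) ->
  runs (For 18 16 pair_body) s (for_time N pair_time)
    (fun s' => rows_done (cells s') v.+1 /\ unreached (cells s') v.+1).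
Proof.
move=> hs hvN hx hr hun hv0.
pose Inv u s' := [/\ rows_done (cells s') v, v = 0 -> forall kap, kap < P ->
      cF (cells s' 0 kap) /\ cD (cells s' 0 kap) = 0%R,
    0 < v -> forall kap, kap < P -> cell_ok (cells s') u v kap &
    unreached (cells s') v.+1].
apply: (@runs_weaken _ _ _ (for_time v pair_time) _ (Inv v)); last first.
- move=> s' [[b1 b2] h0 h1 h2]; split=> //; split.
  + by move=> _; case: (posnP v) => [/h0|/b1].
  + move=> v' kap hv' ; rewrite ltnS leq_eqVlt => /orP [/eqP e|]; last exact: b2.
    by rewrite e in hv' *; apply: h1.
- by rewrite /for_time leq_add2r leq_mul2r (ltnW hvN) orbT.
apply: runs_imp.
  apply: (runs_for (Inv := Inv) hx) => //.
    split=> // [hv kap hk|v' kap hv' hvv hk].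
      split=> [|w kap' //]; by move=> h; have := hun v kap hv (leqnn v) hk; rewrite h.
    by apply: hun => //; apply: ltnW.
  move=> u s1 huv [hR h0 h1 h2] hxu hf.
  have hs1 : dp_ok s1 by apply: dp_frame hf _ hs.
  have hxv1 : imem s1 16 0 = v by rewrite hf.1.
  apply: runs_imp (pair_body_ok hs1 huv hvN hxv1 hxu) _ => s2 hc.
  have hv : 0 < v by apply: leq_ltn_trans huv.
  have low v' k' : v' < v -> k' < P -> cells s2 v' k' = cells s1 v' k'.
    by move=> h h'; rewrite hc //; case: eqP => // e; rewrite e ltnn in h.
  have -> : Inv u.+1 (set_scalar 18 u.+1 s2) = Inv u.+1 s2 by [].
  split.
  - case: hR => b1 b2; split=> [_ kap hk|v' kap hv' hlt hk].
      by rewrite low //; apply: b1.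
    apply: (@cell_ok_ext (cells s1)) => //; last exact: b2.
      by move=> w kap' hw; apply: low; apply: ltn_trans hlt.
    exact: low.
  - by move=> e; rewrite e in hv.
  - move=> _ kap hk; apply: (cell_ok_update huv hk low); last exact: h1.
    by rewrite hc // eqxx.
  - move=> v' kap hv' hlt hk; rewrite hc //.
    case: eqP => [e|_]; first by rewrite e ltnn in hlt.
    exact: h2.
by move=> s' [].
Qed.

Definition dp_time : nat :=
  for_time N 40 + for_time P 40 + for_time N (for_time N pair_time) + 20.

(* The offsets are not yet in place, so the hypotheses cannot be [dp_ok s]. *)
Lemma dp_prog_ok s : tables_ok s -> imem s 14 0 = P -> imem s 29 = wt ->
  imem s 30 = md -> imem s 32 = (fun=> 0) -> rmem s 14 = (fun=> 0%R) ->
  runs dp_prog s dp_time (fun s' => [/\ dp_ok s', rows_done (cells s') N &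
    frame (imods dp_prog) (rmods dp_prog) s s']).
Proof.
move=> hs hP hw hm hF0 hD0.
pose c0 := 44 <-- IConst 0; pose c1 := 32 [V 19]<- IConst 1.
suff h : runs dp_prog s (ccost c0 + (for_time N (ccost offset_body) +
    (for_time P (ccost c1) + for_time N (for_time N pair_time)).+1).+1).+1
    (fun s' => dp_ok s' /\ rows_done (cells s') N).
  apply: runs_weaken (runs_frame h) _ _; last by move=> s' [[]].
  rewrite /dp_time; have : for_time N (ccost offset_body) <= for_time N 40.
    by rewrite /for_time leq_add2r leq_mul2l leq_add2r orbT.
  have : for_time P (ccost c1) <= for_time P 40.
    by rewrite /for_time leq_add2r leq_mul2l leq_add2r orbT.
  by rewrite [ccost c0]/=; lia.
apply: runs_seq.
  by apply: runs_frame; apply: (@runs_wp _ _ _ (fun s' => imem s' 44 0 = 0)).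
move=> s1 [h1 f1]; have hs1 : tables_ok s1 by apply: tables_frame f1 _ hs.
apply: runs_seq.
  apply: (runs_for (Inv := fun v s => imem s 44 0 = v * P /\
     forall u, u < v -> imem s 31 u = u * P) (base_N (nodes_base (tables_nodes hs1)))) => //.
  move=> v s2 hv [hp hr] hx hf.
  have hP2 : imem s2 14 0 = P by rewrite hf.1 // f1.1.
  apply: runs_wp => //=; rewrite /upd /= !hp !hx hP2; split; first by rewrite mulSn addnC.
  exact: prefixS.
move=> s2 [[_ h2] _ f2]; have f12 := frame_cat f1 f2.
have hs2 : tables_ok s2 by apply: tables_frame f12 _ hs.
have hd2 : dp_ok s2 by split; [exact: hs2 | rewrite f12.1 | rewrite f12.1 | rewrite f12.1 | exact: h2].
apply: runs_seq.
  apply: (runs_for (Inv := fun j s => forall a, imem s 32 a = (a < j))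
    (dp_P hd2)) => //.
    by move=> a; rewrite ltn0 /= /upd /= f12.1 // hF0.
  move=> j s3 hj hI hx hf; apply: runs_wp => //= a; rewrite /upd /= hx hI ltnS.
  by rewrite [a <= j]leq_eqVlt; case: eqP.
move=> s3 [h3 _ f3]; have hd3 : dp_ok s3 by apply: dp_frame f3 _ hd2.
have hD3 : rmem s3 14 = (fun=> 0%R) by rewrite f3.2 // f12.2.
apply: runs_imp.
  apply: (runs_for (Inv := fun v s' => [/\ rows_done (cells s') v,
    unreached (cells s') v & v = 0 -> forall kap, kap < P ->
      cF (cells s' 0 kap) /\ cD (cells s' 0 kap) = 0%R])
    (base_N (nodes_base (tables_nodes (dp_tables hd3))))) => //.
    split=> // [v kap hv _ hk|_ kap hk].
      rewrite /cF /= /upd /= h3; case: v hv => // v _.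
      by have -> : (v.+1 * P + kap < P) = false by rewrite mulSn; lia.
    by rewrite /cF /cD /= /upd /= h3 hD3 mul0n add0n hk.
  move=> v s4 hv [i1 i2 i3] hx hf; have hd4 : dp_ok s4 by apply: dp_frame hf _ hd3.
  apply: runs_imp (row_loop_ok hd4 hv hx i1 i2 i3) _ => s5 [b1 b2].
  by split.
by move=> s4 [[h4 _ _] _ f4]; split=> //; apply: dp_frame f4 _ hd3.
Qed.

Lemma rows_bellman T : rows_done T N -> bellman G wt md P
  (fun v kap => cF (T v kap)) (fun v kap => cD (T v kap))
  (fun v kap => cPR (T v kap)) (fun v kap => cPK (T v kap)).
Proof.
move=> [h0 h1]; split.
- by apply: h0; rewrite addn1.
- by move=> v kap hv hvN hk hF; have [h _] := h1 v kap hv hvN hk; have [] := h hF.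
- move=> u v kap kap' hvN hk he hs hF; have huv : u < v by case/andP: he.
  have [_ h] := h1 v kap (leq_ltn_trans (leq0n u) huv) hvN hk.
  exact: (h u kap' huv he hs hF).
Qed.

End DynamicProgram.

(** * Reading off the labeling *)

Definition visit_read : com :=
  35 <-- IAdd (ILoad 31 (V 52)) (V 53) ;;
  55 <-- ILoad 33 (V 35) ;; 56 <-- ILoad 34 (V 35).

Definition visit_label : com :=
  If (BIEq (ILoad 22 (V 52)) (V 11)) Skip
    (4 [V 54]<- ILoad 22 (V 52) ;; 5 [V 54]<~ RLoad 11 (V 52) ;;
     54 <-- IAdd (V 54) (IConst 1)).

(** Labels are numbered in the order of the visit, from the bottom, and scalar 54 already counts the
    current node if it is a label. A point of another color belongs to the node visited next, whose
    number will be the present value of scalar 54. Scanning all points at each node stays within a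
    quadratic total. *)
Definition assign_body : com :=
  If (BAnd (BILe (ILoad 24 (V 55)) (V 17))
           (BILe (IAdd (V 17) (IConst 1)) (ILoad 24 (V 52))))
    (If (BIEq (ILoad 1 (V 17)) (ILoad 22 (V 52)))
       (5 [V 17]<- ISub (V 54) (IConst 1)) (5 [V 17]<- V 54)) Skip.

Definition visit_next : com := 52 <-- V 55 ;; 53 <-- V 56.

Definition visit : com :=
  visit_read ;; visit_label ;; For 17 10 assign_body ;; visit_next.

Definition back_start : com :=
  3 [IConst 0]<- IConst 1 ;; 52 <-- ISub (V 12) (IConst 1) ;;
  53 <-- ISub (V 14) (IConst 1) ;; 54 <-- IConst 0.

(** The length of the walk is not known, but node numbers decrease, so a guarded loop over the
    number of nodes suffices. *)
Definition back_prog : com :=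
  back_start ;;
  For 16 12 (If (BILe (IConst 1) (V 52)) visit Skip) ;;
  3 [IConst 1]<- V 54.

Definition out_prog : com :=
  35 <-- IAdd (ILoad 31 (ISub (V 12) (IConst 1))) (ISub (V 14) (IConst 1)) ;;
  If (BILe (IConst 1) (ILoad 32 (V 35))) back_prog Skip.

Arguments labs : simpl never.

Section Output.
Variables (R : realType) (G : config R) (bound : nat -> nat).
Variables (wt md : nat -> nat) (P : nat).
Hypothesis wf : wf_config G.
Hypothesis P_gt0 : 0 < P.
Local Notation n := (cfg_n G).
Local Notation q := (cfg_q G).
Local Notation N := (4 * n + 1).
Local Notation dp_ok := (dp_ok G bound wt md P).
Implicit Types s : state R.

(* The index of the owner of point [i] among the labels, when [k] labels have
   been listed before [v]. *)
Fixpoint owner_index (k v : nat) (us : seq nat) (i : nat) : nat :=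
  if us is u :: us' then
    let k' := k + (ncolor G v != q) in
    if nbelow u <= i then (if cfg_c G i == ncolor G v then k' - 1 else k')
    else owner_index k' u us' i
  else k.

Lemma labs_cons v vs : labs G (v :: vs) =
  if ncolor G v == q then labs G vs else v :: labs G vs.
Proof. by rewrite /labs /=; case: (ncolor G v == q). Qed.

Lemma owner_indexE k v us i : chain G v us -> i < nbelow v -> i < n ->
  owner_index k v us i = k + index (owner G v us i) (labs G (v :: us)).
Proof.
elim: us k v => [|u us IH] k v; first by rewrite chain_nil => /eqP ->.
move=> hch hi hin; have huniq := chain_uniq hch; have hcol := owner_color hch hi.
move: (hch); rewrite chain_cons => /andP [he hch'].
have hq : cfg_c G i == q = false by have := wf_c wf hin; lia.
have huv : u < v by case/andP: he.
rewrite /=; rewrite /= in hcol; case: leqP hcol => hu hcol; last first.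
  rewrite IH // -addnA (labs_cons v); congr (_ + _).
  case: (ncolor G v == q) => //=; case: (eqVneq v (owner G u us i)) => [e|_] //.
  by case/andP: huniq => /negP []; rewrite e; exact: owner_mem.
case: (eqVneq (cfg_c G i) (ncolor G v)) hcol => [e|e] hcol.
  by rewrite labs_cons -e hq /= eqxx addn1 subn1 addn0.
rewrite !labs_cons hcol hq; case: (ncolor G v == q) => /=; first by rewrite eqxx.
by rewrite eqxx; case: eqP => // e'; rewrite e' ltnn in huv.
Qed.

Fixpoint traces (T : nat -> nat -> cell R) (v kap : nat) (us : seq nat) : Prop :=
  if us is u :: us' then
    [/\ 0 < v, kap < P, u = cPR (T v kap) & traces T u (cPK (T v kap)) us']
  else v = 0.

Lemma trace_traces T f v kap : bellman G wt md P
  (fun v kap => cF (T v kap)) (fun v kap => cD (T v kap))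
  (fun v kap => cPR (T v kap)) (fun v kap => cPK (T v kap)) ->
  v <= f -> v < N -> kap < P -> cF (T v kap) ->
  traces T v kap (trace (fun v kap => cPR (T v kap)) (fun v kap => cPK (T v kap)) f v kap).
Proof.
move=> [h0 h1 h2]; elim: f v kap => [|f IH] v kap hvf hv hk hF.
  by move: hvf; rewrite leqn0 => /eqP.
rewrite [trace _ _ _ _ _]/=; case: posnP => hv0 //=.
have [he hs hF' _] := h1 v kap hv0 hv hk hF.
have huv : cPR (T v kap) < v by case/andP: he.
split=> //; apply: IH => //.
- exact: leq_trans huv hvf.
- exact: ltn_trans huv hv.
- by apply: leq_ltn_trans hk; apply: step_le hs.
Qed.

Definition listed s (ls : seq nat) : Prop :=
  forall l, l < size ls -> imem s 4 l = ncolor G (nth 0 ls l) /\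
                           rmem s 5 l = nheight G (nth 0 ls l).

Variables (T : nat -> nat -> cell R) (us : seq nat).
Hypothesis us_chain : chain G (4 * n) us.

Definition owner_at := owner_index 0 (4 * n) us.

Definition visiting s (cur kap : nat) (rest ls : seq nat) : Prop :=
  [/\ imem s 52 0 = cur, imem s 53 0 = kap, imem s 54 0 = size ls, listed s ls &
      forall i, nbelow cur <= i -> i < n -> imem s 5 i = owner_at i] /\
  [/\ chain G cur rest, traces T cur kap rest,
      labs G (4 * n :: us) = ls ++ labs G (cur :: rest) &
      forall i, i < nbelow cur -> owner_at i = owner_index (size ls) cur rest i].

Lemma visit_label_ok s cur ls : dp_ok s -> cur < N -> imem s 52 0 = cur ->
  imem s 54 0 = size ls -> listed s ls ->
  let ls' := if ncolor G cur == q then ls else rcons ls cur in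
  runs visit_label s (ccost visit_label) (fun s' =>
    imem s' 54 0 = size ls' /\ listed s' ls').
Proof.
move=> hs hcur h52 h54 hls /=; have hn := tables_nodes (dp_tables hs).
apply: runs_wp => //=; rewrite h52 (att_color hn hcur) (base_q (nodes_base hn)) -eqn_leq.
case: ifP => hq; first by rewrite ?hq.
rewrite /upd /= ?hq h54 ?h52 ?(att_color hn hcur) ?(att_height hn hcur).
rewrite size_rcons addn1; split=> // l; rewrite size_rcons ltnS /= nth_rcons.
rewrite leq_eqVlt => /orP [/eqP ->|hl]; first by rewrite eqxx ltnn.
by rewrite hl; case: eqP => [e|_]; [rewrite e ltnn in hl | apply: hls].
Qed.

Lemma assign_ok s cur u k (f : nat -> nat) : dp_ok s -> cur < N -> u < cur ->
  imem s 52 0 = cur -> imem s 55 0 = u -> imem s 54 0 = k ->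
  (forall i, nbelow cur <= i -> i < n -> imem s 5 i = f i) ->
  (forall i, nbelow u <= i -> i < nbelow cur ->
     f i = if cfg_c G i == ncolor G cur then k - 1 else k) ->
  runs (For 17 10 assign_body) s (for_time n (ccost assign_body))
    (fun s' => forall i, nbelow u <= i -> i < n -> imem s' 5 i = f i).
Proof.
move=> hs hcur hu h52 h55 h54 h1 h2; have huN := ltn_trans hu hcur.
have hn := tables_nodes (dp_tables hs); apply: runs_imp.
  apply: (runs_for (Inv := fun j s => forall i, nbelow u <= i -> i < n ->
     (i < j) || (nbelow cur <= i) -> imem s 5 i = f i) (base_n (nodes_base hn))) => //.
    by move=> i _ hi; rewrite ltn0 /=; move: i hi => i hi h; apply: h1.
  move=> j s1 hj hI hx hf.
  have hs1 : dp_ok s1 by apply: dp_frame hf _ hs.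
  have hn1 := tables_nodes (dp_tables hs1).
  have [e1 e2 e3] : [/\ imem s1 52 0 = cur, imem s1 55 0 = u & imem s1 54 0 = k].
    by rewrite !hf.1.
  apply: runs_wp => //=; rewrite hx e1 e2 e3 (att_color hn1 hcur) (att_below hn1 hcur)
    (att_below hn1 huN) (base_c (nodes_base hn1)) -eqn_leq addn1.
  case: ifP => hr; last first.
    move=> i h3 h4; rewrite /= /upd /= => h5; apply: hI => //.
    move: h5; rewrite ltnS leq_eqVlt; case: eqP => [e|_] //=; rewrite e in h3 *.
    by move=> _; apply/orP; right; move: hr; rewrite h3 /= => /negbT; rewrite -leqNgt.
  case/andP: hr => hr1 hr2.
  have old i : i <> j -> nbelow u <= i -> i < n -> (i < j.+1) || (nbelow cur <= i) ->
      imem s1 5 i = f i.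
    by move=> ne h3 h4 h5; apply: hI => //; move: h5; rewrite ltnS leq_eqVlt; case: eqP.
  by case: ifP => hc i h3 h4; rewrite /= /upd /=; case: eqP => [-> _|ne h5];
    [rewrite h2 // hc | exact: old | rewrite h2 // hc | exact: old].
by move=> s' [h _ _] i h3 h4; apply: h => //; rewrite h4.
Qed.

Lemma visit_ok s cur kap rest ls : dp_ok s ->
  (forall v k, cells P s v k = T v k) -> 0 < cur -> cur < N ->
  visiting s cur kap rest ls ->
  runs visit s (for_time n (ccost assign_body) + 200) (fun s' =>
    exists cur' kap' rest' ls', cur' < cur /\ visiting s' cur' kap' rest' ls').
Proof.
move=> hs hT hcur hcurN [[h52 h53 h54 hls hasg] [hch htr hlab hown]].
case: rest hch htr hlab hown => [|u rest].
  by rewrite chain_nil => /eqP e; rewrite e in hcur.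
move=> hch [_ hk hu htr] hlab hown.
move: (hch); rewrite chain_cons => /andP [he hch'].
have hucur : u < cur by case/andP: he.
have hbn : nbelow cur <= n by apply: nbelow_le; lia.
set kap' := cPK (T cur kap) in htr.
set ls' := if ncolor G cur == q then ls else rcons ls cur.
suff h : runs visit s (ccost visit_read + (ccost visit_label +
    (for_time n (ccost assign_body) + ccost visit_next).+1).+1).+1
    (fun s' => visiting s' u kap' rest ls').
  apply: runs_weaken h _ _; last by move=> s' h; exists u, kap', rest, ls'.
  by rewrite [ccost visit_read]/= [ccost visit_label]/= [ccost visit_next]/=; lia.
apply: runs_seq.
  apply: runs_frame; apply: (@runs_wp _ _ _ (fun s' =>
    imem s' 55 0 = u /\ imem s' 56 0 = kap')) => //=.
  rewrite /upd /= h52 h53 (dp_off hs hcurN) hu /kap' -hT.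
  by split.
move=> s1 [[h55 h56] f1].
have hs1 : dp_ok s1 by apply: dp_frame f1 _ hs.
have h521 : imem s1 52 0 = cur by rewrite f1.1.
have h541 : imem s1 54 0 = size ls by rewrite f1.1.
have hls1 : listed s1 ls by move=> l hl; rewrite f1.1 // f1.2 //; apply: hls.
apply: runs_seq (runs_frame (visit_label_ok hs1 hcurN h521 h541 hls1)) _.
rewrite -/ls' => s2 [[h542 hls2] f2]; have f12 := frame_cat f1 f2.
have hs2 : dp_ok s2 by apply: dp_frame f12 _ hs.
have h522 : imem s2 52 0 = cur by rewrite f2.1.
have h552 : imem s2 55 0 = u by rewrite f2.1.
have hasg2 i : nbelow cur <= i -> i < n -> imem s2 5 i = owner_at i.
  by move=> h1 h2; rewrite f12.1 //; apply: hasg.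
have hsz : size ls' = size ls + (ncolor G cur != q).
  by rewrite /ls'; case: eqP => _; rewrite ?addn0 // size_rcons addn1.
have hown2 i : nbelow u <= i -> i < nbelow cur ->
    owner_at i = if cfg_c G i == ncolor G cur then size ls' - 1 else size ls'.
  by move=> h1 h2; rewrite hown // hsz /= h1.
apply: runs_seq (runs_frame (assign_ok hs2 hcurN hucur h522 h552 h542 hasg2 hown2)) _.
move=> s3 [hasg3 f3]; apply: runs_wp => //=.
have f23 := frame_cat f2 f3.
have [e1 e2 e3] : [/\ imem s3 55 0 = u, imem s3 56 0 = kap' & imem s3 54 0 = size ls'].
  by split; [rewrite f23.1 | rewrite f23.1 | rewrite f3.1].
split; split; rewrite /= /upd /= ?e1 ?e2 ?e3 //.
- by move=> l hl; rewrite /= f3.1 // f3.2 //; apply: hls2.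
- rewrite hlab labs_cons /ls'; case: ifP => // _; first by rewrite cat_rcons.
- move=> i hi; have hi' : i < nbelow cur by apply: leq_trans hi (nbelow_mono (ltnW hucur)).
  by rewrite hown // hsz /= leqNgt hi.
Qed.

Definition reported s : Prop :=
  let ls := labs G (4 * n :: us) in
  [/\ imem s 3 0 = 1, imem s 3 1 = size ls, listed s ls &
      forall i, i < n -> imem s 5 i = index (owner G (4 * n) us i) ls].

Hypothesis us_traces : traces T (4 * n) P.-1 us.

Definition out_time : nat := for_time N (for_time n (ccost assign_body) + 210) + 100.

Lemma back_prog_ok s : dp_ok s -> (forall v k, cells P s v k = T v k) ->
  runs back_prog s out_time reported.
Proof.
move=> hs hT.
set B := for_time N (for_time n (ccost assign_body) + 210).
suff h : runs back_prog s (ccost back_start + (B + ccost (3 [IConst 1]<- V 54)).+1).+1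
    reported.
  apply: runs_weaken h _ _ => //; rewrite /out_time -/B.
  by rewrite [ccost back_start]/= [ccost (_ [_]<- _)]/=; lia.
have hn := tables_nodes (dp_tables hs).
apply: runs_seq.
  apply: runs_frame; apply: (@runs_wp _ _ _ (fun s' => imem s' 3 0 = 1 /\
    [/\ imem s' 52 0 = 4 * n, imem s' 53 0 = P.-1 & imem s' 54 0 = 0])) => //=.
  by rewrite /upd /= (base_N (nodes_base hn)) (dp_P hs) addn1 !subn1.
move=> s1 [[h3 [h52 h53 h54]] f1].
have hs1 : dp_ok s1 by apply: dp_frame f1 _ hs.
have hT1 v k : cells P s1 v k = T v k by rewrite -hT /cells !f1.1 ?f1.2.
have hn1 := tables_nodes (dp_tables hs1).
apply: runs_seq.
  apply: (runs_for (Inv := fun j s' => exists cur kap rest ls,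
    cur <= 4 * n - j /\ visiting s' cur kap rest ls) (base_N (nodes_base hn1))) => //.
    exists (4 * n), P.-1, us, [::]; rewrite subn0; split=> //; split; split=> //.
    by move=> i; rewrite sep_nbelow => h1 h2; rewrite leqNgt h2 in h1.
  move=> j s2 hj [cur [kap [rest [ls [hcur hv]]]]] hx hf.
  have hs2 : dp_ok s2 by apply: dp_frame hf _ hs1.
  have hT2 v k : cells P s2 v k = T v k by rewrite -hT1 /cells !hf.1 ?hf.2.
  have [[h52' _ _ _ _] _] := hv.
  apply: (@runs_weaken _ _ _ (bcost (BILe (IConst 1) (V 52)) +
     (for_time n (ccost assign_body) + 200)).+1 _ _ _ _ _ (fun _ h => h)); last first.
    by rewrite /=; lia.
  apply: runs_if => /=; rewrite h52' => hb.
    apply: runs_imp (visit_ok hs2 hT2 hb _ hv) _; first by lia.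
    move=> s3 [cur' [kap' [rest' [ls' [hc' hv']]]]].
    by exists cur', kap', rest', ls'; split=> //; lia.
  apply: (@runs_weaken _ _ _ 1 _ _ _ (@runs_wp _ Skip _ _ isT _)) => //; first by lia.
  by move=> s3 <-; exists cur, kap, rest, ls; split=> //; lia.
move=> s2 [[cur [kap [rest [ls [hcur hv]]]]] _ f2].
have hc0 : cur = 0 by lia.
case: hv => -[h52' _ h54' hls hasg] [hch htr hlab _].
rewrite {}hc0 in hch hlab hasg; case: rest hch htr hlab => [|u rest] hch _ hlab; last first.
  by move: hch; rewrite chain_cons => /andP [/andP []].
have {}hlab : labs G (4 * n :: us) = ls.
  by rewrite hlab labs_cons ncolor0 eqxx cats0.
apply: runs_wp => //=; rewrite /upd /= h54'; split; rewrite ?hlab //=.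
- by rewrite /upd /= f2.1.
- move=> i hi; rewrite hasg // /owner_at owner_indexE // ?hlab //.
  by rewrite sep_nbelow.
Qed.

End Output.

(** * Assembly of the algorithm and its running time *)

Definition solve (cb : bool) (budget_prog : com) : com :=
  init_prog cb ;; nodes_prog ;; table_prog ;; budget_prog ;; dp_prog ;; out_prog.

Section ChainColors.
Variables (R : realType) (G : config R).
Hypothesis wf : wf_config G.
Local Notation n := (cfg_n G).
Local Notation q := (cfg_q G).

Lemma repeats_seen v us : chain G v us -> v <= 4 * n -> all (seen G n) (repeats G v us).
Proof.
elim: us v => [|u us IH] v //; rewrite chain_cons => /andP [he hch] hv.
have hu : u <= 4 * n by apply: leq_trans hv; case/andP: he => /ltnW.
rewrite /=; case: ifP => hf; first exact: IH.
rewrite /= IH // andbT /seen.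
have : 0 < cnt G (ncolor G v) (nbelow u) by rewrite lt0n -/(first_use G u v) hf.
by move/leq_trans; apply; apply: cnt_mono; apply: nbelow_le.
Qed.

Lemma labs_count us a : chain G (4 * n) us -> a < q ->
  count (fun v => ncolor G v == a) (labs G (4 * n :: us)) =
  count_mem a (repeats G (4 * n) us) + seen G n a.
Proof.
move=> hch ha; have haq : a != q by rewrite neq_ltn ha.
have := chain_count hch (leqnn _) haq.
rewrite sep_nbelow sep_color [q == a]eq_sym (negbTE haq) orbF => <-.
rewrite count_filter; apply: eq_count => v /=.
by case: eqP => // ->.
Qed.

Lemma size_sum_count (s : seq nat) : all (fun a => a < q) s ->
  \sum_(a < q) count_mem (val a) s = size s.
Proof.
elim: s => [|b s IH] /=; first by rewrite big1.
case/andP=> hb hs; rewrite big_split /= IH // -[RHS]add1n; congr (_ + _).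
rewrite (bigD1 (Ordinal hb)) //= eqxx big1 // => a ha.
by case: eqP => // e; case/eqP: ha; apply: val_inj.
Qed.

(** Every occurring color has exactly one free label in a chain, so bounding all labels by [K]
    amounts to bounding the charged ones by [K - nseen n]. *)
Lemma size_labs us : chain G (4 * n) us ->
  size (labs G (4 * n :: us)) = size (repeats G (4 * n) us) + nseen G n.
Proof.
move=> hch; rewrite -(size_map (ncolor G)) -[LHS]size_sum_count; last first.
  apply/allP => a /mapP [v hv ->]; move: hv; rewrite mem_filter => /andP [h1 h2].
  exact: (label_color wf (chain_le hch (leqnn _) h2) h1).
rewrite -[X in _ = X + _]size_sum_count; last first.
  by apply: sub_all (repeats_seen hch (leqnn _)) => a; apply: seen_lt.
rewrite /nseen -big_split /=; apply: eq_bigr => a _.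
by rewrite count_map labs_count.
Qed.

End ChainColors.

Section Main.
Variables (R : realType) (I : instance R) (cb : bool) (bound : nat -> nat).
Hypothesis wfI : wf_instance I.
Local Notation G := (config_of I cb).
Local Notation n := (npts I).
Local Notation N := (4 * n + 1).
Let wf : wf_config G := wf_config_of cb wfI.

Lemma init_ok : runs (init_prog cb) (init_state I bound) (ccost (init_prog cb))
  (base G bound).
Proof.
apply: runs_wp => //; rewrite /init_prog /=; split; rewrite /= /upd //=; last by case: cb.
- by lia.
- by rewrite addn1.
Qed.

(** What the common program needs to know about a kind of bound. Chains yield labelings with equal
    label counts, and labelings yield chains with no larger ones; the two directions are asked for
    in exactly these forms. *)
Definition budget_for (adm : labeling I -> Prop) (wt md : nat -> nat) (P : nat) : Prop :=
  forall us, chain G (4 * n) us ->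
  let ls := labs G (4 * n :: us) in
  let aff := affordable wt md P.-1 (repeats G (4 * n) us) in
  (forall L : labeling I, aff -> nlab L = size ls ->
    (forall a : 'I_(ncol I), #|[pred l : 'I_(nlab L) | lcol l == a]| =
       count (fun v => ncolor G v == a) ls) -> adm L) /\
  (forall L : labeling I, adm L -> size ls <= nlab L ->
    (forall a : 'I_(ncol I), count (fun v => ncolor G v == a) ls <=
       #|[pred l : 'I_(nlab L) | lcol l == a]|) -> aff).

Definition fixed_time : nat :=
  ccost (init_prog cb) +
  (for_time n (ccost prev_body) + for_time n (ccost next_body) +
   for_time n (ccost node_body) + 100) +
  (for_time N (for_time n (ccost row_body) + 40) + 10) + out_time G + 100.

Lemma solve_ok adm bp Tb M :
  untouched (imods bp) (rmods bp) [:: 3; 32] [:: 14] ->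
  (forall s, tables_ok G bound s -> runs bp s Tb (fun s' => exists2 P, P <= M &
     budget_ok G bound P s' /\ budget_for adm (imem s' 29) (imem s' 30) P)) ->
  computes_minimum (solve cb bp) bound cb adm
    (fixed_time + Tb + dp_time G M).
Proof.
move=> hbp hb; pose s0 := init_state I bound.
pose final (s : state R) := (exists L, outputs s L /\ minimum_length cb adm L)
  \/ (reports_infeasible s /\ ~ exists L : labeling I, backbone_labeling L /\ adm L).
suff : runs (solve cb bp) s0 (fixed_time + Tb + dp_time G M) final.
  by case=> t [s [h1 h2 h3]]; exists t, s.
pose T5 := (35 <-- IAdd (ILoad 31 (ISub (V 12) (IConst 1))) (ISub (V 14) (IConst 1))).
pose T6 := bcost (BILe (IConst 1) (ILoad 32 (V 35))).
suff h : runs (solve cb bp) s0 (ccost (init_prog cb) +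
    ((for_time n (ccost prev_body) + for_time n (ccost next_body) +
      for_time n (ccost node_body) + 100) +
     ((for_time N (for_time n (ccost row_body) + 40) + 10) +
      (Tb + (dp_time G M + (ccost T5 + (T6 + out_time G).+1).+1).+1).+1).+1).+1).+1 final.
  apply: runs_weaken h _ _ => //; rewrite /fixed_time [ccost T5]/= /T6 [bcost _]/=.
  by lia.
apply: runs_seq (runs_frame init_ok) _ => s1 [hs1 f1].
apply: runs_seq (nodes_prog_ok hs1) _ => s2 [hs2 f2].
apply: runs_seq (table_prog_ok hs2) _ => s3 [hs3 f3].
apply: runs_seq (runs_frame (hb s3 hs3)) _ => s4 [[P hPM [[ht4 hP4 hP0] hadm]] f4].
have i32 : imem s4 32 = (fun=> 0).
  by rewrite (frame_i f4 hbp) // f3.1 // f2.1 // f1.1.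
have i3 : imem s4 3 = (fun=> 0).
  by rewrite (frame_i f4 hbp) // f3.1 // f2.1 // f1.1.
have r14 : rmem s4 14 = (fun=> 0%R).
  by rewrite (frame_r f4 hbp) // f3.2 // f2.2 // f1.2.
have hdp := dp_prog_ok hP0 ht4 hP4 erefl erefl i32 r14.
have htm : dp_time G P <= dp_time G M.
  rewrite /dp_time /pair_time /for_time /=; do ?[apply: leq_add | apply: leq_mul] => //.
apply: runs_seq.
  by apply: runs_weaken hdp htm (fun _ h => h).
move=> s5 [hd5 hr5 f5]; set wt := imem s4 29 in hdp hd5 hr5 hadm.
set md := imem s4 30 in hdp hd5 hr5 hadm.
have hB := rows_bellman hr5; set T := cells P s5 in hr5 hB.
have hN : 4 * n < N by rewrite addn1.
have hPP : P.-1 < P by rewrite prednK.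
(* Used twice: for the optimality of the output, and for infeasibility when the last cell is not
   reached. *)
have hopt (L : labeling I) : backbone_labeling L -> adm L ->
    cF (T (4 * n) P.-1) /\ (cD (T (4 * n) P.-1) <= labeling_length cb L)%R.
  move=> hL hA; have [us [h1 h2 h3 h4]] := completeness_of cb wfI hL.
  have [_ haff] := hadm us h1.
  have [hF hD] := bellman_optimal hB h1 hN hPP (haff L hA h3 h2).
  by split=> //; apply: le_trans hD h4.
apply: runs_seq.
  apply: runs_frame; apply: (@runs_wp _ _ _ (fun s' =>
    imem s' 35 0 = 4 * n * P + P.-1)) => //=.
  have hb5 := nodes_base (tables_nodes (dp_tables hd5)).
  rewrite /upd /= (base_N hb5) addn1 subn1 (dp_off hd5) /= ?addn1 //.
  by rewrite (dp_P hd5) subn1.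
move=> s6 [h35 f6]; have hd6 : dp_ok G bound wt md P s6 by apply: dp_frame f6 _ hd5.
have hT6 v k : cells P s6 v k = T v k by rewrite /T /cells !f6.1 ?f6.2.
have hF6 : (0 < imem s6 32 (imem s6 35 0)) = cF (T (4 * n) P.-1).
  by rewrite h35 -hT6.
apply: runs_if => /=; rewrite hF6 => hF.
  have [hch haff hlen] := trace_chain hB (leqnn _) hN hPP hF.
  have htr := trace_traces hB (leqnn _) hN hPP hF.
  set us := trace _ _ _ _ _ in hch haff hlen htr.
  apply: runs_imp (back_prog_ok wf hP0 hch htr hd6 hT6) _ => s7 [o1 o2 o3 o4].
  have [L [[l1 l2 l3 l4] [l5 l6 l7]]] := soundness wfI hch.
  have [hsound _] := hadm us hch.
  left; exists L; split.
    split=> //; first by rewrite o2 l2.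
    + by move=> l; rewrite l3; have [] := o3 l; rewrite -?l2.
    + by move=> l; rewrite l4; have [] := o3 l; rewrite -?l2.
    + by move=> p; rewrite l5 o4.
  split=> //; first by apply: hsound.
  by move=> L' hL' hA'; rewrite l6 hlen; have [] := hopt L' hL' hA'.
apply: runs_weaken (@runs_wp _ Skip s6 final isT _) _ (fun _ h => h) => /=.
  (* The success flag has never been written and still has its initial value 0. *)
  right; split; first by rewrite /reports_infeasible f6.1 // f5.1 // i3.
  by case=> L [hL hA]; have [h _] := hopt L hL hA; rewrite h in hF.
by rewrite /out_time; lia.
Qed.

End Main.

Lemma for_time_mono m m' B B' : m <= m' -> B <= B' -> for_time m B <= for_time m' B'.
Proof. by move=> hm hB; rewrite /for_time leq_add2r leq_mul // leq_add2r. Qed.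

(** Generous: the dominating loop makes [P] rounds of a few hundred steps for each of at most
    [25 * n ^ 2] pairs of nodes. The product avoids a large unary numeral. *)
Definition time_constant : nat := 200 * 200.

Lemma time_bound (cb : bool) (R : realType) (I : instance R) M Tb :
  wf_instance I -> 0 < M -> Tb <= 1000 * (npts I * M) ->
  fixed_time I cb + Tb + dp_time (config_of I cb) M <=
    time_constant * (npts I ^ 2 * M).
Proof.
case=> hn _ _ _ _ hM hTb.
have c1 : ccost (init_prog cb) <= 200 by case: cb.
have c2 : ccost prev_body <= 200 by [].
have c3 : ccost next_body <= 200 by [].
have c4 : ccost node_body <= 1000 by [].
have c5 : ccost row_body <= 200 by [].
have c6 : ccost assign_body <= 200 by [].
have c7 : ccost cell_body <= 400 by [].
set n := npts I in hn hTb *; pose N := 4 * n + 1.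
have t2 := for_time_mono (leqnn n) c2; have t3 := for_time_mono (leqnn n) c3.
have t4 := for_time_mono (leqnn n) c4.
have t5 : for_time N (for_time n (ccost row_body) + 40) <= for_time N (for_time n 200 + 40).
  by apply: for_time_mono => //; rewrite leq_add2r; apply: for_time_mono.
have t6 : for_time N (for_time n (ccost assign_body) + 210) <=
    for_time N (for_time n 200 + 210).
  by apply: for_time_mono => //; rewrite leq_add2r; apply: for_time_mono.
have t7 : for_time N (for_time N (for_time M (ccost cell_body) + 400)) <=
    for_time N (for_time N (for_time M 400 + 400)).
  by do 2 apply: for_time_mono => //; rewrite leq_add2r; apply: for_time_mono.
rewrite /fixed_time /dp_time /out_time /pair_time.
change (cfg_n (config_of I cb)) with n; rewrite -/n -/N.
apply: leq_trans (_ : 200 + (for_time n 200 + for_time n 200 + for_time n 1000 + 100) +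
  (for_time N (for_time n 200 + 40) + 10) + (for_time N (for_time n 200 + 210) + 100) +
  100 + 1000 * (n * M) + (for_time N 40 + for_time M 40 +
   for_time N (for_time N (for_time M 400 + 400)) + 20) <= _).
  by move: c1 t2 t3 t4 t5 t6 t7 hTb; clear; lia.
rewrite /time_constant /for_time /N expnS expn1.
have x1 : n * M <= n * n * M by rewrite leq_mul2r leq_pmulr ?orbT.
have x2 : n * n <= n * n * M by rewrite leq_pmulr.
have x3 : n <= n * n by rewrite leq_pmulr.
have x4 : M <= n * M by rewrite leq_pmull.
move: x1 x2 x3 x4; clear -hn hM; nia.
Qed.

Section Modes.
Variables (R : realType) (I : instance R) (cb : bool).
Hypothesis wfI : wf_instance I.
Local Notation G := (config_of I cb).
Local Notation n := (npts I).
Let wf : wf_config G := wf_config_of cb wfI.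

Lemma total_budget K (wt md : nat -> nat) : ncol I <= K ->
  (forall t, t < n -> wt (cfg_c G t) = 1 /\ md (cfg_c G t) = K - nseen G n + 1) ->
  budget_for cb (@total_bounded R I K) wt md (K - nseen G n + 1).
Proof.
move=> hK hwm us hch ls aff.
(* Here [K] being at least the number of colors makes the truncated subtraction exact. *)
have hle : nseen G n <= K by apply: leq_trans (nseen_le G n) hK.
have hall : all (seen G n) (repeats G (4 * n) us) := repeats_seen hch (leqnn _).
have -> : aff = (size ls <= K).
  rewrite /aff (@affordable_unit wt md (seen G n) (K - nseen G n + 1)) //.
  - by rewrite /ls (size_labs wf hch) addn1 /= leq_subRL // addnC.
  - by move=> a /cnt_gt0P [t ht <-]; apply: hwm.
  - by rewrite addn1.
split=> L h hL _; first by rewrite /total_bounded hL.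
exact: leq_trans hL h.
Qed.

(** The digits of [P.-1] allow [(k a).-1] charged labels of an occurring color, and the free one
    makes [k a]; other colors have no label in a chain. *)
Lemma color_budget (k : 'I_(ncol I) -> nat) (wt md : nat -> nat) P :
  (forall a, 0 < k a) -> 0 < P ->
  radix wt md (seen G n) (color_bounds_input k) P ->
  budget_for cb (color_bounded k) wt md P.
Proof.
move=> hk hP hrad us hch ls aff.
have hall : all (seen G n) (repeats G (4 * n) us) := repeats_seen hch (leqnn _).
have hb (a : 'I_(ncol I)) : color_bounds_input k a = k a by apply: arr_ord.
have hc (a : 'I_(ncol I)) := labs_count hch (ltn_ord a : a < cfg_q G).
have haff : aff <-> forall a : 'I_(ncol I), seen G n a ->
    count_mem (val a) (repeats G (4 * n) us) <= (k a).-1.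
  rewrite /aff (affordable_radix hrad) //; split=> h.
    by move=> a ha; have := h a ha; rewrite (radix_top hrad) // hb.
  move=> a ha; rewrite (radix_top hrad) //.
  have hlt : a < ncol I by apply: (seen_lt wf (leqnn n)).
  by have := h (Ordinal hlt) ha; rewrite -hb.
have hzero (a : 'I_(ncol I)) : ~~ seen G n a ->
    count_mem (val a) (repeats G (4 * n) us) = 0.
  move=> ha; apply/count_memPn; apply/negP => /(allP hall).
  by rewrite (negbTE ha).
split=> L.
  move=> /haff h _ hL a; rewrite hL /ls hc.
  case hs: (seen G n a); last by rewrite hzero ?hs.
  by have := h a hs; have := hk a; rewrite addn1; case: (k a).
move=> hA _ hL; apply/haff => a ha; have := leq_trans (hL a) (hA a).
by rewrite /ls hc ha addn1; case: (k a).
Qed.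

End Modes.

Lemma color_vector_case (cb : bool) : exists (prog : com) (A : nat),
  forall (R : realType) (I : instance R) (k : 'I_(ncol I) -> nat),
    wf_instance I -> (forall c : 'I_(ncol I), 0 < k c) ->
    computes_minimum prog (color_bounds_input k) cb (color_bounded k)
      (A * (npts I ^ 2 * \prod_(c < ncol I) k c)).
Proof.
exists (solve cb radix_prog), time_constant => R I k wfI hk.
have wf := wf_config_of cb wfI; set M := \prod_(c < _) _.
have hM : M = \prod_(a < ncol I) color_bounds_input k a.
  by apply: eq_bigr => a _; rewrite /color_bounds_input arr_ord.
have hpos a : a < cfg_q (config_of I cb) -> 0 < color_bounds_input k a.
  by move=> ha; rewrite /color_bounds_input (arr_Ordinal _ _ ha).
have hM0 : 0 < M by rewrite /M prodn_gt0.
pose Tb := for_time (npts I) (for_time M 20 + 100) + 10.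
have hTb : Tb <= 1000 * (npts I * M).
  have [hn _ _ _ _] := wfI; rewrite /Tb /for_time.
  have x1 : npts I <= npts I * M by rewrite leq_pmulr.
  by move: x1 hn; clear; nia.
have hrun s : tables_ok (config_of I cb) (color_bounds_input k) s ->
    runs radix_prog s Tb (fun s' => exists2 P, P <= M &
      budget_ok (config_of I cb) (color_bounds_input k) P s' /\
      budget_for cb (color_bounded k) (imem s' 29) (imem s' 30) P).
  move=> hs; apply: runs_weaken (radix_prog_ok wf hpos hs) _ _; first by rewrite /Tb hM.
  move=> s' [hbud hrad].
  exists (radix_size (config_of I cb) (color_bounds_input k) (npts I)).
    by rewrite hM; apply: radix_size_le.
  split=> //; apply: color_budget => //; exact: radix_size_gt0.
have [t [s [h1 h2 h3]]] := solve_ok wfI (bp := radix_prog) isT hrun.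
exists t, s; split=> //; apply: leq_trans h2 _; exact: time_bound.
Qed.

Lemma total_case (cb : bool) : exists (prog : com) (A : nat),
  forall (R : realType) (I : instance R) (K : nat),
    wf_instance I -> ncol I <= K ->
    computes_minimum prog (total_bound_input K) cb (@total_bounded R I K)
      (A * (npts I ^ 2 * K)).
Proof.
exists (solve cb total_prog), time_constant => R I K wfI hK.
have wf := wf_config_of cb wfI; have [hn _ _ _ _] := wfI.
have hq : 0 < ncol I.
  by apply: leq_ltn_trans (wf_c wf (hn : 0 < cfg_n (config_of I cb))).
have hK0 : 0 < K by apply: leq_trans hK.
pose Tb := for_time (npts I) (ccost count_body) + for_time (npts I) (ccost unit_body) + 40.
have hTb : Tb <= 1000 * (npts I * K).
  have c1 : ccost count_body <= 200 by [].
  have c2 : ccost unit_body <= 200 by [].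
  have t1 := for_time_mono (leqnn (npts I)) c1.
  have t2 := for_time_mono (leqnn (npts I)) c2.
  have x1 : npts I <= npts I * K by rewrite leq_pmulr.
  by move: t1 t2 x1 hn; rewrite /Tb /for_time; clear; lia.
have hrun s : tables_ok (config_of I cb) (total_bound_input K) s ->
    runs total_prog s Tb (fun s' => exists2 P, P <= K &
      budget_ok (config_of I cb) (total_bound_input K) P s' /\
      budget_for cb (@total_bounded R I K) (imem s' 29) (imem s' 30) P).
  move=> hs; apply: runs_imp (total_prog_ok wf hs) _ => s' [hbud hwm].
  exists (K - nseen (config_of I cb) (npts I) + 1).
    by have := nseen_gt0 wf; have := nseen_le (config_of I cb) (npts I); move: hK => /=; lia.
  by split=> //; apply: total_budget.
have [t [s [h1 h2 h3]]] := solve_ok wfI (bp := total_prog) isT hrun.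
exists t, s; split=> //; apply: leq_trans h2 _; exact: time_bound.
Qed.

Theorem theorem3 (count_backbones : bool) :
  (exists (prog : com) (A : nat),
     forall (R : realType) (I : instance R) (k : 'I_(ncol I) -> nat),
       wf_instance I ->
       (forall c : 'I_(ncol I), 0 < k c) ->
       computes_minimum prog (color_bounds_input k) count_backbones
         (color_bounded k)
         (A * (npts I ^ 2 * \prod_(c < ncol I) k c)))
  /\
  (exists (prog : com) (A : nat),
     forall (R : realType) (I : instance R) (K : nat),
       wf_instance I ->
       ncol I <= K ->
       computes_minimum prog (total_bound_input K) count_backbones
         (@total_bounded R I K)
         (A * (npts I ^ 2 * K))).
Proof. by split; [apply: color_vector_case | apply: total_case]. Qed.
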